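(* Let $\kappa$ be a measurable cardinal and let $\lambda\leq 2^\kappa$ be an infinite cardinal. Then the following are equivalent: (1) $\kappa$ has the ${<}\lambda^+$-$\mathrm{GP}$ via ultrafilters; (2) $\kappa$ has the $\lambda$-$\mathrm{GP}$ via ultrafilters; (3) $\kappa$ has the weak $\lambda$-$\mathrm{GP}$ via ultrafilters; (4) $\langle \mathfrak{U}_\kappa,\leq_{\mathrm{RK}}\rangle$ is $\lambda^+$-directed. Moreover, if $\lambda\leq\kappa$, then (1), (2), (3) are respectively equivalent to: (1') $\kappa$ has the ${<}\lambda^+$-$\mathrm{GP}$; (2') $\kappa$ has the $\lambda$-$\mathrm{GP}$; (3') $\kappa$ has the weak $\lambda$-$\mathrm{GP}$.
   Context: Let $\kappa$ be measurable and $\alpha\geq\omega$ an ordinal. $\kappa$ has the $\alpha$-Gluing Property ($\alpha$-$\mathrm{GP}$) if for every sequence $\langle U_\beta\mid\beta<\alpha\rangle$ of non-principal $\kappa$-complete ultrafilters on $\kappa$ there are a (definable) elementary embedding $j\colon V\to M$ with $\mathrm{crit}(j)=\kappa$ and $M^\kappa\subseteq M$, and a strictly increasing sequence of ordinals $\langle\eta_\beta\mid\beta<\alpha\rangle$ such that $U_\beta=\{X\subseteq\kappa\mid \eta_\beta\in j(X)\}$ for every $\beta<\alpha$. $\kappa$ has the ${<}\alpha$-$\mathrm{GP}$ if it has the $\beta$-$\mathrm{GP}$ for all $\beta<\alpha$. The weak $\alpha$-$\mathrm{GP}$ is the same but the sequence $\langle\eta_\beta\rangle$ need not be increasing. The $\alpha$-$\mathrm{GP}$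 (resp. weak, resp. ${<}\alpha$) ''via ultrafilters'' means the witnessing embeddings $j$ can be taken to be ultrapower embeddings $j_W\colon V\to\mathrm{Ult}(V,W)$ by $\kappa$-complete ultrafilters $W$ on $\kappa^{<\kappa}$. $\mathfrak{U}_\kappa$ is the set of $\kappa$-complete non-principal ultrafilters on $\kappa$; $U_0\leq_{\mathrm{RK}}U_1$ iff there is $\pi\colon\kappa\to\kappa$ with $X\in U_0\iff\pi^{-1}(X)\in U_1$; $\langle\mathfrak{U}_\kappa,\leq_{\mathrm{RK}}\rangle$ is $\theta$-directed if every subfamily of size $<\theta$ has a $\leq_{\mathrm{RK}}$-upper bound in $\mathfrak{U}_\kappa$. *)

(* Defs.v *)
(* The ambient universe is an arbitrary first-order model V of ZFC, so that the
   statement is the semantic form of "ZFC proves ...".  Sets are the elements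
   of V; proper classes are the predicates on V first-order definable with
   parameters from V.  *)

Record set_structure := SetStructure {
  carrier :> Type;
  mem : carrier -> carrier -> Prop
}.
Arguments mem {s} x y.

Declare Scope set_model_scope.
Notation "x ∈ y" := (mem x y) (at level 70, no associativity) : set_model_scope.
Open Scope set_model_scope.

Inductive formula : Type :=
| f_mem (m n : nat)
| f_eq (m n : nat)
| f_false
| f_imp (phi psi : formula)
| f_all (phi : formula).

Definition env_cons {T : Type} (x : T) (rho : nat -> T) (n : nat) : T :=
  match n with
  | O => x
  | S m => rho m
  end.

(* Satisfaction in the substructure with domain M, i.e. with the quantifiers
   relativized to the class M. *)
Fixpoint sat {V : set_structure} (M : V -> Prop) (rho : nat -> V)
    (phi : formula) : Prop :=
  match phi with
  | f_mem m n => rho m ∈ rho n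
  | f_eq m n => rho m = rho n
  | f_false => False
  | f_imp p q => sat M rho p -> sat M rho q
  | f_all p => forall x : V, M x -> sat M (env_cons x rho) p
  end.

Definition universe (V : set_structure) : V -> Prop := fun _ => True.

(* The assignment rho supplies the parameters. *)
Definition definable_class {V : set_structure} (P : V -> Prop) : Prop :=
  exists (phi : formula) (rho : nat -> V),
    forall x, P x <-> sat (universe V) (env_cons x rho) phi.

Definition definable_rel {V : set_structure} (R : V -> V -> Prop) : Prop :=
  exists (phi : formula) (rho : nat -> V),
    forall x y, R x y <-> sat (universe V) (env_cons x (env_cons y rho)) phi.

Definition definable_fun {V : set_structure} (F : V -> V) : Prop :=
  definable_rel (fun x y => F x = y).

Definition is_empty {V : set_structure} (e : V) : Prop := forall x, ~ x ∈ e.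

Definition subset {V : set_structure} (a b : V) : Prop :=
  forall x, x ∈ a -> x ∈ b.

Definition is_upair {V : set_structure} (c a b : V) : Prop :=
  forall x, x ∈ c <-> x = a \/ x = b.

Definition is_powerset {V : set_structure} (p a : V) : Prop :=
  forall x, x ∈ p <-> subset x a.

Definition is_succ {V : set_structure} (s a : V) : Prop :=
  forall x, x ∈ s <-> x ∈ a \/ x = a.

Record ZFC (V : set_structure) : Prop := {
  zfc_extensionality :
    forall a b : V, (forall x, x ∈ a <-> x ∈ b) -> a = b;
  zfc_foundation :
    forall a : V, (exists x, x ∈ a) ->
      exists x, x ∈ a /\ forall y, y ∈ x -> ~ y ∈ a;
  zfc_pairing :
    forall a b : V, exists c, is_upair c a b;
  zfc_union :
    forall a : V, exists b, forall x, x ∈ b <-> exists y, y ∈ a /\ x ∈ y;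
  zfc_powerset :
    forall a : V, exists p, is_powerset p a;
  zfc_infinity :
    exists w : V, (exists e, is_empty e /\ e ∈ w) /\
      forall x, x ∈ w -> exists s, is_succ s x /\ s ∈ w;
  zfc_separation :
    forall P : V -> Prop, definable_class P ->
      forall a, exists b, forall x, x ∈ b <-> x ∈ a /\ P x;
  zfc_replacement :
    forall R : V -> V -> Prop, definable_rel R ->
      forall a, (forall x, x ∈ a -> exists! y, R x y) ->
        exists b, forall y, y ∈ b <-> exists x, x ∈ a /\ R x y;
  zfc_choice :
    forall a : V,
      (forall x, x ∈ a -> ~ is_empty x) ->
      (forall x y z, x ∈ a -> y ∈ a -> z ∈ x -> z ∈ y -> x = y) ->
      exists c, forall x, x ∈ a -> exists! z, z ∈ x /\ z ∈ c
}.

(* Kuratowski pair: p = {{x}, {x, y}}. *)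
Definition is_pair {V : set_structure} (p x y : V) : Prop :=
  exists s t, is_upair s x x /\ is_upair t x y /\ is_upair p s t.

(* f(x) = y, for a set function f. *)
Definition maps {V : set_structure} (f x y : V) : Prop :=
  exists p, is_pair p x y /\ p ∈ f.

Definition function_on {V : set_structure} (f a : V) : Prop :=
  (forall p, p ∈ f -> exists x y, x ∈ a /\ is_pair p x y) /\
  (forall x, x ∈ a -> exists! y, maps f x y).

Definition function_from_to {V : set_structure} (f a b : V) : Prop :=
  function_on f a /\ forall x y, maps f x y -> y ∈ b.

Definition transitive_set {V : set_structure} (a : V) : Prop :=
  forall x y, x ∈ a -> y ∈ x -> y ∈ a.

(* Well-foundedness of ∈ on a comes from Foundation. *)
Definition ordinal {V : set_structure} (a : V) : Prop :=
  transitive_set a /\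
  forall x y, x ∈ a -> y ∈ a -> x ∈ y \/ x = y \/ y ∈ x.

Definition ord_le {V : set_structure} (a b : V) : Prop := a ∈ b \/ a = b.

Definition natural {V : set_structure} (n : V) : Prop :=
  ordinal n /\
  forall m, ord_le m n -> is_empty m \/ exists k, is_succ m k.

Definition is_omega {V : set_structure} (w : V) : Prop :=
  forall n, n ∈ w <-> natural n.

Definition infinite_ordinal {V : set_structure} (a : V) : Prop :=
  ordinal a /\ exists w, is_omega w /\ ord_le w a.

(* |a| <= |b| *)
Definition card_le {V : set_structure} (a b : V) : Prop :=
  exists f, function_from_to f a b /\
    forall x x' y, maps f x y -> maps f x' y -> x = x'.

(* |a| < |b| *)
Definition card_lt {V : set_structure} (a b : V) : Prop :=
  card_le a b /\ ~ card_le b a.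

Definition cardinal {V : set_structure} (k : V) : Prop :=
  ordinal k /\ forall a, a ∈ k -> card_lt a k.

Definition infinite_cardinal {V : set_structure} (k : V) : Prop :=
  cardinal k /\ infinite_ordinal k.

(* mu = lam^+ *)
Definition is_succ_cardinal {V : set_structure} (mu lam : V) : Prop :=
  cardinal mu /\ lam ∈ mu /\
  forall nu, cardinal nu -> lam ∈ nu -> ord_le mu nu.

(* lam <= 2^kappa *)
Definition le_two_power {V : set_structure} (lam kappa : V) : Prop :=
  exists p, is_powerset p kappa /\ card_le lam p.

Record ultrafilter_on {V : set_structure} (D U : V) : Prop := {
  uf_subset : forall X, X ∈ U -> subset X D;
  uf_full : D ∈ U;
  uf_empty : forall e, is_empty e -> ~ e ∈ U;
  uf_upward : forall X Y, X ∈ U -> subset X Y -> subset Y D -> Y ∈ U;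
  uf_inter : forall X Y Z, X ∈ U -> Y ∈ U ->
    (forall x, x ∈ Z <-> x ∈ X /\ x ∈ Y) -> Z ∈ U;
  uf_ultra : forall X Y, subset X D ->
    (forall x, x ∈ Y <-> x ∈ D /\ ~ x ∈ X) -> X ∈ U \/ Y ∈ U
}.

(* Y is the intersection of the family A inside D. *)
Definition complete {V : set_structure} (kappa D U : V) : Prop :=
  forall A, subset A U -> card_lt A kappa ->
    forall Y, (forall x, x ∈ Y <-> x ∈ D /\ forall X, X ∈ A -> x ∈ X) ->
      Y ∈ U.

Definition principal {V : set_structure} (D U : V) : Prop :=
  exists d, d ∈ D /\ forall X, X ∈ U <-> subset X D /\ d ∈ X.

(* U belongs to the set 𝔘_kappa. *)
Definition frakU {V : set_structure} (kappa U : V) : Prop :=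
  ultrafilter_on kappa U /\ complete kappa kappa U /\ ~ principal kappa U.

Definition measurable {V : set_structure} (kappa : V) : Prop :=
  cardinal kappa /\
  (exists w, is_omega w /\ w ∈ kappa) /\
  exists U, frakU kappa U.

Definition RK_le {V : set_structure} (kappa U0 U1 : V) : Prop :=
  exists f, function_from_to f kappa kappa /\
    forall X, subset X kappa ->
      forall Y,
        (forall x, x ∈ Y <-> x ∈ kappa /\ exists y, maps f x y /\ y ∈ X) ->
        (X ∈ U0 <-> Y ∈ U1).

Definition RK_directed {V : set_structure} (theta kappa : V) : Prop :=
  forall A, (forall U, U ∈ A -> frakU kappa U) -> card_lt A theta ->
    exists W, frakU kappa W /\ forall U, U ∈ A -> RK_le kappa U W.

(* D = kappa^{<kappa} *)
Definition is_short_sequences {V : set_structure} (D kappa : V) : Prop :=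
  forall s, s ∈ D <-> exists a, a ∈ kappa /\ function_from_to s a kappa.

Definition transitive_class {V : set_structure} (M : V -> Prop) : Prop :=
  forall x y, M x -> y ∈ x -> M y.

Definition is_crit {V : set_structure} (j : V -> V) (kappa : V) : Prop :=
  ordinal kappa /\ j kappa <> kappa /\ forall a, a ∈ kappa -> j a = a.

(* M^kappa ⊆ M *)
Definition closed_under_sequences {V : set_structure} (kappa : V)
    (M : V -> Prop) : Prop :=
  forall f, function_on f kappa -> (forall x y, maps f x y -> M y) -> M f.

(* j : V -> M is a definable elementary embedding into a transitive class M,
   with crit(j) = kappa and M^kappa ⊆ M.  Elementarity is asserted for each
   formula separately. *)
Record embedding {V : set_structure} (kappa : V) (M : V -> Prop)
    (j : V -> V) : Prop := {
  emb_definable_target : definable_class M;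
  emb_definable : definable_fun j;
  emb_transitive : transitive_class M;
  emb_into : forall x, M (j x);
  emb_elementary : forall (phi : formula) (rho : nat -> V),
    sat (universe V) rho phi <-> sat M (fun n => j (rho n)) phi;
  emb_crit : is_crit j kappa;
  emb_closed : closed_under_sequences kappa M
}.

(* M is the transitive collapse of Ult(V, W), for W an ultrafilter on D, and
   j = j_W.  The class function cl sends a function f on D to (the collapse
   of) its class [f]_W; its values at other arguments are irrelevant. *)
Definition is_ultrapower {V : set_structure} (D W : V) (M : V -> Prop)
    (j : V -> V) : Prop :=
  transitive_class M /\
  exists cl : V -> V,
    definable_fun cl /\
    (forall f, function_on f D -> M (cl f)) /\
    (forall y, M y -> exists f, function_on f D /\ cl f = y) /\
    (forall f g, function_on f D -> function_on g D ->
       (cl f = cl g <->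
        exists S, S ∈ W /\
          forall d, d ∈ S <->
            d ∈ D /\ exists x y, maps f d x /\ maps g d y /\ x = y)) /\
    (forall f g, function_on f D -> function_on g D ->
       (cl f ∈ cl g <->
        exists S, S ∈ W /\
          forall d, d ∈ S <->
            d ∈ D /\ exists x y, maps f d x /\ maps g d y /\ x ∈ y)) /\
    (forall a c, function_on c D -> (forall d, d ∈ D -> maps c d a) ->
       j a = cl c).

Definition uf_sequence {V : set_structure} (kappa alpha U : V) : Prop :=
  function_on U alpha /\ forall b u, maps U b u -> frakU kappa u.

Definition ordinal_sequence {V : set_structure} (alpha eta : V) : Prop :=
  function_on eta alpha /\ forall b e, maps eta b e -> ordinal e.

Definition strictly_increasing {V : set_structure} (eta : V) : Prop :=
  forall b b' e e', maps eta b e -> maps eta b' e' -> b ∈ b' -> e ∈ e'.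

(* U_b = {X ⊆ kappa | eta_b ∈ j(X)} for every index b. *)
Definition glues {V : set_structure} (kappa : V) (j : V -> V)
    (U eta : V) : Prop :=
  forall b u e, maps U b u -> maps eta b e ->
    forall X, X ∈ u <-> subset X kappa /\ e ∈ j X.

(* The predicate via restricts the admissible embeddings j : V -> M. *)
Definition GP_by {V : set_structure} (via : (V -> Prop) -> (V -> V) -> Prop)
    (kappa alpha : V) : Prop :=
  forall U, uf_sequence kappa alpha U ->
    exists (M : V -> Prop) (j : V -> V) (eta : V),
      embedding kappa M j /\ via M j /\
      ordinal_sequence alpha eta /\ strictly_increasing eta /\
      glues kappa j U eta.

Definition weak_GP_by {V : set_structure}
    (via : (V -> Prop) -> (V -> V) -> Prop) (kappa alpha : V) : Prop :=
  forall U, uf_sequence kappa alpha U ->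
    exists (M : V -> Prop) (j : V -> V) (eta : V),
      embedding kappa M j /\ via M j /\
      ordinal_sequence alpha eta /\
      glues kappa j U eta.

(* The beta-GP is only defined for beta >= omega. *)
Definition lt_GP_by {V : set_structure}
    (via : (V -> Prop) -> (V -> V) -> Prop) (kappa alpha : V) : Prop :=
  forall beta, beta ∈ alpha -> infinite_ordinal beta -> GP_by via kappa beta.

Definition any_embedding {V : set_structure} (M : V -> Prop) (j : V -> V)
  : Prop := True.

Definition ultrapower_embedding {V : set_structure} (kappa : V)
    (M : V -> Prop) (j : V -> V) : Prop :=
  exists D W, is_short_sequences D kappa /\
    ultrafilter_on D W /\ complete kappa D W /\ is_ultrapower D W M j.

Definition GP {V : set_structure} (kappa alpha : V) : Prop :=
  GP_by any_embedding kappa alpha.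
Definition weak_GP {V : set_structure} (kappa alpha : V) : Prop :=
  weak_GP_by any_embedding kappa alpha.
Definition lt_GP {V : set_structure} (kappa alpha : V) : Prop :=
  lt_GP_by any_embedding kappa alpha.

Definition GP_uf {V : set_structure} (kappa alpha : V) : Prop :=
  GP_by (ultrapower_embedding kappa) kappa alpha.
Definition weak_GP_uf {V : set_structure} (kappa alpha : V) : Prop :=
  weak_GP_by (ultrapower_embedding kappa) kappa alpha.
Definition lt_GP_uf {V : set_structure} (kappa alpha : V) : Prop :=
  lt_GP_by (ultrapower_embedding kappa) kappa alpha.

(* Main.v *)
(** A weak gluing by an embedding [j] yields one ultrafilter [W] on kappa^{<kappa} that projects to all the
    given ultrafilters: [j] itself is [j_W], or, when lam <= kappa, the sequence of the generators lies in
    the target model and [W] is the measure it generates.  Since kappa is inaccessible, kappa^{<kappa}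
    injects into kappa, so [W] can be moved to kappa, where it is a Rudin-Keisler bound.

    Conversely, an ultrapower by a Rudin-Keisler bound of the family glues it weakly.  To make the
    generators increase, one bounds another family: call E good at b if E has U_b as its second
    coordinate and, for every a < b, projects to some E' good at a by a map that decreases the second
    coordinate.  Good ultrafilters exist at every b < beta, by induction: if W bounds good ultrafilters
    chosen below b, the product W x U_b is good, because its second coordinate exceeds every function of
    the first.  In the ultrapower by a bound of good ultrafilters, let eta_b be the least second
    coordinate of a point whose type is good at b.  Projecting such a least point shows eta_a < eta_b
    for a < b. *)

From Stdlib Require Import Classical ClassicalEpsilon FunctionalExtensionality Lia.
Require Import Defs.

(* The schemes of the model apply only to classes that are first-order definable with parameters, so
   every construction carries a proof of definability. This dictates the shape of the set theory
   below: operations are total, with default values, and definability is a calculus of predicates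
   and terms.

   A Rudin-Keisler bound gives each member of a family some generator in the ultrapower, but
   generators of different members are unrelated. Goodness is a property of an ultrafilter alone, so
   one point of a good type can stand in for another; the least second coordinate is therefore taken
   over all points of good type, and no coherence between the chosen ultrafilters enters.

   An ordinal below lam^+ has at most lam elements, so bounds for families of size lam treat all
   lengths below lam^+ at once. For arbitrary embeddings, lam <= kappa serves twice: closure under
   kappa-sequences puts the sequence of generators into the target model, and its indices lie below
   the critical point, so they are not moved. *)
Existing Class ZFC.

(** * Renaming of variables and interleaving of environments *)

Fixpoint rename (f : nat -> nat) (phi : formula) : formula :=
  match phi with
  | f_mem m n => f_mem (f m) (f n)
  | f_eq m n => f_eq (f m) (f n)
  | f_false => f_false
  | f_imp p q => f_imp (rename f p) (rename f q)
  | f_all p => f_all (rename (env_cons 0 (fun n => S (f n))) p)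
  end.

Lemma sat_rename {V : set_structure} (M : V -> Prop) phi f rho :
  sat M rho (rename f phi) <-> sat M (fun n => rho (f n)) phi.
Proof.
  revert f rho; induction phi; intros f rho; simpl; try tauto.
  - rewrite IHphi1, IHphi2; tauto.
  - assert (E : forall x, sat M (env_cons x rho) (rename (env_cons 0 (fun n => S (f n))) phi)
       <-> sat M (env_cons x (fun n => rho (f n))) phi).
    { intros x. rewrite IHphi.
      replace (fun n => env_cons x rho (env_cons 0 (fun n => S (f n)) n))
        with (env_cons x (fun n => rho (f n))); [tauto|].
      apply functional_extensionality; intros [|n]; reflexivity. }
    split; intros H x Mx; apply E; auto.
Qed.

(** Arguments and parameters share one environment, at even and odd indices. Both supplies stay
    infinite, so the number of arguments of a predicate never has to be recorded. *)
Fixpoint mix {T : Type} (r p : nat -> T) (n : nat) : T :=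
  match n with
  | 0 => r 0
  | 1 => p 0
  | S (S m) => mix (fun k => r (S k)) (fun k => p (S k)) m
  end.

Lemma mix_even {T} (r p : nat -> T) n : mix r p (2 * n) = r n.
Proof.
  revert r p; induction n; intros r p; [reflexivity|].
  replace (2 * S n) with (S (S (2 * n))) by lia. simpl mix. apply IHn.
Qed.

Lemma mix_odd {T} (r p : nat -> T) n : mix r p (S (2 * n)) = p n.
Proof.
  revert r p; induction n; intros r p; [reflexivity|].
  replace (S (2 * S n)) with (S (S (S (2 * n)))) by lia.
  change (mix r p (S (S (S (2 * n)))))
    with (mix (fun k => r (S k)) (fun k => p (S k)) (S (2 * n))). apply IHn.
Qed.

Lemma mix_map {T S} (F : T -> S) r p n :
  F (mix r p n) = mix (fun k => F (r k)) (fun k => F (p k)) n.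
Proof.
  revert r p.
  (* [mix] recurses two indices at a time, so the induction carries two consecutive ones. *)
  enough (H : forall r p, F (mix r p n) = mix (fun k => F (r k)) (fun k => F (p k)) n
    /\ F (mix r p (Datatypes.S n)) = mix (fun k => F (r k)) (fun k => F (p k)) (Datatypes.S n))
    by (intros; apply H).
  induction n; intros r p; [split; reflexivity|].
  split; [apply IHn|]. simpl. apply (proj1 (IHn _ _)).
Qed.

Lemma mix_map_ext {T S} (F : T -> S) r p :
  (fun n => F (mix r p n)) = mix (fun k => F (r k)) (fun k => F (p k)).
Proof. apply functional_extensionality; intros n; apply mix_map. Qed.

(** * Definable classes and class functions *)

Section Definability.
Context {V : set_structure} {HV : ZFC V}.

Implicit Types (P Q : (nat -> V) -> Prop) (s t : (nat -> V) -> V).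

Lemma inhabited_model : inhabited V.
Proof. destruct (zfc_infinity V HV) as [w _]; exact (inhabits w). Qed.

(** Choice in the metatheory, which turns the existence axioms into functions of Rocq. A function
    obtained this way may enter separation or replacement only once its graph is shown definable,
    usually from the uniqueness of its value. *)
Definition the (P : V -> Prop) : V := epsilon inhabited_model P.

(* The odd variables of the formula hold the parameters [p]. *)
Definition D P : Prop :=
  exists phi p, forall r, P r <-> sat (universe V) (mix r p) phi.

(** A term is definable when its graph is, the value being variable 0; the language itself has no
    terms. *)
Definition Dt t : Prop := D (fun r => r 0 = t (fun n => r (S n))).

Lemma D_ext P Q : (forall r, Q r <-> P r) -> D P -> D Q.
Proof.
  intros H (phi & p & E); exists phi, p; intros r. rewrite H. apply E.
Qed.


(** By excluded middle a proposition independent of the environment has a truth value, and a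
    constant formula expresses it, whatever its content. *)
Lemma D_const (A : Prop) : D (fun _ => A).
Proof.
  destruct (classic A) as [a|a].
  - exists (f_imp f_false f_false), (fun _ => the (fun _ => True)); simpl; tauto.
  - exists f_false, (fun _ => the (fun _ => True)); simpl; tauto.
Qed.

Lemma D_rename P (f : nat -> nat) : D P -> D (fun r => P (fun n => r (f n))).
Proof.
  intros (phi & p & E).
  exists (rename (mix (fun n => 2 * f n) (fun n => S (2 * n))) phi), p.
  intros r. rewrite E, sat_rename, (mix_map_ext (mix r p)).
  replace (fun k => mix r p (2 * f k)) with (fun k => r (f k))
    by (apply functional_extensionality; intro; now rewrite mix_even).
  replace (fun k => mix r p (S (2 * k))) with p
    by (apply functional_extensionality; intro; now rewrite mix_odd).
  tauto.
Qed.

Lemma D_imp P Q : D P -> D Q -> D (fun r => P r -> Q r).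
Proof.
  intros (phi & p & E) (psi & q & E').
  (* The parameters are interleaved once more: those of [phi] take the even parameter slots, those
     of [psi] the odd ones. *)
  exists (f_imp (rename (mix (fun n => 2 * n) (fun n => S (2 * (2 * n)))) phi)
            (rename (mix (fun n => 2 * n) (fun n => S (2 * (S (2 * n))))) psi)), (mix p q).
  intros r. cbn [sat]. rewrite E, E', !sat_rename, !(mix_map_ext (mix r (mix p q))).
  replace (fun k => mix r (mix p q) (2 * k)) with r
    by (apply functional_extensionality; intro; now rewrite mix_even).
  replace (fun k => mix r (mix p q) (S (2 * (2 * k)))) with p
    by (apply functional_extensionality; intro; now rewrite mix_odd, mix_even).
  replace (fun k => mix r (mix p q) (S (2 * (S (2 * k))))) with q
    by (apply functional_extensionality; intro; now rewrite !mix_odd).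
  tauto.
Qed.

Lemma D_all (P : V -> (nat -> V) -> Prop) :
  D (fun r => P (r 0) (fun n => r (S n))) -> D (fun r => forall x, P x r).
Proof.
  intros (phi & p & E).
  (* The bound variable is prepended and shifts all indices by one, which swaps the parities; the
     renaming swaps them back. *)
  exists (f_all (rename (mix (env_cons 0 (fun n => S (2 * n))) (fun n => S (S (2 * n)))) phi)), p.
  intros r. cbn [sat].
  assert (H : forall x, P x r <-> sat (universe V) (env_cons x (mix r p))
     (rename (mix (env_cons 0 (fun n => S (2 * n))) (fun n => S (S (2 * n)))) phi)).
  { intros x. specialize (E (env_cons x r)). simpl in E.
    rewrite sat_rename, (mix_map_ext (env_cons x (mix r p))).
    replace (fun k => env_cons x (mix r p) (env_cons 0 (fun n => S (2 * n)) k))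
      with (env_cons x r)
      by (apply functional_extensionality; intros [|n]; [reflexivity|];
          cbn [env_cons]; now rewrite mix_even).
    replace (fun k => env_cons x (mix r p) (S (S (2 * k)))) with p
      by (apply functional_extensionality; intros n; cbn [env_cons]; now rewrite mix_odd).
    exact E. }
  split; intros H' x; [intros _|]; apply H; auto. apply H'; exact I.
Qed.

Lemma D_not P : D P -> D (fun r => ~ P r).
Proof. intros H. apply D_imp; [exact H|apply D_const]. Qed.

Lemma D_and P Q : D P -> D Q -> D (fun r => P r /\ Q r).
Proof.
  intros H H'. apply (D_ext (fun r => ~ (P r -> ~ Q r))); [intros; tauto|].
  apply D_not, D_imp; [exact H|now apply D_not].
Qed.

Lemma D_or P Q : D P -> D Q -> D (fun r => P r \/ Q r).
Proof.
  intros H H'. apply (D_ext (fun r => ~ P r -> Q r)); [intros; tauto|].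
  apply D_imp; [now apply D_not|exact H'].
Qed.

Lemma D_iff P Q : D P -> D Q -> D (fun r => P r <-> Q r).
Proof. intros H H'. apply D_and; now apply D_imp. Qed.

Lemma D_ex (P : V -> (nat -> V) -> Prop) :
  D (fun r => P (r 0) (fun n => r (S n))) -> D (fun r => exists x, P x r).
Proof.
  intros H. apply (D_ext (fun r => ~ forall x, ~ P x r)).
  - intros r; split; [intros [x h] h'; exact (h' x h)|].
    intros h; apply not_all_not_ex; exact h.
  - apply D_not. apply (D_all (fun x r => ~ P x r)). now apply D_not.
Qed.

Lemma D_mem_var i j : D (fun r => r i ∈ r j).
Proof.
  exists (f_mem (2 * i) (2 * j)), (fun _ => the (fun _ => True)); intros r; cbn [sat].
  now rewrite !mix_even.
Qed.

Lemma D_eq_var i j : D (fun r => r i = r j).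
Proof.
  exists (f_eq (2 * i) (2 * j)), (fun _ => the (fun _ => True)); intros r; cbn [sat].
  now rewrite !mix_even.
Qed.

Lemma Dt_var i : Dt (fun r => r i).
Proof. apply (D_eq_var 0 (S i)). Qed.

Lemma Dt_const c : Dt (fun _ => c).
Proof. exists (f_eq 0 1), (fun _ => c); intros r; simpl; tauto. Qed.

Lemma Dt_rename t (f : nat -> nat) : Dt t -> Dt (fun r => t (fun n => r (f n))).
Proof.
  intros H. exact (D_rename (fun r => r 0 = t (fun n => r (S n))) (env_cons 0 (fun n => S (f n))) H).
Qed.

Lemma D_mem s t : Dt s -> Dt t -> D (fun r => s r ∈ t r).
Proof.
  intros Hs Ht. apply (D_ext (fun r => exists x, exists y, x = s r /\ y = t r /\ x ∈ y)).
  - intros r; split; [intros H; now exists (s r), (t r)|].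
    now intros (x & y & -> & -> & H).
  - apply (D_ex (fun x r => exists y, x = s r /\ y = t r /\ x ∈ y)).
    apply (D_ex (fun y r => r 0 = s (fun n => r (S n)) /\ y = t (fun n => r (S n)) /\ r 0 ∈ y)).
    apply D_and; [|apply D_and].
    + exact (D_rename (fun r => r 0 = s (fun n => r (S n))) S Hs).
    + exact (D_rename (fun r => r 0 = t (fun n => r (S n))) (env_cons 0 (fun n => S (S n))) Ht).
    + apply (D_mem_var 1 0).
Qed.

Lemma D_eq s t : Dt s -> Dt t -> D (fun r => s r = t r).
Proof.
  intros Hs Ht. apply (D_ext (fun r => exists x, x = s r /\ x = t r)).
  - intros r; split; [intros H; now exists (s r)|].
    now intros (x & -> & ->).
  - apply (D_ex (fun x r => x = s r /\ x = t r)). now apply D_and.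
Qed.

(** Substitution of definable terms into a formula. By induction on the formula everything reduces
    to the atoms, where [D_mem] and [D_eq] quantify over the graphs. The same lemma later shows that
    the set in the theorem of Łoś is definable. *)
Lemma D_sat (T : nat -> (nat -> V) -> V) phi :
  (forall n, Dt (T n)) -> D (fun r => sat (universe V) (fun n => T n r) phi).
Proof.
  revert T; induction phi; intros T H; simpl.
  - now apply D_mem.
  - now apply D_eq.
  - apply D_const.
  - apply D_imp; auto.
  - apply (D_all (fun x r => universe V x ->
                   sat (universe V) (env_cons x (fun n => T n r)) phi)).
    apply D_imp; [apply (D_ext (fun _ => True)); [intros; unfold universe; tauto|apply D_const]|].
    apply (D_ext (fun r => sat (universe V)
      (fun n => (env_cons (fun r => r 0) (fun n r => T n (fun k => r (S k)))) n r) phi)).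
    + intros r.
      replace (env_cons (r 0) (fun n => T n (fun k => r (S k))))
        with (fun n => (env_cons (fun r => r 0) (fun n r => T n (fun k => r (S k)))) n r);
        [tauto|apply functional_extensionality; now intros [|n]].
    + apply IHphi. intros [|n]; simpl; [apply Dt_var|]. now apply Dt_rename.
Qed.

Lemma D_subst P (T : nat -> (nat -> V) -> V) :
  D P -> (forall n, Dt (T n)) -> D (fun r => P (fun n => T n r)).
Proof.
  intros (phi & p & E) H.
  apply (D_ext (fun r => sat (universe V) (fun n => (mix T (fun n _ => p n)) n r) phi)).
  - intros r. rewrite E. now rewrite (mix_map_ext (fun t => t r)).
  - apply D_sat. intros n.
    enough (Q : forall k, Dt (mix T (fun n _ => p n) (2 * k)) /\
                          Dt (mix T (fun n _ => p n) (S (2 * k)))).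
    { destruct (PeanoNat.Nat.Even_or_Odd n) as [[k ->]|[k ->]];
        [apply Q|rewrite PeanoNat.Nat.add_1_r; apply Q]. }
    intros k; rewrite mix_even, mix_odd. split; [apply H|apply Dt_const].
Qed.

Lemma Dt_subst t (T : nat -> (nat -> V) -> V) :
  Dt t -> (forall n, Dt (T n)) -> Dt (fun r => t (fun n => T n r)).
Proof.
  intros Ht H.
  apply (D_subst (fun r => r 0 = t (fun n => r (S n))) (env_cons (fun r => r 0) (fun n r => T n (fun k => r (S k)))) Ht).
  intros [|n]; simpl; [apply Dt_var|now apply Dt_rename].
Qed.

Definition D1 (P : V -> Prop) := D (fun r => P (r 0)).
Definition D2 (P : V -> V -> Prop) := D (fun r => P (r 0) (r 1)).
Definition D3 (P : V -> V -> V -> Prop) := D (fun r => P (r 0) (r 1) (r 2)).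
Definition D4 (P : V -> V -> V -> V -> Prop) := D (fun r => P (r 0) (r 1) (r 2) (r 3)).
Definition Df1 (F : V -> V) := Dt (fun r => F (r 0)).
Definition Df2 (F : V -> V -> V) := Dt (fun r => F (r 0) (r 1)).
Definition Df3 (F : V -> V -> V -> V) := Dt (fun r => F (r 0) (r 1) (r 2)).
Definition Df4 (F : V -> V -> V -> V -> V) := Dt (fun r => F (r 0) (r 1) (r 2) (r 3)).

Definition args (a b c d : (nat -> V) -> V) (n : nat) : (nat -> V) -> V :=
  match n with 0 => a | 1 => b | 2 => c | _ => d end.

Lemma Dt_args a b c d n : Dt a -> Dt b -> Dt c -> Dt d -> Dt (args a b c d n).
Proof. destruct n as [|[|[|n]]]; auto. Qed.

Lemma D_app1 R a : D1 R -> Dt a -> D (fun r => R (a r)).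
Proof. intros H A. apply (D_subst _ (args a a a a) H). intros; now apply Dt_args. Qed.
Lemma D_app2 R a b : D2 R -> Dt a -> Dt b -> D (fun r => R (a r) (b r)).
Proof. intros H A B. apply (D_subst _ (args a b a a) H). intros; now apply Dt_args. Qed.
Lemma D_app3 R a b c : D3 R -> Dt a -> Dt b -> Dt c -> D (fun r => R (a r) (b r) (c r)).
Proof. intros H A B C. apply (D_subst _ (args a b c a) H). intros; now apply Dt_args. Qed.
Lemma D_app4 R a b c d : D4 R -> Dt a -> Dt b -> Dt c -> Dt d ->
  D (fun r => R (a r) (b r) (c r) (d r)).
Proof. intros H A B C E. apply (D_subst _ (args a b c d) H). intros; now apply Dt_args. Qed.
Lemma Dt_app1 F a : Df1 F -> Dt a -> Dt (fun r => F (a r)).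
Proof. intros H A. apply (Dt_subst _ (args a a a a) H). intros; now apply Dt_args. Qed.
Lemma Dt_app2 F a b : Df2 F -> Dt a -> Dt b -> Dt (fun r => F (a r) (b r)).
Proof. intros H A B. apply (Dt_subst _ (args a b a a) H). intros; now apply Dt_args. Qed.
Lemma Dt_app3 F a b c : Df3 F -> Dt a -> Dt b -> Dt c -> Dt (fun r => F (a r) (b r) (c r)).
Proof. intros H A B C. apply (Dt_subst _ (args a b c a) H). intros; now apply Dt_args. Qed.
Lemma Dt_app4 F a b c d : Df4 F -> Dt a -> Dt b -> Dt c -> Dt d ->
  Dt (fun r => F (a r) (b r) (c r) (d r)).
Proof. intros H A B C E. apply (Dt_subst _ (args a b c d) H). intros; now apply Dt_args. Qed.

Lemma definable_classE R : definable_class R <-> D1 R.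
Proof.
  split.
  - intros (phi & rho & E).
    exists (rename (env_cons 0 (fun n => S (2 * n))) phi), rho.
    intros r. rewrite E, sat_rename.
    replace (fun n => mix r rho (env_cons 0 (fun n => S (2 * n)) n))
      with (env_cons (r 0) rho); [tauto|].
    apply functional_extensionality; intros [|n]; [reflexivity|].
    cbn [env_cons]. now rewrite mix_odd.
  - intros (phi & p & E).
    (* Only variable 0 matters to [R], so the other even variables are frozen at an arbitrary set
       and become parameters. *)
    exists phi, (fun n => mix (fun _ => the (fun _ => True)) p (S n)).
    intros x. rewrite (E (env_cons x (fun _ => the (fun _ => True)))).
    cbn [env_cons].
    match goal with |- sat _ ?a _ <-> sat _ ?b _ => replace b with a; [tauto|] end.
    apply functional_extensionality; intros [|[|n]]; reflexivity.
Qed.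

Lemma definable_relE R : definable_rel R <-> D2 R.
Proof.
  split.
  - intros (phi & rho & E).
    exists (rename (env_cons 0 (env_cons 2 (fun n => S (2 * n)))) phi), rho.
    intros r. rewrite E, sat_rename.
    match goal with |- sat _ ?a _ <-> sat _ ?b _ => replace b with a; [tauto|] end.
    apply functional_extensionality; intros [|[|n]]; try reflexivity.
    cbn [env_cons]. now rewrite mix_odd.
  - intros (phi & p & E).
    exists (rename (env_cons 0 (env_cons 2 (env_cons 1 (fun n => S (S (S n)))))) phi),
      (fun n => mix (fun _ => the (fun _ => True)) p (match n with 0 => 1 | S n => S (S (S n)) end)).
    intros x y. rewrite (E (env_cons x (env_cons y (fun _ => the (fun _ => True))))).
    rewrite sat_rename.
    match goal with |- sat _ ?a _ <-> sat _ ?b _ => replace b with a; [tauto|] end.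
    apply functional_extensionality; intros [|[|[|n]]]; reflexivity.
Qed.

Lemma definable_funE F : definable_fun F <-> Df1 F.
Proof.
  unfold definable_fun. rewrite definable_relE. unfold D2, Df1, Dt. split; intros H.
  - apply (D_rename _ (env_cons 1 (env_cons 0 S))) in H.
    revert H; apply D_ext; intros r; split; intros E; symmetry; exact E.
  - apply (D_rename _ (env_cons 1 (env_cons 0 S))) in H.
    revert H; apply D_ext; intros r; split; intros E; symmetry; exact E.
Qed.

End Definability.

Create HintDb dfn.

(** Syntax-directed proof of definability. The order of cases matters: an implication is also a
    product, so it is tried before the universal quantifier, and expressions independent of the
    environment are closed at once as constants. Defined notions enter through the database
    [dfn]. *)
Ltac dstep :=
  cbn beta;
  match goal with
  | |- D1 _ => unfold D1
  | |- D2 _ => unfold D2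
  | |- D3 _ => unfold D3
  | |- D4 _ => unfold D4
  | |- Df1 _ => unfold Df1
  | |- Df2 _ => unfold Df2
  | |- Df3 _ => unfold Df3
  | |- Df4 _ => unfold Df4
  | |- definable_class _ => apply definable_classE
  | |- definable_rel _ => apply definable_relE
  | |- definable_fun _ => apply definable_funE
  | |- D (fun _ => ?A) => exact (D_const A)
  | |- Dt (fun _ => ?A) => exact (Dt_const A)
  | |- Dt (fun r => r ?n) => exact (Dt_var n)
  | |- D (fun r => _ /\ _) => simple apply D_and
  | |- D (fun r => _ \/ _) => simple apply D_or
  | |- D (fun r => ~ _) => simple apply D_not
  | |- D (fun r => _ <-> _) => simple apply D_iff
  | |- D (fun r => _ = _) => simple apply D_eq
  | |- D (fun r => _ ∈ _) => simple apply D_mem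
  | |- D (fun r => ex (unique _)) => unfold unique
  | |- D (fun r => exists x, _) => simple apply D_ex
  | |- D (fun r => _ -> _) => simple apply D_imp
  | |- D (fun r => forall x, _) => simple apply D_all
  | |- D (fun r => ?P (@?a r) (@?b r) (@?c r) (@?d r)) =>
      simple apply (D_app4 P a b c d); [solve [auto 2 with dfn]| | | |]
  | |- D (fun r => ?P (@?a r) (@?b r) (@?c r)) =>
      simple apply (D_app3 P a b c); [solve [auto 2 with dfn]| | |]
  | |- D (fun r => ?P (@?a r) (@?b r)) =>
      simple apply (D_app2 P a b); [solve [auto 2 with dfn]| |]
  | |- D (fun r => ?P (@?a r)) =>
      simple apply (D_app1 P a); [solve [auto 2 with dfn]|]
  | |- Dt (fun r => ?F (@?a r) (@?b r) (@?c r) (@?d r)) =>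
      simple apply (Dt_app4 F a b c d); [solve [auto 2 with dfn]| | | |]
  | |- Dt (fun r => ?F (@?a r) (@?b r) (@?c r)) =>
      simple apply (Dt_app3 F a b c); [solve [auto 2 with dfn]| | |]
  | |- Dt (fun r => ?F (@?a r) (@?b r)) =>
      simple apply (Dt_app2 F a b); [solve [auto 2 with dfn]| |]
  | |- Dt (fun r => ?F (@?a r)) =>
      simple apply (Dt_app1 F a); [solve [auto 2 with dfn]|]
  end.
(* Extended as binding operations are introduced. *)
Ltac dfn_binder := fail.
Ltac dfn := repeat first [dstep | dfn_binder].

(** * Basic set theory inside the model *)

Section SetOperations.
Context {V : set_structure} {HV : ZFC V}.
Implicit Types (a b c x y z f : V).

Lemma the_spec (P : V -> Prop) : (exists x, P x) -> P (the P).
Proof. apply epsilon_spec. Qed.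

Lemma set_ext a b : (forall x, x ∈ a <-> x ∈ b) -> a = b.
Proof. apply zfc_extensionality, HV. Qed.

Definition upair a b : V := the (fun c => is_upair c a b).
Definition sing a : V := upair a a.
Definition pair a b : V := upair (sing a) (upair a b).
Definition union a : V := the (fun b => forall x, x ∈ b <-> exists y, y ∈ a /\ x ∈ y).
Definition pow a : V := the (fun b => is_powerset b a).
Definition sep a (P : V -> Prop) : V := the (fun b => forall x, x ∈ b <-> x ∈ a /\ P x).
Definition repl a (F : V -> V) : V :=
  the (fun b => forall y, y ∈ b <-> exists x, x ∈ a /\ y = F x).
Definition cup a b : V := union (upair a b).
Definition succ a : V := cup a (sing a).
Definition emp : V := sep (the (fun _ => True)) (fun _ => False).

Lemma in_upair a b x : x ∈ upair a b <-> x = a \/ x = b.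
Proof. apply (the_spec (fun c => is_upair c a b)), zfc_pairing, HV. Qed.

Lemma in_sing a x : x ∈ sing a <-> x = a.
Proof. unfold sing; rewrite in_upair; tauto. Qed.

Lemma in_union a x : x ∈ union a <-> exists y, y ∈ a /\ x ∈ y.
Proof.
  apply (the_spec (fun b => forall x, x ∈ b <-> exists y, y ∈ a /\ x ∈ y)), zfc_union, HV.
Qed.

Lemma in_pow a x : x ∈ pow a <-> subset x a.
Proof. apply (the_spec (fun c => is_powerset c a)), zfc_powerset, HV. Qed.

Lemma in_sep a (P : V -> Prop) x : D1 P -> (x ∈ sep a P <-> x ∈ a /\ P x).
Proof.
  intros H. apply (the_spec (fun b => forall x, x ∈ b <-> x ∈ a /\ P x)).
  apply zfc_separation; [exact HV|now apply definable_classE].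
Qed.

Lemma in_repl a (F : V -> V) y : Df1 F -> (y ∈ repl a F <-> exists x, x ∈ a /\ y = F x).
Proof.
  intros H. apply (the_spec (fun b => forall y, y ∈ b <-> exists x, x ∈ a /\ y = F x)).
  apply (zfc_replacement _ HV (fun x y => y = F x)); [dfn|].
  intros x _; exists (F x); split; auto.
Qed.

Lemma in_cup a b x : x ∈ cup a b <-> x ∈ a \/ x ∈ b.
Proof.
  unfold cup; rewrite in_union; split.
  - intros (y & Hy & H); apply in_upair in Hy; destruct Hy; subst; auto.
  - intros [H|H]; [exists a|exists b]; rewrite in_upair; auto.
Qed.

Lemma in_succ a x : x ∈ succ a <-> x ∈ a \/ x = a.
Proof. unfold succ; rewrite in_cup, in_sing; tauto. Qed.

Lemma in_emp x : ~ x ∈ emp.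
Proof. unfold emp; rewrite in_sep by dfn; tauto. Qed.

Lemma is_empty_emp e : is_empty e <-> e = emp.
Proof.
  split; [|intros ->; exact in_emp].
  intros H; apply set_ext; intros x; split; intros h; exfalso; [exact (H x h)|exact (in_emp x h)].
Qed.

Lemma nonempty_ex a : a <> emp -> exists x, x ∈ a.
Proof.
  intros H. apply NNPP; intros h; apply H, is_empty_emp; intros x hx; eauto.
Qed.

Lemma is_upairE c a b : is_upair c a b <-> c = upair a b.
Proof.
  split; [|intros ->; intros x; apply in_upair].
  intros H; apply set_ext; intros x; rewrite in_upair; apply H.
Qed.

Lemma is_pairE p x y : is_pair p x y <-> p = pair x y.
Proof.
  split.
  - intros (s & t & Hs & Ht & Hp). apply is_upairE in Hs, Ht, Hp; subst; reflexivity.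
  - intros ->. exists (sing x), (upair x y). now rewrite !is_upairE.
Qed.

Lemma is_succE s a : is_succ s a <-> s = succ a.
Proof.
  split; [|intros ->; intros x; apply in_succ].
  intros H; apply set_ext; intros x; rewrite in_succ; apply H.
Qed.

Lemma is_powersetE p a : is_powerset p a <-> p = pow a.
Proof.
  split; [|intros ->; intros x; apply in_pow].
  intros H; apply set_ext; intros x; rewrite in_pow; apply H.
Qed.

Lemma pair_inj a b x y : pair a b = pair x y -> a = x /\ b = y.
Proof.
  unfold pair; intros H.
  assert (E : forall s, s = sing a \/ s = upair a b <-> s = sing x \/ s = upair x y)
    by (intros s; rewrite <- !in_upair, H; tauto).
  assert (Ex : a = x).
  { assert (h : sing a = sing x \/ sing a = upair x y) by (apply E; auto).
    destruct h as [h|h]; symmetry; apply in_sing; rewrite h;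
      [apply in_sing|apply in_upair]; auto. }
  split; [exact Ex|]; subst x.
  assert (B : b = a \/ b = y).
  { assert (h : upair a b = sing a \/ upair a b = upair a y) by (apply E; auto).
    assert (hb : b ∈ upair a b) by (apply in_upair; auto).
    destruct h as [h|h]; rewrite h in hb; [left; now apply in_sing in hb|now apply in_upair in hb]. }
  assert (Y : y = a \/ y = b).
  { assert (h : upair a y = sing a \/ upair a y = upair a b) by (apply E; auto).
    assert (hb : y ∈ upair a y) by (apply in_upair; auto).
    destruct h as [h|h]; rewrite h in hb; [left; now apply in_sing in hb|now apply in_upair in hb]. }
  destruct B, Y; congruence.
Qed.

Lemma mapsE f x y : maps f x y <-> pair x y ∈ f.
Proof.
  split; [intros (p & Hp & H); apply is_pairE in Hp; now subst|].
  intros H; exists (pair x y); now rewrite is_pairE.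
Qed.

Lemma Dt_intro t : D (fun r : nat -> V => r 0 = t (fun n => r (S n))) -> Dt t.
Proof. exact (fun H => H). Qed.

(** Here the predicate may itself depend on the environment, so [sep] binds a variable and is out of
    reach of the [Dt_app] lemmas. By extensionality its graph is given by a formula about
    elements. *)
Lemma Dt_sep (A : (nat -> V) -> V) (P : V -> (nat -> V) -> Prop) :
  Dt A -> D (fun r => P (r 0) (fun n => r (S n))) -> Dt (fun r => sep (A r) (fun x => P x r)).
Proof.
  intros HA HP. apply Dt_intro.
  apply (D_ext (fun r => forall x, x ∈ r 0 <-> x ∈ A (fun n => r (S n)) /\ P x (fun n => r (S n)))).
  - intros r.
    assert (h : D1 (fun x => P x (fun n => r (S n)))).
    { apply (D_subst _ (env_cons (fun r => r 0) (fun n _ => r (S n))) HP).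
      intros [|n]; simpl; dfn. }
    split; [intros -> x; now apply in_sep|].
    intros H; apply set_ext; intros x; rewrite in_sep by exact h; apply H.
  - apply (D_all (fun x r => x ∈ r 0 <-> x ∈ A (fun n => r (S n)) /\ P x (fun n => r (S n)))).
    apply D_iff; [dfn|]. apply D_and.
    + apply D_mem; [dfn|]. apply (Dt_rename A (fun n => S (S n)) HA).
    + apply (D_rename (fun r => P (r 0) (fun n => r (S n))) (env_cons 0 (fun n => S (S n))) HP).
Qed.

Lemma Dt_repl (A : (nat -> V) -> V) (F : V -> (nat -> V) -> V) :
  Dt A -> Dt (fun r => F (r 0) (fun n => r (S n))) -> Dt (fun r => repl (A r) (fun x => F x r)).
Proof.
  intros HA HF. apply Dt_intro.
  apply (D_ext (fun r => forall y, y ∈ r 0 <->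
     exists x, x ∈ A (fun n => r (S n)) /\ y = F x (fun n => r (S n)))).
  - intros r.
    assert (h : Df1 (fun x => F x (fun n => r (S n)))).
    { apply (Dt_subst _ (env_cons (fun r => r 0) (fun n _ => r (S n))) HF).
      intros [|n]; simpl; dfn. }
    split; [intros -> x; now apply in_repl|].
    intros H; apply set_ext; intros x; rewrite in_repl by exact h; apply H.
  - apply (D_all (fun y r => y ∈ r 0 <->
       exists x, x ∈ A (fun n => r (S n)) /\ y = F x (fun n => r (S n)))).
    apply D_iff; [dfn|].
    apply (D_ex (fun x r => x ∈ A (fun n => r (S (S n))) /\ r 0 = F x (fun n => r (S (S n))))).
    apply D_and; apply D_mem || apply D_eq; dfn.
    + apply (Dt_rename A (fun n => S (S (S n))) HA).
    + apply (Dt_rename (fun r => F (r 0) (fun n => r (S n))) (env_cons 0 (fun n => S (S (S n)))) HF).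
Qed.

Lemma Dt_upair : Df2 upair.
Proof.
  unfold Df2. apply Dt_intro.
  apply (D_ext (fun r => is_upair (r 0) (r 1) (r 2))); [intros; symmetry; apply is_upairE|].
  unfold is_upair; dfn.
Qed.
Hint Resolve Dt_upair : dfn.

Lemma Dt_union : Df1 union.
Proof.
  unfold Df1. apply Dt_intro.
  apply (D_ext (fun r => forall x, x ∈ r 0 <-> exists y, y ∈ r 1 /\ x ∈ y)); [|dfn].
  intros r; split; [intros ->; apply in_union|].
  intros H; apply set_ext; intros x; rewrite in_union; apply H.
Qed.
Hint Resolve Dt_union : dfn.

Lemma D_subset : D2 (@subset V).
Proof. unfold subset; dfn. Qed.
Hint Resolve D_subset : dfn.

Lemma Dt_pow : Df1 pow.
Proof.
  unfold Df1. apply Dt_intro.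
  apply (D_ext (fun r => is_powerset (r 0) (r 1))); [intros; symmetry; apply is_powersetE|].
  unfold is_powerset; dfn.
Qed.

Lemma Dt_sing : Df1 sing. Proof. unfold sing; dfn. Qed.
Hint Resolve Dt_sing : dfn.
Lemma Dt_pair : Df2 pair. Proof. unfold pair; dfn. Qed.
Lemma Dt_cup : Df2 cup. Proof. unfold cup; dfn. Qed.
Hint Resolve Dt_cup : dfn.
Lemma Dt_succ : Df1 succ. Proof. unfold succ; dfn. Qed.
End SetOperations.

#[export] Hint Resolve Dt_upair Dt_union D_subset Dt_pow Dt_sing Dt_pair Dt_cup Dt_succ : dfn.

Ltac dfn_binder ::=
  match goal with
  | |- Dt (fun r => sep _ _) => simple apply Dt_sep
  | |- Dt (fun r => repl _ _) => simple apply Dt_repl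
  end.

(** * Set functions and foundation *)

Section Functions.
Context {V : set_structure} {HV : ZFC V}.
Implicit Types (a b c x y z f : V).

Lemma D_maps : D3 (@maps V).
Proof.
  apply (D_ext (fun r => pair (r 1) (r 2) ∈ r 0)); [intros; apply mapsE|dfn].
Qed.
Hint Resolve D_maps : dfn.

Lemma D_is_pair : D3 (@is_pair V).
Proof.
  apply (D_ext (fun r => r 0 = pair (r 1) (r 2))); [intros; apply is_pairE|dfn].
Qed.
Hint Resolve D_is_pair : dfn.

Lemma D_function_on : D2 (@function_on V).
Proof. unfold function_on; dfn. Qed.
Hint Resolve D_function_on : dfn.

Lemma D_function_from_to : D3 (@function_from_to V).
Proof. unfold function_from_to; dfn. Qed.

(** The union of all values at [x]: it is the value when there is exactly one, and empty off the
    domain, so application is total and definable. Both coordinates of a Kuratowski pair in [f]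
    belong to the double union of [f]. *)
Definition app f x : V := union (sep (union (union f)) (fun y => pair x y ∈ f)).
Definition func a (F : V -> V) : V := repl a (fun x => pair x (F x)).
Definition prod a b : V := union (repl a (fun x => repl b (fun y => pair x y))).

Lemma Dt_app : Df2 app.
Proof. unfold app; dfn. Qed.
Hint Resolve Dt_app : dfn.

Lemma Dt_prod : Df2 prod.
Proof. unfold prod; dfn. Qed.

Lemma in_prod a b p : p ∈ prod a b <-> exists x y, x ∈ a /\ y ∈ b /\ p = pair x y.
Proof.
  unfold prod; rewrite in_union; split.
  - intros (s & Hs & Hp). apply in_repl in Hs; [|dfn]. destruct Hs as (x & Hx & ->).
    apply in_repl in Hp; [|dfn]. destruct Hp as (y & Hy & ->). eauto.
  - intros (x & y & Hx & Hy & ->). exists (repl b (fun y => pair x y)).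
    split; apply in_repl; [dfn|now exists x|dfn|now exists y].
Qed.

Lemma Dt_func (A : (nat -> V) -> V) (F : V -> (nat -> V) -> V) :
  Dt A -> Dt (fun r => F (r 0) (fun n => r (S n))) -> Dt (fun r => func (A r) (fun x => F x r)).
Proof.
  intros HA HF. unfold func. apply (Dt_repl A (fun x r => pair x (F x r))); [exact HA|]. dfn.
  exact HF.
Qed.

Lemma app_eq f x y : pair x y ∈ f -> (forall y', pair x y' ∈ f -> y' = y) -> app f x = y.
Proof.
  intros H U. unfold app. apply set_ext; intros z.
  rewrite in_union. split.
  - intros (t & Ht & Hz). apply in_sep in Ht; [|dfn]. destruct Ht as [_ Ht].
    apply U in Ht; now subst.
  - intros Hz; exists y; split; [|exact Hz]. rewrite in_sep by dfn. split; [|exact H].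
    apply in_union; exists (upair x y); split; [|apply in_upair; auto].
    apply in_union; exists (pair x y); split; [exact H|]. unfold pair; apply in_upair; auto.
Qed.

Lemma function_maps f a x y : function_on f a -> (maps f x y <-> x ∈ a /\ y = app f x).
Proof.
  intros [F1 F2].
  assert (K : forall x, x ∈ a -> maps f x (app f x)).
  { intros x' Hx'. destruct (F2 x' Hx') as (y' & Hy' & U).
    rewrite (app_eq f x' y'); [exact Hy'|now apply mapsE|].
    intros y'' h; symmetry; apply U, mapsE, h. }
  split.
  - intros H. assert (Hx : x ∈ a).
    { destruct H as (p & Hp & Hf). destruct (F1 p Hf) as (x' & y' & Hx' & Hp').
      apply is_pairE in Hp, Hp'. subst. apply pair_inj in Hp'. now destruct Hp' as [-> _]. }
    split; [exact Hx|]. destruct (F2 x Hx) as (y' & Hy' & U).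
    rewrite <- (U y H). apply U, K, Hx.
  - intros [Hx ->]. now apply K.
Qed.

Lemma function_pair f a x : function_on f a -> x ∈ a -> pair x (app f x) ∈ f.
Proof. intros F Hx. apply mapsE, (function_maps f a); auto. Qed.

Lemma in_function f a p : function_on f a -> (p ∈ f <-> exists x, x ∈ a /\ p = pair x (app f x)).
Proof.
  intros F; split.
  - intros H. destruct (proj1 F p H) as (x & y & Hx & Hp). apply is_pairE in Hp; subst.
    exists x; split; [exact Hx|]. apply mapsE in H. apply (function_maps f a) in H; [|exact F].
    destruct H as [_ <-]; reflexivity.
  - intros (x & Hx & ->). now apply (function_pair f a).
Qed.

Lemma function_ext f g a : function_on f a -> function_on g a ->
  (forall x, x ∈ a -> app f x = app g x) -> f = g.
Proof.
  intros F G H; apply set_ext; intros p. rewrite (in_function f a), (in_function g a) by assumption.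
  split; intros (x & Hx & ->); exists x; rewrite H; auto.
Qed.

Lemma func_on a (F : V -> V) : Df1 F -> function_on (func a F) a.
Proof.
  intros HF. split.
  - intros p Hp. apply in_repl in Hp; [|dfn]. destruct Hp as (x & Hx & ->).
    exists x, (F x); rewrite is_pairE; auto.
  - intros x Hx; exists (F x); split.
    + apply mapsE, in_repl; [dfn|]; eauto.
    + intros y Hy; apply mapsE, in_repl in Hy; [|dfn]. destruct Hy as (x' & _ & E).
      apply pair_inj in E. now destruct E as [-> ->].
Qed.

Lemma app_func a (F : V -> V) x : Df1 F -> x ∈ a -> app (func a F) x = F x.
Proof.
  intros HF Hx. apply app_eq; [apply in_repl; [dfn|]; eauto|].
  intros y Hy; apply in_repl in Hy; [|dfn]. destruct Hy as (x' & _ & E).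
  apply pair_inj in E. now destruct E as [-> ->].
Qed.

Lemma maps_func a (F : V -> V) x y : Df1 F -> (maps (func a F) x y <-> x ∈ a /\ y = F x).
Proof.
  intros HF. rewrite (function_maps _ a) by now apply func_on.
  split; intros [Hx ->]; rewrite app_func by auto; auto.
Qed.

Lemma func_from_to a b (F : V -> V) : Df1 F -> (forall x, x ∈ a -> F x ∈ b) ->
  function_from_to (func a F) a b.
Proof.
  intros HF H; split; [now apply func_on|].
  intros x y Hxy. apply maps_func in Hxy; [|exact HF]. destruct Hxy as [? ->]; auto.
Qed.

Lemma from_to_app f a b x : function_from_to f a b -> x ∈ a -> app f x ∈ b.
Proof. intros [F H] Hx. apply (H x), (function_maps f a); auto. Qed.

Lemma foundation a x : x ∈ a -> exists m, m ∈ a /\ forall y, y ∈ m -> ~ y ∈ a.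
Proof. intros H. apply zfc_foundation; eauto. Qed.

Lemma mem_irrefl x : ~ x ∈ x.
Proof.
  intros H. destruct (foundation (sing x) x) as (m & Hm & U); [now apply in_sing|].
  apply in_sing in Hm; subst. apply (U x H), in_sing; auto.
Qed.

Lemma mem_asym x y : x ∈ y -> ~ y ∈ x.
Proof.
  intros H H'. destruct (foundation (upair x y) x) as (m & Hm & U); [apply in_upair; auto|].
  apply in_upair in Hm; destruct Hm as [-> | ->];
    [apply (U y H')|apply (U x H)]; apply in_upair; auto.
Qed.

End Functions.

#[export] Hint Resolve D_maps D_is_pair D_function_on D_function_from_to Dt_app Dt_prod : dfn.

Ltac dfn_binder ::=
  match goal with
  | |- Dt (fun r => sep _ _) => simple apply Dt_sep
  | |- Dt (fun r => repl _ _) => simple apply Dt_repl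
  | |- Dt (fun r => func _ _) => simple apply Dt_func
  end.

Ltac sep_spec :=
  intros; match goal with |- _ ∈ ?s <-> _ => unfold s; rewrite in_sep by dfn; reflexivity end.

(** * Ordinals, least witnesses and natural numbers *)

Section Ordinals.
Context {V : set_structure} {HV : ZFC V}.
Implicit Types (a b c x y z f : V).

Lemma Dt_the (Q : V -> (nat -> V) -> Prop) :
  D (fun r => Q (r 0) (fun n => r (S n))) -> (forall r, exists! m, Q m r) ->
  Dt (fun r => the (fun m => Q m r)).
Proof.
  intros HQ U. apply Dt_intro. revert HQ; apply D_ext; intros r.
  destruct (U (fun n => r (S n))) as (m & Hm & Um).
  assert (E : Q (the (fun m => Q m (fun n => r (S n)))) (fun n => r (S n)))
    by (apply (the_spec (fun m => Q m (fun n => r (S n)))); eauto).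
  split; [intros ->; exact E|]. intros H. rewrite <- (Um _ H). now apply Um.
Qed.

Lemma repl_ext a (F G : V -> V) : Df1 F -> Df1 G -> (forall x, x ∈ a -> F x = G x) ->
  repl a F = repl a G.
Proof.
  intros HF HG E; apply set_ext; intros y. rewrite !in_repl by assumption.
  split; intros (x & Hx & ->); exists x; rewrite E; auto.
Qed.

(** A case distinction built from separation by a constant predicate, so that its definability
    reduces to that of [sep] and [cup]. *)
Definition ite (P : Prop) a b : V := cup (sep a (fun _ => P)) (sep b (fun _ => ~ P)).

Lemma ite_true (P : Prop) a b : P -> ite P a b = a.
Proof.
  intros H; apply set_ext; intros x. unfold ite. rewrite in_cup, !in_sep by dfn. tauto.
Qed.

Lemma ite_false (P : Prop) a b : ~ P -> ite P a b = b.
Proof.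
  intros H; apply set_ext; intros x. unfold ite. rewrite in_cup, !in_sep by dfn. tauto.
Qed.

Lemma Dt_ite (P : (nat -> V) -> Prop) s t : D P -> Dt s -> Dt t -> Dt (fun r => ite (P r) (s r) (t r)).
Proof.
  intros HP Hs Ht. unfold ite. dfn; try assumption; exact (D_rename P S HP).
Qed.

Lemma D_transitive : D1 (@transitive_set V).
Proof. unfold transitive_set; dfn. Qed.
Hint Resolve D_transitive : dfn.
Lemma D_ordinal : D1 (@ordinal V).
Proof. unfold ordinal; dfn. Qed.
Hint Resolve D_ordinal : dfn.

Lemma mem_cycle3 x y z : x ∈ y -> y ∈ z -> ~ z ∈ x.
Proof.
  intros H1 H2 H3.
  destruct (foundation (cup (upair x y) (sing z)) x) as (m & Hm & U).
  - rewrite in_cup, in_upair; auto.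
  - rewrite in_cup, in_upair, in_sing in Hm.
    destruct Hm as [[-> | ->] | ->];
      [apply (U z H3)|apply (U x H1)|apply (U y H2)]; rewrite in_cup, in_upair, in_sing; auto.
Qed.

Lemma ord_mem a x : ordinal a -> x ∈ a -> ordinal x.
Proof.
  intros [Ta La] Hx. split.
  - intros y z Hy Hz.
    assert (y ∈ a) by eauto. assert (z ∈ a) by eauto.
    destruct (La z x) as [h|[h|h]]; auto; subst; exfalso.
    + exact (mem_asym _ _ Hy Hz).
    + exact (mem_cycle3 _ _ _ Hz Hy h).
  - intros y z Hy Hz. apply La; eauto.
Qed.

Lemma ord_sub_mem a b : ordinal a -> ordinal b -> subset a b -> a <> b -> a ∈ b.
Proof.
  intros Oa Ob S N.
  assert (exists x, x ∈ sep b (fun x => ~ x ∈ a)) as [x Hx].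
  { apply nonempty_ex; intros E. apply N, set_ext; intros x; split; [apply S|].
    intros Hx; apply NNPP; intros h. apply (in_emp x); rewrite <- E, in_sep by dfn; auto. }
  (* The minimal element of [b] outside [a] turns out to be [a] itself. *)
  destruct (foundation _ _ Hx) as (m & Hm & U). clear x Hx.
  apply in_sep in Hm; [|dfn]. destruct Hm as [Hb Ha].
  replace a with m; [exact Hb|]. apply set_ext; intros z; split; intros Hz.
  - apply NNPP; intros h. apply (U z Hz), in_sep; [dfn|]. split; [|exact h].
    exact (proj1 Ob m z Hb Hz).
  - assert (Hzb := S z Hz). destruct (proj2 Ob z m Hzb Hb) as [h|[h|h]]; [exact h|subst; tauto|].
    exfalso; apply Ha. exact (proj1 Oa z m Hz h).
Qed.

Lemma ord_trich a b : ordinal a -> ordinal b -> a ∈ b \/ a = b \/ b ∈ a.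
Proof.
  intros Oa Ob.
  set (c := sep a (fun x => x ∈ b)).
  assert (Hc : forall x, x ∈ c <-> x ∈ a /\ x ∈ b) by sep_spec.
  assert (Oc : ordinal c).
  { split.
    - intros x y Hx Hy. apply Hc in Hx; apply Hc; destruct Hx; split;
        [exact (proj1 Oa x y H Hy)|exact (proj1 Ob x y H0 Hy)].
    - intros x y Hx Hy; apply (proj2 Oa); [apply Hc in Hx|apply Hc in Hy]; tauto. }
  destruct (classic (c = a)) as [E|E].
  - destruct (classic (a = b)) as [E'|E']; [auto|left].
    apply ord_sub_mem; auto. intros x Hx. rewrite <- E in Hx. now apply Hc in Hx.
  - destruct (classic (c = b)) as [E'|E'].
    + right; right. rewrite <- E'. apply ord_sub_mem; auto. intros x Hx; now apply Hc in Hx.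
    + exfalso. apply (mem_irrefl c), Hc.
      split; apply ord_sub_mem; auto; intros x Hx; now apply Hc in Hx.
Qed.

Lemma ord_le_subset a b : ordinal a -> ordinal b -> (ord_le a b <-> subset a b).
Proof.
  intros Oa Ob; split.
  - intros [h| ->]; [|now intros x]. intros x Hx; exact (proj1 Ob a x h Hx).
  - intros H. destruct (classic (a = b)) as [E|E]; [now right|left]. now apply ord_sub_mem.
Qed.

Lemma ord_not_mem a b : ordinal a -> ordinal b -> (~ a ∈ b <-> ord_le b a).
Proof.
  intros Oa Ob; split.
  - intros H. destruct (ord_trich a b) as [h|[h|h]]; auto; [tauto|right; auto|left; auto].
  - intros [h| ->] h'; [exact (mem_asym _ _ h h')|exact (mem_irrefl _ h')].
Qed.

Lemma ord_mem_trans a b c : ordinal c -> a ∈ b -> b ∈ c -> a ∈ c.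
Proof. intros Oc H H'; exact (proj1 Oc b a H' H). Qed.

Lemma ord_le_mem_trans a b c : ordinal c -> ord_le a b -> b ∈ c -> a ∈ c.
Proof. intros Oc [H| ->] H'; [exact (proj1 Oc b a H' H)|exact H']. Qed.

Lemma ord_mem_le_trans a b c : ordinal c -> a ∈ b -> ord_le b c -> a ∈ c.
Proof. intros Oc H [H'| <-]; [exact (proj1 Oc b a H' H)|exact H]. Qed.

Lemma ord_emp : ordinal emp.
Proof. split; intros x y H; exfalso; exact (in_emp x H). Qed.

Lemma ord_emp_mem a x : ordinal a -> x ∈ a -> emp ∈ a.
Proof.
  intros Oa Hx. destruct (ord_trich emp a ord_emp Oa) as [h|[h|h]]; auto;
    [subst; exfalso; exact (in_emp x Hx)|exfalso; exact (in_emp a h)].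
Qed.

Lemma ord_succ a : ordinal a -> ordinal (succ a).
Proof.
  intros Oa; split.
  - intros x y Hx Hy; apply in_succ in Hx; apply in_succ; left.
    destruct Hx as [Hx | ->]; [exact (proj1 Oa x y Hx Hy)|exact Hy].
  - intros x y Hx Hy; apply in_succ in Hx, Hy. apply ord_trich;
      [destruct Hx as [Hx | ->]|destruct Hy as [Hy | ->]]; auto; eapply ord_mem; eauto.
Qed.

Lemma ord_union a : (forall x, x ∈ a -> ordinal x) -> ordinal (union a).
Proof.
  intros H; split.
  - intros x y Hx Hy; apply in_union in Hx; destruct Hx as (s & Hs & Hx).
    apply in_union; exists s; split; [exact Hs|]. exact (proj1 (H s Hs) x y Hx Hy).
  - intros x y Hx Hy; apply in_union in Hx, Hy.
    destruct Hx as (s & Hs & Hx), Hy as (t & Ht & Hy).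
    apply ord_trich; [exact (ord_mem s x (H s Hs) Hx)|exact (ord_mem t y (H t Ht) Hy)].
Qed.

Lemma ord_least (P : V -> Prop) a : D1 P -> ordinal a -> P a ->
  exists m, ordinal m /\ P m /\ (forall x, x ∈ m -> ~ P x).
Proof.
  intros HP Oa Pa.
  destruct (foundation (sep (succ a) P) a) as (m & Hm & U).
  - apply in_sep; [exact HP|]. rewrite in_succ; auto.
  - apply in_sep in Hm; [|exact HP]. destruct Hm as [Hm Pm].
    exists m; split; [|split; [exact Pm|]].
    + exact (ord_mem _ _ (ord_succ _ Oa) Hm).
    + intros x Hx Px; apply (U x Hx), in_sep; [exact HP|]. split; [|exact Px].
      exact (proj1 (ord_succ _ Oa) m x Hm Hx).
Qed.

Lemma ord_induction (P : V -> Prop) : D1 P ->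
  (forall a, ordinal a -> (forall x, x ∈ a -> P x) -> P a) -> forall a, ordinal a -> P a.
Proof.
  intros HP IH a Oa. apply NNPP; intros h.
  destruct (ord_least (fun x => ~ P x) a) as (m & Om & Pm & U); auto.
  { apply D_not, HP. }
  apply Pm, IH; auto. intros x Hx; apply NNPP, U, Hx.
Qed.

(* Equal to [emp] when no ordinal satisfies [P], so that the operation is total and definable. *)
Definition least (P : V -> Prop) : V :=
  the (fun m => (ordinal m /\ P m /\ forall x, x ∈ m -> ~ P x) \/
                ((forall x, ordinal x -> ~ P x) /\ m = emp)).

Lemma least_unique (P : V -> Prop) : D1 P ->
  exists! m, (ordinal m /\ P m /\ forall x, x ∈ m -> ~ P x) \/
             ((forall x, ordinal x -> ~ P x) /\ m = emp).
Proof.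
  intros HP. destruct (classic (exists a, ordinal a /\ P a)) as [(a & Oa & Pa)|N].
  - destruct (ord_least P a HP Oa Pa) as (m & Om & Pm & U).
    exists m; split; [auto|]. intros m' [(Om' & Pm' & U')|(h & _)]; [|exfalso; exact (h a Oa Pa)].
    destruct (ord_trich m m') as [h|[h|h]]; auto; exfalso; [exact (U' _ h Pm)|exact (U _ h Pm')].
  - exists emp; split; [right; split; [|reflexivity]; eauto|].
    intros m' [(Om' & Pm' & U')|(h & ->)]; [exfalso; eauto|reflexivity].
Qed.

Lemma least_spec (P : V -> Prop) a : D1 P -> ordinal a -> P a ->
  ordinal (least P) /\ P (least P) /\ (forall x, ordinal x -> P x -> ord_le (least P) x).
Proof.
  intros HP Oa Pa.
  destruct (least_unique P HP) as (m & Hm & _).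
  assert (S := the_spec (fun m => (ordinal m /\ P m /\ forall x, x ∈ m -> ~ P x) \/
                ((forall x, ordinal x -> ~ P x) /\ m = emp)) (ex_intro _ m Hm)).
  destruct S as [(O & Q & U)|(h & _)]; [|exfalso; exact (h a Oa Pa)].
  fold (least P) in O, Q, U. split; [exact O|split; [exact Q|]].
  intros x Ox Px. apply ord_not_mem; auto. intros h; exact (U x h Px).
Qed.

Lemma Dt_least (P : V -> (nat -> V) -> Prop) :
  D (fun r => P (r 0) (fun n => r (S n))) -> Dt (fun r => least (fun x => P x r)).
Proof.
  intros HP. unfold least.
  apply (Dt_the (fun m r => (ordinal m /\ P m r /\ forall x, x ∈ m -> ~ P x r) \/
                            ((forall x, ordinal x -> ~ P x r) /\ m = emp))).
  - dfn; try exact HP;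
      exact (D_rename (fun r => P (r 0) (fun n => r (S n))) (env_cons 0 (fun n => S (S n))) HP).
  - intros r. apply least_unique.
    apply (D_subst _ (env_cons (fun r => r 0) (fun n _ => r n)) HP).
    intros [|n]; simpl; dfn.
Qed.

Lemma D_natural : D1 (@natural V).
Proof. unfold natural, ord_le, is_empty, is_succ; dfn. Qed.

Lemma natural_emp : natural emp.
Proof.
  split; [exact ord_emp|]. intros m [h| ->]; [exfalso; exact (in_emp _ h)|left; exact in_emp].
Qed.

Lemma natural_succ (n : V) : natural n -> natural (succ n).
Proof.
  intros [On H]; split; [now apply ord_succ|].
  intros m [h| ->]; [|right; exists n; now apply is_succE].
  apply in_succ in h; apply H; exact h.
Qed.

Lemma natural_mem (n m : V) : natural n -> m ∈ n -> natural m.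
Proof.
  intros [On H] Hm; split; [exact (ord_mem _ _ On Hm)|].
  intros k Hk; apply H. left. exact (ord_le_mem_trans _ _ _ On Hk Hm).
Qed.

Lemma omega_exists : exists w : V, is_omega w.
Proof.
  destruct (zfc_infinity V HV) as (i & (e & He & Hei) & Hs).
  apply is_empty_emp in He; subst e.
  exists (sep i natural). intros n. rewrite in_sep by apply D_natural.
  split; [tauto|]. intros Hn; split; [|exact Hn]. apply NNPP; intros N.
  destruct (ord_least (fun x => natural x /\ ~ x ∈ i) n) as (m & Om & [Nm Im] & U);
    [apply D_and; [apply D_natural|dfn]|apply Hn|auto|].
  destruct (proj2 Nm m) as [E|[k E]]; [right; auto|apply is_empty_emp in E; subst; auto|].
  apply is_succE in E; subst m.
  assert (Hk : k ∈ succ k) by (apply in_succ; auto).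
  assert (Hki : k ∈ i).
  { apply NNPP; intros h. apply (U k Hk). split; [exact (natural_mem _ _ Nm Hk)|exact h]. }
  destruct (Hs k Hki) as (s & E & Hsi). apply is_succE in E; subst; auto.
Qed.

Definition omega : V := the is_omega.

Lemma in_omega n : n ∈ omega <-> natural n.
Proof. apply (the_spec is_omega omega_exists). Qed.

Lemma is_omegaE w : is_omega w <-> w = omega.
Proof.
  split; [|intros ->; intros n; apply in_omega].
  intros H; apply set_ext; intros n. rewrite in_omega; apply H.
Qed.

Lemma emp_omega : emp ∈ omega.
Proof. apply in_omega, natural_emp. Qed.

Lemma succ_omega n : n ∈ omega -> succ n ∈ omega.
Proof. rewrite !in_omega; apply natural_succ. Qed.

Lemma omega_induction (P : V -> Prop) : D1 P -> P emp ->
  (forall n, n ∈ omega -> P n -> P (succ n)) -> forall n, n ∈ omega -> P n.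
Proof.
  intros HP P0 PS. intros n Hn. apply NNPP; intros h.
  destruct (ord_least (fun x => natural x /\ ~ P x) n) as (m & Om & [Nm Im] & U);
    [apply D_and; [apply D_natural|apply D_not, HP]|apply in_omega, Hn|split; [apply in_omega|]; auto|].
  destruct (proj2 Nm m) as [E|[k E]]; [right; auto|apply is_empty_emp in E; subst; auto|].
  apply is_succE in E; subst m.
  assert (Hk : k ∈ succ k) by (apply in_succ; auto).
  apply Im, PS; [apply in_omega; exact (natural_mem _ _ Nm Hk)|].
  apply NNPP; intros N. apply (U k Hk); split; [exact (natural_mem _ _ Nm Hk)|exact N].
Qed.

Lemma succ_inj a b : succ a = succ b -> a = b.
Proof.
  intros E. assert (H : a ∈ succ b) by (rewrite <- E; apply in_succ; auto).
  assert (H' : b ∈ succ a) by (rewrite E; apply in_succ; auto).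
  apply in_succ in H, H'. destruct H as [H|H], H' as [H'|H']; auto.
  exfalso; exact (mem_asym _ _ H H').
Qed.

Lemma succ_not_emp a : succ a <> emp.
Proof. intros E. apply (in_emp a). rewrite <- E. apply in_succ; auto. Qed.

End Ordinals.

#[export] Hint Resolve D_transitive D_ordinal D_natural : dfn.

Ltac dfn_binder ::=
  match goal with
  | |- Dt (fun r => sep _ _) => simple apply Dt_sep
  | |- Dt (fun r => repl _ _) => simple apply Dt_repl
  | |- Dt (fun r => func _ _) => simple apply Dt_func
  | |- Dt (fun r => ite _ _ _) => simple apply Dt_ite
  | |- Dt (fun r => least _) => simple apply Dt_least
  end.

(** * Well-founded recursion *)

Section LocalRecursion.
Context {V : set_structure} {HV : ZFC V}.
Variables (pred : V -> V) (H : V -> V -> V).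
Hypothesis Dpred : Df1 pred.
Hypothesis DH : Df2 H.
Hypothesis wf : forall a x, x ∈ a -> exists m, m ∈ a /\ forall y, y ∈ pred m -> ~ y ∈ a.
(* Discharged later: closures are themselves obtained by recursion on [omega]. *)
Hypothesis closed : forall x, exists c, x ∈ c /\ forall y z, y ∈ c -> z ∈ pred y -> z ∈ c.

(** A set-sized approximation to the recursion: single-valued, with a domain closed under [pred],
    and satisfying the equation there. [H] receives the set of earlier values, not the function
    restricted to the predecessors; hierarchy, enumeration and collapse need no more. *)
Let attempt (t : V) : Prop :=
  (forall x y y', pair x y ∈ t -> pair x y' ∈ t -> y = y') /\
  (forall x y, pair x y ∈ t ->
    (forall z, z ∈ pred x -> exists v, pair z v ∈ t) /\ y = H x (repl (pred x) (app t))).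

Let D_attempt : D1 attempt.
Proof. unfold attempt; dfn. Qed.

Let attempt_app t x y : attempt t -> pair x y ∈ t -> app t x = y.
Proof. intros At Ht. apply app_eq; auto. intros y' h; exact (proj1 At x y' y h Ht). Qed.

Let attempt_agree t t' x y y' :
  attempt t -> attempt t' -> pair x y ∈ t -> pair x y' ∈ t' -> y = y'.
Proof.
  intros At At' Ht Ht'. apply NNPP; intros N.
  (* The points where the two attempts disagree; at a minimal one the earlier values agree, and so
     do the two sides of the equation. *)
  set (A := sep (union (union t)) (fun x => exists y y', pair x y ∈ t /\ pair x y' ∈ t' /\ y <> y')).
  assert (HA : forall x, x ∈ A <-> exists y y', pair x y ∈ t /\ pair x y' ∈ t' /\ y <> y').
  { intros u. unfold A. rewrite in_sep by dfn. split; [tauto|]. intros h; split; [|exact h].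
    destruct h as (v & v' & h & _). apply in_union; exists (sing u); split; [|now apply in_sing].
    apply in_union; exists (pair u v); split; [exact h|apply in_upair; auto]. }
  destruct (wf A x) as (m & Hm & U); [apply HA; eauto|].
  apply HA in Hm. destruct Hm as (v & v' & Hv & Hv' & Nv). apply Nv.
  destruct (proj2 At m v Hv) as [C ->]. destruct (proj2 At' m v' Hv') as [C' ->].
  f_equal. apply repl_ext; [dfn|dfn|]. intros z Hz.
  destruct (C z Hz) as [u Hu]. destruct (C' z Hz) as [u' Hu'].
  rewrite (attempt_app t z u), (attempt_app t' z u'); auto.
  apply NNPP; intros h. apply (U z Hz), HA. eauto.
Qed.

Let val (x y : V) : Prop := exists t, attempt t /\ pair x y ∈ t.
Let D_val : D2 val.
Proof. unfold val; dfn. Qed.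

Let val_total x : exists y, val x y.
Proof.
  apply NNPP; intros N. destruct (closed x) as (c & Hx & Cc).
  destruct (wf (sep c (fun x => ~ exists y, val x y)) x) as (m & Hm & U).
  { apply in_sep; [dfn|auto]. }
  apply in_sep in Hm; [|dfn]. destruct Hm as [Hmc Hm].
  set (c' := sep c (fun x => exists y, val x y)).
  assert (Hc' : forall x, x ∈ c' <-> x ∈ c /\ exists y, val x y) by sep_spec.
  assert (exists F : V -> V, Df1 F /\ forall x y, val x y -> F x = y) as (F & DF & HF).
  { exists (fun x => the (fun y => val x y \/ ((forall v, ~ val x v) /\ y = emp))); split.
    - apply (Dt_the (fun y r => val (r 0) y \/ ((forall v, ~ val (r 0) v) /\ y = emp))).
      + dfn.
      + intros r. destruct (classic (exists v, val (r 0) v)) as [[v hv]|h].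
        * exists v; split; [auto|]. intros v' [h'|[h' _]]; [|exfalso; exact (h' v hv)].
          destruct hv as (t & At & Ht), h' as (t' & At' & Ht').
          exact (attempt_agree t t' _ _ _ At At' Ht Ht').
        * exists emp; split; [right; split; [intros v h'; apply h; exists v; exact h'|reflexivity]|].
          intros v' [h'|[_ ->]]; [exfalso; apply h; exists v'; exact h'|reflexivity].
    - intros u v hv.
      destruct (the_spec (fun y => val u y \/ ((forall v, ~ val u v) /\ y = emp)))
        as [h|[h _]]; [exists v; left; exact hv| |exfalso; exact (h v hv)].
      destruct hv as (t & At & Ht), h as (t' & At' & Ht').
      exact (attempt_agree t' t _ _ _ At' At Ht' Ht). }
  (* All values known inside the closure form one function; adjoining the value that the equation
     prescribes at the minimal bad point [m] gives an attempt defined at [m]. *)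
  set (t := cup (func c' F) (sing (pair m (H m (repl (pred m) F))))).
  assert (Ht : forall u v, pair u v ∈ t <->
     (u ∈ c' /\ v = F u) \/ (u = m /\ v = H m (repl (pred m) F))).
  { intros u v. unfold t. rewrite in_cup, in_sing, <- mapsE, maps_func by exact DF.
    split; intros [h|h]; auto; right; [now apply pair_inj in h|now destruct h; subst]. }
  assert (Nm : ~ m ∈ c') by (rewrite Hc'; tauto).
  assert (F1 : forall x y y', pair x y ∈ t -> pair x y' ∈ t -> y = y').
  { intros u v v'. rewrite !Ht. intros [[h ->]|[-> ->]] [[h' ->]|[h' ->]]; subst; tauto. }
  assert (At : forall u, u ∈ c' -> app t u = F u).
  { intros u Hu. apply app_eq; [apply Ht; auto|]. intros v hv.
    apply (F1 u); [exact hv|apply Ht; auto]. }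
  assert (Pm : forall z, z ∈ pred m -> z ∈ c').
  { intros z Hz. apply Hc'; split; [eauto|]. apply NNPP; intros h.
    apply (U z Hz), in_sep; [dfn|split; eauto]. }
  apply Hm. exists (H m (repl (pred m) F)), t; split; [|apply Ht; auto].
  split; [exact F1|]. intros u v Huv. apply Ht in Huv.
  assert (Pu : forall z, z ∈ pred u -> z ∈ c').
  { destruct Huv as [[Hu _]|[-> _]]; [|exact Pm]. intros z Hz. apply Hc' in Hu.
    destruct Hu as (Hu & y & s & As & Hs). apply Hc'; split; [eauto|].
    destruct (proj1 (proj2 As u y Hs) z Hz) as [v' Hv']. exists v', s; auto. }
  split.
  - intros z Hz; exists (F z); apply Ht; auto.
  - destruct Huv as [[Hu ->]|[-> ->]].
    + apply Hc' in Hu. destruct Hu as (Hu & y & s & As & Hs).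
      rewrite (HF u y); [|exists s; auto]. destruct (proj2 As u y Hs) as [C ->].
      f_equal. apply repl_ext; [dfn|dfn|]. intros z Hz.
      rewrite At by auto. destruct (C z Hz) as [v' Hv'].
      rewrite (attempt_app s z v'), (HF z v'); auto. exists s; auto.
    + f_equal. apply repl_ext; [dfn|dfn|]. intros z Hz. rewrite At; auto.
Qed.

Lemma local_recursion : exists F : V -> V, Df1 F /\ forall x, F x = H x (repl (pred x) F).
Proof.
  exists (fun x => the (val x)).
  assert (DF : Df1 (fun x => the (val x))).
  { apply (Dt_the (fun y r => val (r 0) y)); [dfn|].
    intros r. destruct (val_total (r 0)) as [v hv]. exists v; split; [exact hv|].
    intros v' h'. destruct hv as (t & At & Ht), h' as (t' & At' & Ht').
          exact (attempt_agree t t' _ _ _ At At' Ht Ht'). }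
  split; [exact DF|]. intros x.
  assert (E : forall x y, val x y -> the (val x) = y).
  { intros u v hv. destruct (the_spec (val u) (val_total u)) as (t' & At' & Ht').
    destruct hv as (t & At & Ht). exact (attempt_agree t' t _ _ _ At' At Ht' Ht). }
  destruct (val_total x) as [y Hy]. rewrite (E x y Hy).
  destruct Hy as (t & At & Ht). destruct (proj2 At x y Ht) as [C ->].
  f_equal. apply repl_ext; [dfn|exact DF|]. intros z Hz. destruct (C z Hz) as [v Hv].
  rewrite (attempt_app t z v), (E z v); auto. exists t; auto.
Qed.
End LocalRecursion.

Section Recursion.
Context {V : set_structure} {HV : ZFC V}.

Lemma iterate_exists (g : V -> V) (x0 : V) : Df1 g ->
  exists F : V -> V, Df1 F /\ F emp = x0 /\ forall n, n ∈ omega -> F (succ n) = g (F n).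
Proof.
  intros Dg.
  (* A number has at most one predecessor, so the union of the set of earlier values is the previous
     value. Closures exist trivially for this relation, since adding a point to [omega] suffices;
     this avoids a circle with [closure_exists]. *)
  destruct (local_recursion (fun n => sep omega (fun k => n = succ k))
              (fun n I => ite (n = emp) x0 (g (union I)))) as (F & DF & E).
  - dfn.
  - dfn.
  - intros a x Hx. destruct (foundation a x Hx) as (m & Hm & U). exists m; split; [exact Hm|].
    intros y Hy. apply in_sep in Hy; [|dfn]. destruct Hy as [_ ->]. apply U, in_succ; auto.
  - intros x. exists (cup omega (sing x)). split; [apply in_cup; right; now apply in_sing|].
    intros y z _ Hz. apply in_sep in Hz; [|dfn]. apply in_cup; tauto.
  - exists F; split; [exact DF|split].
    + rewrite E. now apply ite_true.
    + intros n Hn. rewrite E, ite_false by apply succ_not_emp. f_equal.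
      apply set_ext; intros z. rewrite in_union. split.
      * intros (y & Hy & Hz). apply in_repl in Hy; [|exact DF]. destruct Hy as (k & Hk & ->).
        apply in_sep in Hk; [|dfn]. destruct Hk as [_ Hk]. apply succ_inj in Hk; now subst.
      * intros Hz. exists (F n); split; [|exact Hz]. apply in_repl; [exact DF|].
        exists n; split; [|reflexivity]. apply in_sep; [dfn|auto].
Qed.

Lemma closure_exists (pred : V -> V) (x : V) : Df1 pred ->
  exists c, x ∈ c /\ forall y z, y ∈ c -> z ∈ pred y -> z ∈ c.
Proof.
  intros Dp.
  destruct (iterate_exists (fun s => union (repl s pred)) (sing x)) as (F & DF & F0 & FS);
    [dfn|].
  exists (union (repl omega F)); split.
  - apply in_union; exists (F emp); split; [|rewrite F0; now apply in_sing].
    apply in_repl; [exact DF|]; exists emp; split; [apply emp_omega|auto].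
  - intros y z Hy Hz. apply in_union in Hy; destruct Hy as (s & Hs & Hy).
    apply in_repl in Hs; [|exact DF]. destruct Hs as (n & Hn & ->).
    apply in_union; exists (F (succ n)); split.
    + apply in_repl; [exact DF|]; exists (succ n); split; [now apply succ_omega|auto].
    + rewrite FS by exact Hn. apply in_union; exists (pred y); split; [|exact Hz].
      apply in_repl; [exact Dp|eauto].
Qed.

Theorem recursion (pred : V -> V) (H : V -> V -> V) : Df1 pred -> Df2 H ->
  (forall a x, x ∈ a -> exists m, m ∈ a /\ forall y, y ∈ pred m -> ~ y ∈ a) ->
  exists F : V -> V, Df1 F /\ forall x, F x = H x (repl (pred x) F).
Proof.
  intros Dp DH wf. apply local_recursion; auto. intros x; now apply closure_exists.
Qed.

Lemma wf_induction (pred : V -> V) (P : V -> Prop) : Df1 pred -> D1 P ->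
  (forall a x, x ∈ a -> exists m, m ∈ a /\ forall y, y ∈ pred m -> ~ y ∈ a) ->
  (forall x, (forall y, y ∈ pred x -> P y) -> P x) -> forall x, P x.
Proof.
  intros Dp DP wf IH x. apply NNPP; intros N.
  destruct (closure_exists pred x Dp) as (c & Hx & Cc).
  destruct (wf (sep c (fun x => ~ P x)) x) as (m & Hm & U); [apply in_sep; [dfn|auto]|].
  apply in_sep in Hm; [|dfn]. destruct Hm as [Hmc Hm]. apply Hm, IH.
  intros y Hy; apply NNPP; intros h. apply (U y Hy), in_sep; [dfn|split; eauto].
Qed.
End Recursion.

(** * Choice and cardinality *)

Section Choice.
Context {V : set_structure} {HV : ZFC V}.
Implicit Types (a b c d x y z f A B mu lam : V).

Lemma choice_function A : exists c, forall x, x ∈ A -> x <> emp -> app c x ∈ x.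
Proof.
  (* Choice is assumed for disjoint families; tagging each [x] as {x} x x makes the family
     disjoint. *)
  set (B := repl (sep A (fun x => x <> emp)) (fun x => prod (sing x) x)).
  assert (HB : forall b, b ∈ B <-> exists x, x ∈ sep A (fun x => x <> emp) /\ b = prod (sing x) x)
    by (intros; unfold B; apply in_repl; dfn).
  assert (Hp : forall p x, p ∈ prod (sing x) x <-> exists u, u ∈ x /\ p = pair x u).
  { intros p x; rewrite in_prod; split.
    - intros (v & u & Hv & Hu & ->). apply in_sing in Hv; subst; eauto.
    - intros (u & Hu & ->). exists x, u; rewrite in_sing; auto. }
  destruct (zfc_choice V HV B) as (c & Hc).
  - intros b Hb E. apply HB in Hb; destruct Hb as (x & Hx & ->).
    apply in_sep in Hx; [|dfn]. destruct Hx as [_ Hx]. apply nonempty_ex in Hx.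
    destruct Hx as [u Hu]. apply (E (pair x u)), Hp; eauto.
  - intros b b' p Hb Hb' Hpb Hpb'. apply HB in Hb, Hb'.
    destruct Hb as (x & _ & ->), Hb' as (x' & _ & ->).
    apply Hp in Hpb, Hpb'. destruct Hpb as (u & _ & ->), Hpb' as (u' & _ & E).
    apply pair_inj in E. now destruct E as [-> _].
  - exists (sep c (fun p => exists b, b ∈ B /\ p ∈ b)). intros x Hx Nx.
    assert (Hb : prod (sing x) x ∈ B) by (apply HB; exists x; rewrite in_sep by dfn; auto).
    destruct (Hc _ Hb) as (p & [Hpx Hpc] & U). apply Hp in Hpx. destruct Hpx as (u & Hu & ->).
    rewrite (app_eq _ x u); [exact Hu| |].
    + apply in_sep; [dfn|]. split; [exact Hpc|]. exists (prod (sing x) x). rewrite Hp; eauto.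
    + intros y Hy. apply in_sep in Hy; [|dfn]. destruct Hy as (Hyc & b & Hb' & Hy).
      apply HB in Hb'; destruct Hb' as (x' & Hx' & ->). assert (Hy' := Hy).
      apply Hp in Hy. destruct Hy as (u' & Hu' & E). apply pair_inj in E.
      destruct E as [<- <-]. symmetry.
      apply (pair_inj x u x y), U; auto.
Qed.

(** At an ordinal this is the level of the cumulative hierarchy with that index; defining it on all
    sets lets membership recursion apply directly. *)
Lemma hierarchy_exists : exists F : V -> V, Df1 F /\
  forall x z, z ∈ F x <-> exists y, y ∈ x /\ subset z (F y).
Proof.
  destruct (recursion (fun x => x) (fun x I => union (repl I pow))) as (F & DF & E);
    [dfn|dfn|exact foundation|].
  exists F; split; [exact DF|]. intros x z. rewrite E, in_union. split.
  - intros (s & Hs & Hz). apply in_repl in Hs; [|dfn]. destruct Hs as (t & Ht & ->).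
    apply in_repl in Ht; [|exact DF]. destruct Ht as (y & Hy & ->).
    apply in_pow in Hz; eauto.
  - intros (y & Hy & Hz). exists (pow (F y)); split; [|now apply in_pow].
    apply in_repl; [dfn|]. exists (F y); split; [|auto]. apply in_repl; eauto.
Qed.

Lemma mem_induction (P : V -> Prop) : D1 P ->
  (forall x, (forall y, y ∈ x -> P y) -> P x) -> forall x, P x.
Proof. intros DP. apply (wf_induction (fun x => x)); [dfn|exact DP|exact foundation]. Qed.

Lemma collection a (R : V -> V -> Prop) : D2 R -> (forall x, x ∈ a -> exists y, R x y) ->
  exists b, forall x, x ∈ a -> exists y, y ∈ b /\ R x y.
Proof.
  intros DR HR. destruct hierarchy_exists as (F & DF & HF).
  assert (mono : forall s t, subset s t -> subset (F s) (F t)).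
  { intros s t H z Hz. apply HF in Hz. destruct Hz as (y & Hy & Hz). apply HF; eauto. }
  (* The supremum of the least witnesses bounds ordinal witnesses for a whole set. It is used twice:
     to show that every set lies in some level, and to bound the levels in which [R] has
     witnesses. *)
  assert (K : forall b (Q : V -> V -> Prop), D2 Q ->
    (forall x, x ∈ b -> exists al, ordinal al /\ Q x al) ->
    exists be, ordinal be /\ forall x, x ∈ b -> exists al, ordinal al /\ subset al be /\ Q x al).
  { intros b Q DQ HQ.
    exists (union (repl b (fun x => least (Q x)))).
    assert (L : forall x, x ∈ b -> ordinal (least (Q x)) /\ Q x (least (Q x))).
    { intros x Hx. destruct (HQ x Hx) as (al & O & H).
      destruct (least_spec (Q x) al) as (O' & H' & _); auto; dfn. }
    split.
    - apply ord_union. intros x Hx. apply in_repl in Hx; [|dfn]. destruct Hx as (y & Hy & ->).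
      now apply L.
    - intros x Hx. exists (least (Q x)). destruct (L x Hx) as [O H]. repeat split; try apply O; auto.
      intros z Hz; apply in_union; exists (least (Q x)); split; [|exact Hz].
      apply in_repl; [dfn|eauto]. }
  assert (rank : forall y, exists al, ordinal al /\ subset y (F al)).
  { apply (mem_induction (fun y => exists al, ordinal al /\ subset y (F al))); [dfn|].
    intros y IH. destruct (K y (fun z al => subset z (F al))) as (be & O & H); [dfn|exact IH|].
    exists (succ be); split; [now apply ord_succ|]. intros z Hz. destruct (H z Hz) as (al & Oal & S & Sz).
    apply HF. exists be; split; [apply in_succ; auto|].
    intros u Hu. apply (mono al be S), Sz, Hu. }
  destruct (K a (fun x al => exists y, subset y (F al) /\ R x y)) as (be & O & H); [dfn| |].
  - intros x Hx. destruct (HR x Hx) as [y Hy]. destruct (rank y) as (al & Oal & S). eauto.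
  - exists (pow (F be)). intros x Hx. destruct (H x Hx) as (al & _ & S & y & Sy & Hy).
    exists y; split; [|exact Hy]. apply in_pow. intros z Hz; apply (mono al be S), Sy, Hz.
Qed.

Lemma class_choice a (R : V -> V -> Prop) : D2 R -> (forall x, x ∈ a -> exists y, R x y) ->
  exists g, function_on g a /\ forall x, x ∈ a -> R x (app g x).
Proof.
  intros DR HR. destruct (collection a R DR HR) as (b & Hb).
  destruct (choice_function (pow b)) as (c & Hc).
  exists (func a (fun x => app c (sep b (fun y => R x y)))); split; [apply func_on; dfn|].
  intros x Hx. rewrite app_func by (auto; dfn).
  assert (h : app c (sep b (fun y => R x y)) ∈ sep b (fun y => R x y)).
  { apply Hc.
    - apply in_pow. intros y Hy. apply in_sep in Hy; [tauto|dfn].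
    - intros E. destruct (Hb x Hx) as (y & Hy & HRy). apply (in_emp y). rewrite <- E.
      apply in_sep; [dfn|auto]. }
  apply in_sep in h; [tauto|dfn].
Qed.

Lemma ordinals_not_set a : exists x, ordinal x /\ ~ x ∈ a.
Proof.
  apply NNPP; intros N.
  set (u := union (sep a ordinal)).
  assert (Ou : ordinal u).
  { apply ord_union; intros x Hx. apply in_sep in Hx; [tauto|dfn]. }
  apply N. exists (succ u); split; [now apply ord_succ|]. intros h.
  apply (mem_irrefl u). unfold u at 2. apply in_union. exists (succ u); split.
  - apply in_sep; [dfn|]. split; [exact h|now apply ord_succ].
  - apply in_succ; auto.
Qed.

Lemma well_ordering A : exists d (F : V -> V), ordinal d /\ Df1 F /\
  (forall x, x ∈ d -> F x ∈ A) /\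
  (forall x y, x ∈ d -> y ∈ d -> F x = F y -> x = y) /\
  (forall z, z ∈ A -> exists x, x ∈ d /\ z = F x).
Proof.
  destruct (choice_function (pow A)) as (c & Hc).
  destruct (recursion (fun x => x) (fun x I => app c (sep A (fun z => ~ z ∈ I))))
    as (F & DF & E); [dfn|dfn|exact foundation|].
  set (rest := fun x => sep A (fun z => ~ z ∈ repl x F)).
  assert (Drest : Df1 rest) by (unfold rest; dfn).
  assert (Hrest : forall x z, z ∈ rest x <-> z ∈ A /\ ~ exists y, y ∈ x /\ z = F y).
  { intros x z. unfold rest. rewrite in_sep by dfn. rewrite in_repl by dfn. tauto. }
  assert (HF : forall x, rest x <> emp -> F x ∈ rest x).
  { intros x Hx. rewrite E. apply Hc; [|exact Hx].
    apply in_pow. intros z Hz. apply Hrest in Hz; tauto. }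
  assert (inj : forall x y, y ∈ x -> rest x <> emp -> F x <> F y).
  { intros x y Hy Hx Exy. apply HF, Hrest in Hx. apply (proj2 Hx). eauto. }
  (* If [A] were never exhausted, [F] would be injective on all ordinals, and replacement applied to
     its inverse would collect them into a set. *)
  assert (exists x, ordinal x /\ rest x = emp) as (x & Ox & Hx).
  { apply NNPP; intros N.
    assert (N' : forall x, ordinal x -> rest x <> emp) by (intros x O h; apply N; eauto).
    destruct (ordinals_not_set (repl A (fun z => least (fun x => F x = z)))) as (al & O & Hal).
    apply Hal, in_repl; [dfn|]. exists (F al); split.
    - apply (Hrest al), HF, N', O.
    - destruct (least_spec (fun x => F x = F al) al) as (O' & E' & _); auto; [dfn|].
      destruct (ord_trich al (least (fun x => F x = F al)) O O') as [h|[h|h]]; auto; exfalso.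
      + exact (inj _ _ h (N' _ O') E').
      + exact (inj _ _ h (N' _ O) (eq_sym E')). }
  destruct (ord_least (fun x => rest x = emp) x) as (d & Od & Hd & U); auto; [dfn|].
  exists d, F. split; [exact Od|split; [exact DF|split; [|split]]].
  - intros y Hy. apply (Hrest y), HF, U, Hy.
  - intros y z Hy Hz Eyz. assert (Oy := ord_mem _ _ Od Hy). assert (Oz := ord_mem _ _ Od Hz).
    destruct (ord_trich y z Oy Oz) as [h|[h|h]]; auto; exfalso.
    + exact (inj _ _ h (U _ Hz) (eq_sym Eyz)).
    + exact (inj _ _ h (U _ Hy) Eyz).
  - intros z Hz. apply NNPP; intros h. apply (in_emp z). rewrite <- Hd. now apply Hrest.
Qed.

Lemma card_le_intro a b (F : V -> V) : Df1 F -> (forall x, x ∈ a -> F x ∈ b) ->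
  (forall x y, x ∈ a -> y ∈ a -> F x = F y -> x = y) -> card_le a b.
Proof.
  intros DF H I. exists (func a F); split; [now apply func_from_to|].
  intros x x' y Hx Hx'. apply maps_func in Hx, Hx'; try exact DF.
  destruct Hx as [Hx ->], Hx' as [Hx' E]; auto.
Qed.

Lemma card_le_elim a b : card_le a b -> exists f, (forall x, x ∈ a -> app f x ∈ b) /\
  (forall x y, x ∈ a -> y ∈ a -> app f x = app f y -> x = y).
Proof.
  intros (f & Hf & I). exists f; split.
  - intros x Hx; now apply (from_to_app f a).
  - intros x y Hx Hy E. apply (I x y (app f x)); apply (function_maps f a); auto; apply Hf.
Qed.

Lemma card_le_subset a b : subset a b -> card_le a b.
Proof. intros H. apply (card_le_intro a b (fun x => x)); auto; dfn. Qed.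

Lemma card_le_trans a b c : card_le a b -> card_le b c -> card_le a c.
Proof.
  intros H H'. apply card_le_elim in H, H'. destruct H as (f & Hf & If), H' as (g & Hg & Ig).
  apply (card_le_intro a c (fun x => app g (app f x))); auto; dfn.
Qed.

Lemma card_le_surj a b (F : V -> V) : Df1 F ->
  (forall y, y ∈ b -> exists x, x ∈ a /\ y = F x) -> card_le b a.
Proof.
  intros DF H. destruct (class_choice b (fun y x => x ∈ a /\ y = F x)) as (g & _ & Hg); [dfn|exact H|].
  apply (card_le_intro b a (app g)); [dfn|intros x Hx; now apply Hg|].
  intros x y Hx Hy E. rewrite (proj2 (Hg x Hx)), (proj2 (Hg y Hy)), E; auto.
Qed.

Lemma card_le_repl a (F : V -> V) : Df1 F -> card_le (repl a F) a.
Proof. intros DF. apply (card_le_surj a _ F DF). intros y Hy. now apply in_repl in Hy. Qed.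

Lemma card_compare A mu : ordinal mu -> card_le mu A \/ exists d, d ∈ mu /\ card_le A d.
Proof.
  intros Om. destruct (well_ordering A) as (d & F & Od & DF & H1 & H2 & H3).
  destruct (classic (d ∈ mu)) as [h|h].
  - right; exists d; split; [exact h|]. now apply (card_le_surj d A F).
  - left. apply ord_not_mem in h; auto. apply ord_le_subset in h; auto.
    apply (card_le_trans mu d); [now apply card_le_subset|]. now apply (card_le_intro d A F).
Qed.

Lemma card_ltE A mu : cardinal mu -> (card_lt A mu <-> exists d, d ∈ mu /\ card_le A d).
Proof.
  intros [Om Hm]. split.
  - intros [_ H]. destruct (card_compare A mu Om); tauto.
  - intros (d & Hd & H). destruct (Hm d Hd) as [L N]. split; [exact (card_le_trans _ _ _ H L)|].
    intros h. exact (N (card_le_trans _ _ _ h H)).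
Qed.

Lemma card_lt_mono A B mu : card_le A B -> card_lt B mu -> card_lt A mu.
Proof.
  intros H [L N]; split; [exact (card_le_trans _ _ _ H L)|].
  intros h. exact (N (card_le_trans _ _ _ h H)).
Qed.

Lemma mem_succ_cardinal mu lam d : ordinal lam -> is_succ_cardinal mu lam -> d ∈ mu -> card_le d lam.
Proof.
  intros Ol (Cm & Hl & U) Hd. assert (Od := ord_mem _ _ (proj1 Cm) Hd).
  (* [n] is the cardinality of [d]. Were lam below [n], then lam^+ <= [n], so [d] would lie in [n],
     against leastness. *)
  destruct (ord_least (fun n => card_le d n) d) as (n & On & Hn & Un); auto.
  { unfold card_le; dfn. }
  { now apply card_le_subset. }
  assert (Cn : cardinal n).
  { split; [exact On|]. intros x Hx. split.
    - apply card_le_subset. intros y Hy; exact (proj1 On x y Hx Hy).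
    - intros h. exact (Un x Hx (card_le_trans _ _ _ Hn h)). }
  destruct (classic (lam ∈ n)) as [h|h].
  - exfalso. assert (Hmn := U n Cn h).
    assert (Hdn : d ∈ n) by exact (ord_mem_le_trans _ _ _ On Hd Hmn).
    apply (Un d Hdn), card_le_subset. now intros x.
  - apply ord_not_mem in h; auto. apply ord_le_subset in h; auto.
    exact (card_le_trans _ _ _ Hn (card_le_subset _ _ h)).
Qed.

Lemma card_lt_succ_cardinal mu lam A : ordinal lam -> is_succ_cardinal mu lam ->
  (card_lt A mu <-> card_le A lam).
Proof.
  intros Ol Hm. rewrite card_ltE by apply Hm. split.
  - intros (d & Hd & H). apply (card_le_trans _ _ _ H). now apply (mem_succ_cardinal mu).
  - intros H; exists lam; split; [apply Hm|exact H].
Qed.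

End Choice.

(** * Ultrafilters *)

Section Ultrafilters.
Context {V : set_structure} {HV : ZFC V}.

(** The ultrafilter quantifier: [P] holds at [W]-almost every point of [E]. Treated as a binder of
    the definability calculus, it can be iterated, as products of ultrafilters require. *)
Definition big (E W : V) (P : V -> Prop) : Prop := sep E P ∈ W.

Lemma D_big (E W : (nat -> V) -> V) (P : V -> (nat -> V) -> Prop) :
  Dt E -> Dt W -> D (fun r => P (r 0) (fun n => r (S n))) ->
  D (fun r => big (E r) (W r) (fun x => P x r)).
Proof. intros HE HW HP. unfold big. apply D_mem; [|exact HW]. now apply Dt_sep. Qed.
End Ultrafilters.

Ltac dfn_binder ::=
  match goal with
  | |- Dt (fun r => sep _ _) => simple apply Dt_sep
  | |- Dt (fun r => repl _ _) => simple apply Dt_repl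
  | |- Dt (fun r => func _ _) => simple apply Dt_func
  | |- Dt (fun r => ite _ _ _) => simple apply Dt_ite
  | |- Dt (fun r => least _) => simple apply Dt_least
  | |- D (fun r => big _ _ _) => simple apply D_big
  end.

Section UltrafilterFacts.
Context {V : set_structure} {HV : ZFC V}.
Implicit Types (E W kappa U f : V) (P Q : V -> Prop).

Lemma bigE E W P : D1 P ->
  (big E W P <-> exists S, S ∈ W /\ forall d, d ∈ S <-> d ∈ E /\ P d).
Proof.
  intros DP; split.
  - intros H; exists (sep E P); split; [exact H|]. intros d. now apply in_sep.
  - intros (S & HS & H). unfold big. replace (sep E P) with S; [exact HS|].
    apply set_ext; intros d. rewrite in_sep by exact DP. apply H.
Qed.

Lemma sep_subset E P : D1 P -> subset (sep E P) E.
Proof. intros DP x Hx. apply in_sep in Hx; tauto. Qed.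

Lemma sep_mem E X : subset X E -> sep E (fun x => x ∈ X) = X.
Proof.
  intros H; apply set_ext; intros x. rewrite in_sep by dfn. split; [tauto|]. auto.
Qed.

Section Fixed.
Variables E W : V.
Hypothesis UW : ultrafilter_on E W.

Lemma big_mem X : subset X E -> (X ∈ W <-> big E W (fun x => x ∈ X)).
Proof. intros H. unfold big. now rewrite sep_mem. Qed.

Lemma big_mono P Q : D1 P -> D1 Q -> (forall x, x ∈ E -> P x -> Q x) -> big E W P -> big E W Q.
Proof.
  intros DP DQ H h. apply (uf_upward E W UW (sep E P)); [exact h| |now apply sep_subset].
  intros x Hx. apply in_sep in Hx; [|exact DP]. apply in_sep; [exact DQ|]. destruct Hx; auto.
Qed.

Lemma big_iff P Q : D1 P -> D1 Q -> (forall x, x ∈ E -> (P x <-> Q x)) -> (big E W P <-> big E W Q).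
Proof. intros DP DQ H; split; apply big_mono; auto; intros x Hx; apply H, Hx. Qed.

Lemma big_and P Q : D1 P -> D1 Q -> big E W P -> big E W Q -> big E W (fun x => P x /\ Q x).
Proof.
  intros DP DQ h h'. apply (uf_inter E W UW (sep E P) (sep E Q)); auto.
  intros x. rewrite !in_sep by dfn. tauto.
Qed.

Lemma big_true P : D1 P -> (forall x, x ∈ E -> P x) -> big E W P.
Proof.
  intros DP H. unfold big. replace (sep E P) with E; [apply (uf_full E W UW)|].
  apply set_ext; intros x. rewrite in_sep by exact DP. split; [auto|tauto].
Qed.

Lemma big_ex P : D1 P -> big E W P -> exists x, x ∈ E /\ P x.
Proof.
  intros DP H. apply NNPP; intros N. apply (uf_empty E W UW (sep E P)); [|exact H].
  intros x Hx. apply in_sep in Hx; [|exact DP]. eauto.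
Qed.

Lemma big_not P : D1 P -> (~ big E W P <-> big E W (fun x => ~ P x)).
Proof.
  intros DP. split.
  - intros N. destruct (uf_ultra E W UW (sep E P) (sep E (fun x => ~ P x))) as [h|h];
      [now apply sep_subset| |contradiction|exact h].
    intros x. rewrite !in_sep by dfn. tauto.
  - intros h h'. destruct (big_ex (fun x => ~ P x /\ P x)) as (x & _ & H); [dfn| |tauto].
    apply (big_and (fun x => ~ P x) P); auto; dfn.
Qed.

Lemma big_and2 P Q R : D1 P -> D1 Q -> D1 R -> (forall x, x ∈ E -> P x -> Q x -> R x) ->
  big E W P -> big E W Q -> big E W R.
Proof.
  intros DP DQ DR H h h'. apply (big_mono (fun x => P x /\ Q x)); [dfn|exact DR| |now apply big_and].
  intros x Hx [? ?]; auto.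
Qed.

Lemma big_iff_big P Q : D1 P -> D1 Q -> big E W (fun x => P x <-> Q x) -> (big E W P <-> big E W Q).
Proof.
  intros DP DQ H. split; intros h.
  - apply (big_and2 P (fun x => P x <-> Q x) Q); auto; [dfn|]. tauto.
  - apply (big_and2 Q (fun x => P x <-> Q x) P); auto; [dfn|]. tauto.
Qed.

Lemma big_maps (R : V -> V -> Prop) f g : D2 R -> function_on f E -> function_on g E ->
  ((exists S, S ∈ W /\ forall d, d ∈ S <-> d ∈ E /\ exists x y, maps f d x /\ maps g d y /\ R x y) <->
   big E W (fun d => R (app f d) (app g d))).
Proof.
  intros DR Ff Fg.
  rewrite <- (bigE E W (fun d => exists x y, maps f d x /\ maps g d y /\ R x y)) by dfn.
  apply big_iff; [dfn|dfn|]. intros d Hd. split.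
  - intros (x & y & Hx & Hy & H). apply (function_maps f E) in Hx; [|exact Ff].
    apply (function_maps g E) in Hy; [|exact Fg]. destruct Hx as [_ ->], Hy as [_ ->]; exact H.
  - intros H. exists (app f d), (app g d). rewrite (function_maps f E), (function_maps g E) by assumption. auto.
Qed.

Variable kappa : V.
Hypothesis CW : complete kappa E W.

Lemma big_forall A (R : V -> V -> Prop) : D2 R -> card_lt A kappa ->
  (forall i, i ∈ A -> big E W (R i)) -> big E W (fun x => forall i, i ∈ A -> R i x).
Proof.
  intros DR HA H. apply (CW (repl A (fun i => sep E (R i)))).
  - intros X HX. apply in_repl in HX; [|dfn]. destruct HX as (i & Hi & ->). now apply H.
  - apply (card_lt_mono _ A); [|exact HA]. apply card_le_repl; dfn.
  - intros x. rewrite in_sep by dfn. split.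
    + intros [Hx h]; split; [exact Hx|]. intros X HX. apply in_repl in HX; [|dfn].
      destruct HX as (i & Hi & ->). apply in_sep; [dfn|auto].
    + intros [Hx h]; split; [exact Hx|]. intros i Hi.
      assert (h' : x ∈ sep E (R i)) by (apply h, in_repl; [dfn|eauto]).
      apply in_sep in h'; [tauto|dfn].
Qed.

(** Dual to completeness: a large set covered by fewer than kappa pieces has a large piece. Hence a
    function that is almost everywhere below some ordinal less than kappa is almost everywhere
    constant. *)
Lemma big_exists A (R : V -> V -> Prop) : D2 R -> card_lt A kappa ->
  big E W (fun x => exists i, i ∈ A /\ R i x) -> exists i, i ∈ A /\ big E W (R i).
Proof.
  intros DR HA H. apply NNPP; intros N.
  assert (h : big E W (fun x => forall i, i ∈ A -> ~ R i x)).
  { apply (big_forall A (fun i x => ~ R i x)); [dfn|exact HA|].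
    intros i Hi. apply (big_not (R i)); [dfn|]. intros h. apply N; eauto. }
  revert H. apply big_not; [dfn|]. revert h. apply big_mono; [dfn|dfn|].
  intros x _ h (i & Hi & Hx). exact (h i Hi Hx).
Qed.
End Fixed.

Definition push E W (F : V -> V) (E' : V) : V := sep (pow E') (fun X => big E W (fun x => F x ∈ X)).

Lemma in_push E W F E' X : Df1 F ->
  (X ∈ push E W F E' <-> subset X E' /\ big E W (fun x => F x ∈ X)).
Proof. intros DF. unfold push. rewrite in_sep by dfn. now rewrite in_pow. Qed.

Lemma big_push E W F E' P : ultrafilter_on E W -> Df1 F -> (forall x, x ∈ E -> F x ∈ E') -> D1 P ->
  (big E' (push E W F E') P <-> big E W (fun x => P (F x))).
Proof.
  intros UW DF HF DP. unfold big at 1. rewrite in_push by exact DF.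
  rewrite (big_iff E W UW (fun x => F x ∈ sep E' P) (fun x => P (F x))); [|dfn|dfn|].
  - split; [tauto|]. intros h; split; [now apply sep_subset|exact h].
  - intros x Hx. rewrite in_sep by dfn. split; [tauto|]. auto.
Qed.

Lemma ultrafilter_push E W F E' : ultrafilter_on E W -> Df1 F -> (forall x, x ∈ E -> F x ∈ E') ->
  ultrafilter_on E' (push E W F E').
Proof.
  intros UW DF HF. constructor.
  - intros X HX. apply in_push in HX; tauto.
  - apply in_push; [exact DF|]. split; [now intros x|]. apply big_true; auto; dfn.
  - intros e He H. apply in_push in H; [|exact DF]. destruct H as [_ H].
    apply (big_ex E W UW) in H; [|dfn]. destruct H as (x & _ & H). exact (He _ H).
  - intros X Y HX S S'. apply in_push in HX; [|exact DF]. apply in_push; [exact DF|].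
    split; [exact S'|]. apply (big_mono E W UW (fun x => F x ∈ X)); [dfn|dfn| |tauto]. auto.
  - intros X Y Z HX HY HZ. apply in_push in HX, HY; try exact DF. apply in_push; [exact DF|].
    split; [intros x Hx; apply HX; now apply HZ in Hx|].
    apply (big_and2 E W UW (fun x => F x ∈ X) (fun x => F x ∈ Y)); try tauto; try dfn.
    intros x _ h h'; apply HZ; auto.
  - intros X Y S HY. destruct (classic (big E W (fun x => F x ∈ X))) as [h|h]; [left|right];
      apply in_push; auto. split; [intros x Hx; now apply HY in Hx|].
    apply (big_not E W UW) in h; [|dfn]. revert h; apply big_mono; auto; [dfn|dfn|].
    intros x Hx h; apply HY; auto.
Qed.

Lemma complete_push kappa E W F E' : ultrafilter_on E W -> complete kappa E W ->
  Df1 F -> (forall x, x ∈ E -> F x ∈ E') -> complete kappa E' (push E W F E').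
Proof.
  intros UW CW DF HF A SA HA Y HY. apply in_push; [exact DF|].
  split; [intros x Hx; now apply HY in Hx|].
  apply (big_mono E W UW (fun x => forall X, X ∈ A -> F x ∈ X)); [dfn|dfn| |].
  - intros x Hx h; apply HY; auto.
  - apply (big_forall E W kappa CW A (fun X x => F x ∈ X)); [dfn|exact HA|].
    intros X HX. apply SA, in_push in HX; tauto.
Qed.

Lemma RK_le_intro kappa U0 U1 (F : V -> V) : Df1 F -> (forall x, x ∈ kappa -> F x ∈ kappa) ->
  (forall X, subset X kappa -> (X ∈ U0 <-> big kappa U1 (fun x => F x ∈ X))) -> RK_le kappa U0 U1.
Proof.
  intros DF HF H. exists (func kappa F); split; [now apply func_from_to|].
  intros X SX Y HY. rewrite (H X SX). unfold big.
  replace (sep kappa (fun x => F x ∈ X)) with Y; [tauto|].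
  apply set_ext; intros x. rewrite HY, in_sep by dfn. split.
  - intros (Hx & y & Hy & HX). apply maps_func in Hy; [|exact DF]. destruct Hy; subst; auto.
  - intros [Hx HX]; split; [exact Hx|]. exists (F x). rewrite maps_func by exact DF. auto.
Qed.

Lemma RK_le_elim kappa U0 U1 : RK_le kappa U0 U1 -> exists f,
  (forall x, x ∈ kappa -> app f x ∈ kappa) /\
  (forall X, subset X kappa -> (X ∈ U0 <-> big kappa U1 (fun x => app f x ∈ X))).
Proof.
  intros (f & Ff & H). exists f; split; [intros x; now apply from_to_app|].
  intros X SX. apply (H X SX). intros x. rewrite in_sep by dfn. split.
  - intros [Hx HX]; split; [exact Hx|]. exists (app f x); split; [|exact HX].
    apply (function_maps f kappa); auto; apply Ff.
  - intros (Hx & y & Hy & HX); split; [exact Hx|]. apply (function_maps f kappa) in Hy; [|apply Ff].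
    destruct Hy; subst; auto.
Qed.

Lemma RK_le_push kappa U0 U1 f : ultrafilter_on kappa U0 ->
  (forall X, subset X kappa -> (X ∈ U0 <-> big kappa U1 (fun x => app f x ∈ X))) ->
  U0 = push kappa U1 (app f) kappa.
Proof.
  intros H0 H. apply set_ext; intros X. rewrite in_push by dfn. split.
  - intros HX. assert (S := uf_subset _ _ H0 X HX). split; [exact S|now apply H].
  - intros [S HX]; now apply H.
Qed.

(** The image of the ultrafilter concentrated at [d] is concentrated at the image of [d]. So a bound
    of one nonprincipal ultrafilter is automatically nonprincipal. *)
Lemma RK_le_nonprincipal kappa U0 U1 : ultrafilter_on kappa U0 -> RK_le kappa U0 U1 ->
  ~ principal kappa U0 -> ~ principal kappa U1.
Proof.
  intros H0 H N (d & Hd & P). apply RK_le_elim in H. destruct H as (f & Hf & H).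
  apply N. exists (app f d); split; [auto|]. intros X. split.
  - intros HX. assert (S := uf_subset _ _ H0 X HX). split; [exact S|].
    apply H, P in HX; [|exact S]. destruct HX as [_ HX]. apply in_sep in HX; [tauto|dfn].
  - intros [S HX]. apply H; [exact S|]. apply P; split; [apply sep_subset; dfn|].
    apply in_sep; [dfn|auto].
Qed.

End UltrafilterFacts.

(** * Measurable cardinals *)

Section Measurable.
Context {V : set_structure} {HV : ZFC V}.

Lemma ord_argmin (A x : V) (g : V -> V) : Df1 g -> (forall y, y ∈ A -> ordinal (g y)) -> x ∈ A ->
  exists m, m ∈ A /\ forall y, y ∈ A -> ord_le (g m) (g y).
Proof.
  intros Dg Og Hx.
  destruct (ord_least (fun z => exists y, y ∈ A /\ g y = z) (g x)) as (z & Oz & (m & Hm & E) & U);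
    [dfn|auto|eauto|].
  exists m; split; [exact Hm|]. intros y Hy. apply ord_not_mem; auto.
  intros h. rewrite E in h. apply (U _ h). eauto.
Qed.

(* The lexicographic order on (least [g] with [s ∈ Q g], fixed well-order) has small proper initial
   segments, so its collapse takes values in [kappa]. *)
Lemma card_le_small_cover (kappa E : V) (Q : V -> V) : cardinal kappa -> Df1 Q ->
  (forall g, g ∈ kappa -> card_lt (Q g) kappa) ->
  (forall g g', g ∈ g' -> g' ∈ kappa -> subset (Q g) (Q g')) ->
  (forall s, s ∈ E -> exists g, g ∈ kappa /\ s ∈ Q g) -> card_le E kappa.
Proof.
  intros Ck DQ HQ mono cover. assert (Ok := proj1 Ck).
  destruct (well_ordering E) as (d & F & Od & DF & _ & _ & SF).
  assert (Hf := card_le_surj d E F DF SF). apply card_le_elim in Hf. destruct Hf as (f & Hf & If).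
  clear F DF SF.
  set (rho := fun s => least (fun g => g ∈ kappa /\ s ∈ Q g)).
  assert (Dr : Df1 rho) by (unfold rho; dfn).
  assert (Hr : forall s, s ∈ E -> ordinal (rho s) /\ rho s ∈ kappa /\ s ∈ Q (rho s)).
  { intros s Hs. destruct (cover s Hs) as (g & Hg & Hsg).
    destruct (least_spec (fun g => g ∈ kappa /\ s ∈ Q g) g) as (O & H & _); auto; [dfn|].
    exact (ord_mem _ _ Ok Hg). }
  assert (Of : forall s, s ∈ E -> ordinal (app f s)) by (intros s Hs; exact (ord_mem _ _ Od (Hf s Hs))).
  set (lt := fun s t => rho s ∈ rho t \/ (rho s = rho t /\ app f s ∈ app f t)).
  assert (Dlt : D2 lt) by (unfold lt; dfn).
  set (pred := fun t => sep E (fun s => t ∈ E /\ lt s t)).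
  assert (Dp : Df1 pred) by (unfold pred; dfn).
  assert (Hp : forall s t, s ∈ pred t <-> s ∈ E /\ t ∈ E /\ lt s t).
  { intros s t. unfold pred. now rewrite in_sep by dfn. }
  assert (trans : forall s t u, s ∈ pred t -> t ∈ pred u -> s ∈ pred u).
  { intros s t u. rewrite !Hp. unfold lt. intros (Hs & Ht & H) (_ & Hu & H').
    destruct (Hr u Hu) as [Ou _]. assert (Ofu := Of u Hu).
    split; [exact Hs|split; [exact Hu|]].
    destruct H as [H|[H H0]], H' as [H'|[H' H0']].
    - left; exact (ord_mem_trans _ _ _ Ou H H').
    - left; now rewrite <- H'.
    - left; now rewrite H.
    - right; split; [congruence|exact (ord_mem_trans _ _ _ Ofu H0 H0')]. }
  assert (wf : forall a x, x ∈ a -> exists m, m ∈ a /\ forall y, y ∈ pred m -> ~ y ∈ a).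
  { intros a x Hx.
    (* Points outside [E] have no predecessors. Inside [E], minimise [rho] first and then the fixed
       well-order. *)
    destruct (classic (exists m, m ∈ a /\ ~ m ∈ E)) as [(m & Hm & N)|N].
    { exists m; split; [exact Hm|]. intros y Hy. apply Hp in Hy. tauto. }
    assert (SE : forall y, y ∈ a -> y ∈ E) by (intros y Hy; apply NNPP; intros h; eauto).
    destruct (ord_argmin a x rho) as (m0 & Hm0 & U0); auto.
    { intros y Hy; apply Hr; auto. }
    destruct (ord_argmin (sep a (fun y => rho y = rho m0)) m0 (app f)) as (m & Hm & U); [dfn| | |].
    { intros y Hy. apply in_sep in Hy; [|dfn]. apply Of, SE, Hy. }
    { apply in_sep; [dfn|auto]. }
    apply in_sep in Hm; [|dfn]. destruct Hm as [Hm Em]. exists m; split; [exact Hm|].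
    intros y Hy Hya. apply Hp in Hy. destruct Hy as (HyE & HmE & [h|[h h']]).
    - rewrite Em in h. revert h. apply ord_not_mem; auto; apply Hr; auto.
    - revert h'. apply ord_not_mem; auto. apply U, in_sep; [dfn|]. split; [exact Hya|congruence]. }
  destruct (recursion pred (fun _ I => I)) as (C & DC & HC); [exact Dp|dfn|exact wf|].
  assert (HC' : forall t z, z ∈ C t <-> exists s, s ∈ pred t /\ z = C s).
  { intros t z. rewrite HC at 1. now apply in_repl. }
  assert (OC : forall t, ordinal (C t)).
  { apply (wf_induction pred (fun t => ordinal (C t))); [exact Dp|dfn|exact wf|].
    intros t IH. split.
    - intros x y Hx Hy. apply HC' in Hx. destruct Hx as (s & Hs & ->).
      apply HC' in Hy. destruct Hy as (u & Hu & ->). apply HC'; eauto.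
    - intros x y Hx Hy. apply HC' in Hx, Hy. destruct Hx as (s & Hs & ->), Hy as (u & Hu & ->).
      apply ord_trich; auto. }
  apply (card_le_intro E kappa C DC).
  - intros t Ht. apply NNPP; intros N. apply ord_not_mem in N; auto. apply ord_le_subset in N; auto.
    destruct (Hr t Ht) as (_ & Hrt & _).
    (* The predecessors of [t] all lie in [Q (rho t)], so a value of the collapse at or above kappa
       would inject kappa into that small set. *)
    apply (proj2 (HQ _ Hrt)). apply (card_le_trans _ (C t)); [now apply card_le_subset|].
    apply (card_le_trans _ (pred t)); [rewrite HC; now apply card_le_repl|].
    apply card_le_subset. intros s Hs. apply Hp in Hs. destruct Hs as (Hs & _ & H).
    destruct (Hr s Hs) as (_ & _ & Hsq).
    destruct H as [H|[H _]]; [exact (mono _ _ H Hrt s Hsq)|now rewrite <- H].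
  - intros s t Hs Ht Est. apply NNPP; intros N.
    assert (T : lt s t \/ lt t s).
    { unfold lt. destruct (Hr s Hs) as [Os _], (Hr t Ht) as [Ot _].
      destruct (ord_trich (rho s) (rho t) Os Ot) as [h|[h|h]]; auto.
      destruct (ord_trich (app f s) (app f t) (Of s Hs) (Of t Ht)) as [h'|[h'|h']]; auto.
      exfalso; apply N; auto. }
    apply (mem_irrefl (C t)). destruct T as [T|T].
    + rewrite <- Est at 1. apply HC'. exists s; rewrite Hp; auto.
    + rewrite <- Est at 2. apply HC'. exists t; rewrite Hp; auto.
Qed.

Definition short_sequences (kappa : V) : V :=
  sep (pow (prod kappa kappa)) (fun s => exists a, a ∈ kappa /\ function_from_to s a kappa).

Lemma short_sequencesE (kappa E : V) : ordinal kappa ->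
  (is_short_sequences E kappa <-> E = short_sequences kappa).
Proof.
  intros Ok.
  assert (H : is_short_sequences (short_sequences kappa) kappa).
  { intros s. unfold short_sequences. rewrite in_sep by dfn. split; [tauto|].
    intros (a & Ha & F). split; [|eauto]. apply in_pow. intros p Hp.
    apply (in_function s a) in Hp; [|apply F]. destruct Hp as (x & Hx & ->).
    apply in_prod. exists x, (app s x). repeat split; auto.
    - exact (proj1 Ok a x Ha Hx).
    - now apply (from_to_app s a). }
  split; [|intros ->; exact H]. intros H'. apply set_ext; intros s. now rewrite (H' s), (H s).
Qed.

(** * Inaccessibility derived from the ultrafilter *)

Section Kappa.
Variables kappa U : V.
Hypothesis Ck : cardinal kappa.
Hypothesis FU : frakU kappa U.
Let Ok : ordinal kappa := proj1 Ck.
Let UU : ultrafilter_on kappa U := proj1 FU.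
Let CU : complete kappa kappa U := proj1 (proj2 FU).

Lemma mem_card_lt a : a ∈ kappa -> card_lt a kappa.
Proof. apply Ck. Qed.

Lemma emp_kappa : emp ∈ kappa.
Proof.
  destruct (big_ex kappa U UU (fun _ => True)) as (x & Hx & _); [dfn| |].
  - apply big_true; auto; dfn.
  - exact (ord_emp_mem _ _ Ok Hx).
Qed.

Lemma big_neq a : big kappa U (fun x => x <> a).
Proof.
  apply (big_not kappa U UU (fun x => x = a)); [dfn|]. intros h. apply (proj2 (proj2 FU)).
  assert (Ha : a ∈ kappa).
  { apply (big_ex kappa U UU) in h; [|dfn]. now destruct h as (x & Hx & ->). }
  exists a; split; [exact Ha|]. intros X. split.
  - intros HX. assert (S := uf_subset _ _ UU X HX). split; [exact S|].
    apply (big_mem kappa U) in HX; [|exact S].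
    destruct (big_ex kappa U UU (fun x => x = a /\ x ∈ X)) as (x & _ & -> & H); [dfn| |exact H].
    apply (big_and kappa U UU (fun x => x = a) (fun x => x ∈ X)); auto; dfn.
  - intros [S H]. apply (big_mem kappa U); [exact S|].
    revert h; apply (big_mono kappa U UU); [dfn|dfn|]. now intros x _ ->.
Qed.

Lemma big_above a : a ∈ kappa -> big kappa U (fun x => a ∈ x).
Proof.
  intros Ha.
  apply (big_and2 kappa U UU (fun x => forall i, i ∈ a -> x <> i) (fun x => x <> a)); [dfn|dfn|dfn| | |].
  - intros x Hx h h'. destruct (ord_trich a x) as [H|[H|H]]; auto; try (eapply ord_mem; eassumption).
    + congruence.
    + exfalso; exact (h x H eq_refl).
  - apply (big_forall kappa U kappa CU a (fun i x => x <> i)); [dfn|now apply mem_card_lt|].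
    intros i _. apply big_neq.
  - apply big_neq.
Qed.

(** Strong limit, by majority vote. For an injection h of kappa into the subsets of [A],
    completeness makes almost every h(x) equal to the set of those i that belong to h(y) for almost
    every y. Two distinct points then have the same image. *)
Lemma pow_card_lt A : card_lt A kappa -> card_lt (pow A) kappa.
Proof.
  intros HA. destruct (card_compare (pow A) kappa Ok) as [H|H]; [exfalso|now apply card_ltE].
  apply card_le_elim in H. destruct H as (h & Hh & I).
  assert (B : big kappa U (fun x => forall i, i ∈ A ->
            (i ∈ app h x <-> big kappa U (fun y => i ∈ app h y)))).
  { apply (big_forall kappa U kappa CU A
      (fun i x => i ∈ app h x <-> big kappa U (fun y => i ∈ app h y))); [dfn|exact HA|].
    intros i Hi. destruct (classic (big kappa U (fun y => i ∈ app h y))) as [b|b].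
    - assert (b' := b). revert b'; apply (big_mono kappa U UU); [dfn|dfn|]. tauto.
    - assert (b' := b). apply (big_not kappa U UU) in b'; [|dfn].
      revert b'; apply (big_mono kappa U UU); [dfn|dfn|]. tauto. }
  assert (Bx := B). apply (big_ex kappa U UU) in Bx; [|dfn]. destruct Bx as (x & Hx & Bx).
  pose proof (fun d d' => big_and kappa U UU _ _ d d' B (big_neq x)) as B'.
    specialize (B' ltac:(dfn) ltac:(dfn)).
  apply (big_ex kappa U UU) in B'; [|dfn]. destruct B' as (y & Hy & By & N).
  apply N, I; auto. apply set_ext; intros i.
  assert (Sx := Hh x Hx). assert (Sy := Hh y Hy). rewrite in_pow in Sx, Sy.
  split; intros Hi; assert (Hi' := Hi); [apply Sy in Hi'|apply Sx in Hi'].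
  - apply Bx, By; auto.
  - apply By, Bx; auto.
Qed.

Lemma pow_mono (a b : V) : subset a b -> subset (pow a) (pow b).
Proof. intros H x. rewrite !in_pow. intros h y Hy; auto. Qed.

Lemma pair_in_pow_pow (a x y : V) : x ∈ a -> y ∈ a -> pair x y ∈ pow (pow a).
Proof.
  intros Hx Hy. apply in_pow. intros s Hs. apply in_pow. unfold pair in Hs.
  apply in_upair in Hs. destruct Hs as [-> | ->]; intros z Hz.
  - apply in_sing in Hz; now subst.
  - apply in_upair in Hz; destruct Hz; now subst.
Qed.

Lemma prod_card_le : card_le (prod kappa kappa) kappa.
Proof.
  apply (card_le_small_cover _ _ (fun g => pow (pow g))); [exact Ck|dfn| | |].
  - intros g Hg. apply pow_card_lt, pow_card_lt, mem_card_lt, Hg.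
  - intros g g' H H'. apply pow_mono, pow_mono. intros x Hx.
    exact (proj1 (ord_mem _ _ Ok H') g x H Hx).
  - intros s Hs. apply in_prod in Hs. destruct Hs as (x & y & Hx & Hy & ->).
    pose proof (fun d d' => big_and kappa U UU _ _ d d' (big_above x Hx) (big_above y Hy)) as B.
    specialize (B ltac:(dfn) ltac:(dfn)).
    apply (big_ex kappa U UU) in B; [|dfn]. destruct B as (g & Hg & H1 & H2).
    exists g; split; [exact Hg|now apply pair_in_pow_pow].
Qed.

Lemma short_sequences_card_le : card_le (short_sequences kappa) kappa.
Proof.
  apply (card_le_small_cover _ _ (fun g => pow (pow (pow g)))); [exact Ck|dfn| | |].
  - intros g Hg. apply pow_card_lt, pow_card_lt, pow_card_lt, mem_card_lt, Hg.
  - intros g g' H H'. apply pow_mono, pow_mono, pow_mono. intros x Hx.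
    exact (proj1 (ord_mem _ _ Ok H') g x H Hx).
  - intros s Hs. apply (proj2 (short_sequencesE kappa _ Ok) eq_refl) in Hs.
    destruct Hs as (a & Ha & F).
    (* Regularity is read off the ultrafilter: almost every [g] exceeds all values of [s], and also
       its length. Then [s] is a set of pairs from [g], hence a member of the triple power set of
       [g]. *)
    assert (B : big kappa U (fun x => forall i, i ∈ a -> app s i ∈ x)).
    { apply (big_forall kappa U kappa CU a (fun i x => app s i ∈ x)); [dfn|now apply mem_card_lt|].
      intros i Hi. apply big_above. now apply (from_to_app s a). }
    pose proof (fun d d' => big_and kappa U UU _ _ d d' B (big_above a Ha)) as B'.
    specialize (B' ltac:(dfn) ltac:(dfn)).
    apply (big_ex kappa U UU) in B'; [|dfn]. destruct B' as (g & Hg & H1 & H2).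
    exists g; split; [exact Hg|]. apply in_pow. intros p Hp.
    apply (in_function s a) in Hp; [|apply F]. destruct Hp as (x & Hx & ->).
    apply pair_in_pow_pow; auto. exact (ord_mem_trans _ _ _ (ord_mem _ _ Ok Hg) Hx H2).
Qed.

Lemma RK_bound_of_ultrafilter E W :
  ultrafilter_on E W -> complete kappa E W -> card_le E kappa ->
  exists W', ultrafilter_on kappa W' /\ complete kappa kappa W' /\
    forall U0 (F : V -> V), ultrafilter_on kappa U0 -> Df1 F ->
      (forall X, subset X kappa -> (X ∈ U0 <-> big E W (fun x => F x ∈ X))) ->
      RK_le kappa U0 W'.
Proof.
  intros UW CW HE. apply card_le_elim in HE. destruct HE as (h & Hh & Ih).
  exists (push E W (app h) kappa). split; [|split].
  - apply ultrafilter_push; auto; dfn.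
  - apply complete_push; auto; dfn.
  - intros U0 F H0 DF HF.
    (* The inverse of the injection: each fibre has at most one element, which its union returns. *)
    set (inv := fun x => union (sep E (fun d => app h d = x))).
    assert (Dinv : Df1 inv) by (unfold inv; dfn).
    assert (Hinv : forall d, d ∈ E -> inv (app h d) = d).
    { intros d Hd. apply set_ext; intros z. unfold inv. rewrite in_union. split.
      - intros (y & Hy & Hz). apply in_sep in Hy; [|dfn]. destruct Hy as [Hy Ey].
        apply Ih in Ey; auto; now subst.
      - intros Hz; exists d; split; [|exact Hz]. apply in_sep; [dfn|auto]. }
    (* [F] takes values in kappa only almost everywhere, because kappa belongs to [U0], while a
       Rudin-Keisler map must do so everywhere; hence the default. *)
    apply (RK_le_intro kappa U0 _ (fun x => ite (F (inv x) ∈ kappa) (F (inv x)) emp)); [dfn| |].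
    + intros x Hx. destruct (classic (F (inv x) ∈ kappa)) as [H|H];
        [now rewrite ite_true|rewrite ite_false by exact H; exact emp_kappa].
    + intros X SX. rewrite big_push; [|exact UW|dfn|exact Hh|dfn].
      rewrite (HF X SX). apply (big_iff_big E W UW); [dfn|dfn|].
      assert (B : big E W (fun x => F x ∈ kappa)).
      { apply HF; [now intros x|apply (uf_full _ _ H0)]. }
      revert B; apply (big_mono E W UW); [dfn|dfn|]. intros x Hx B.
      rewrite Hinv by exact Hx. now rewrite ite_true.
Qed.

End Kappa.
End Measurable.

(** * Elementary embeddings *)

Section Delta0.
Context {V : set_structure} {HV : ZFC V}.
Implicit Types (P Q : (nat -> V) -> Prop).

(** A semantic form of absoluteness: a single formula expresses [P] in every transitive class
    containing the environment, the universe included. Bounded formulas qualify because transitive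
    classes contain the elements of their members. *)
Definition D0 P : Prop := exists phi, forall (M : V -> Prop), transitive_class M ->
  forall r, (forall n, M (r n)) -> (P r <-> sat M r phi).

Lemma D0_ext P Q : (forall r, Q r <-> P r) -> D0 P -> D0 Q.
Proof.
  intros H (phi & E); exists phi. intros M TM r Mr. rewrite H. now apply E.
Qed.

Lemma D0_false : D0 (fun _ => False).
Proof. exists f_false; intros; simpl; tauto. Qed.

Lemma D0_mem i j : D0 (fun r => r i ∈ r j).
Proof. exists (f_mem i j); intros; simpl; tauto. Qed.

Lemma D0_eq i j : D0 (fun r => r i = r j).
Proof. exists (f_eq i j); intros; simpl; tauto. Qed.

Lemma D0_imp P Q : D0 P -> D0 Q -> D0 (fun r => P r -> Q r).
Proof.
  intros (phi & E) (psi & E'). exists (f_imp phi psi). intros M TM r Mr. simpl.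
  now rewrite (E M TM r Mr), (E' M TM r Mr).
Qed.

Lemma D0_not P : D0 P -> D0 (fun r => ~ P r).
Proof. intros H. apply D0_imp; [exact H|exact D0_false]. Qed.

Lemma D0_and P Q : D0 P -> D0 Q -> D0 (fun r => P r /\ Q r).
Proof.
  intros H H'. apply (D0_ext (fun r => ~ (P r -> ~ Q r))); [intros; tauto|].
  apply D0_not, D0_imp; [exact H|now apply D0_not].
Qed.

Lemma D0_or P Q : D0 P -> D0 Q -> D0 (fun r => P r \/ Q r).
Proof.
  intros H H'. apply (D0_ext (fun r => ~ P r -> Q r)); [intros; tauto|].
  apply D0_imp; [now apply D0_not|exact H'].
Qed.

Lemma D0_iff P Q : D0 P -> D0 Q -> D0 (fun r => P r <-> Q r).
Proof. intros H H'. apply D0_and; now apply D0_imp. Qed.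

Lemma D0_rename P (f : nat -> nat) : D0 P -> D0 (fun r => P (fun n => r (f n))).
Proof.
  intros (phi & E). exists (rename f phi). intros M TM r Mr. rewrite sat_rename.
  apply (E M TM (fun n => r (f n))). auto.
Qed.

Lemma D0_ball i (P : V -> (nat -> V) -> Prop) : D0 (fun r => P (r 0) (fun n => r (S n))) ->
  D0 (fun r => forall x, x ∈ r i -> P x r).
Proof.
  intros (phi & E). exists (f_all (f_imp (f_mem 0 (S i)) phi)). intros M TM r Mr. simpl.
  split; intros H x; specialize (H x).
  - intros Mx Hx. apply (E M TM (env_cons x r)); [intros [|n]; simpl; auto|]. now apply H.
  - intros Hx. assert (Mx : M x) by exact (TM _ _ (Mr i) Hx).
    apply (E M TM (env_cons x r)); [intros [|n]; simpl; auto|]. now apply H.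
Qed.

Lemma D0_bex i (P : V -> (nat -> V) -> Prop) : D0 (fun r => P (r 0) (fun n => r (S n))) ->
  D0 (fun r => exists x, x ∈ r i /\ P x r).
Proof.
  intros H. apply (D0_ext (fun r => ~ forall x, x ∈ r i -> ~ P x r)).
  - intros r; split; [intros (x & Hx & h) h'; exact (h' x Hx h)|].
    intros h; apply NNPP; intros N; apply h; intros x Hx h'; eauto.
  - apply D0_not, (D0_ball i (fun x r => ~ P x r)). now apply D0_not.
Qed.

Lemma D0_app3 (R : V -> V -> V -> Prop) i j k :
  D0 (fun r => R (r 0) (r 1) (r 2)) -> D0 (fun r => R (r i) (r j) (r k)).
Proof.
  exact (D0_rename (fun r => R (r 0) (r 1) (r 2)) (fun n => match n with 0 => i | 1 => j | _ => k end)).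
Qed.
End Delta0.

Create HintDb dzero.
Ltac d0 := cbn beta;
  repeat (match goal with
  | |- D0 (fun r => _ /\ _) => simple apply D0_and
  | |- D0 (fun r => _ \/ _) => simple apply D0_or
  | |- D0 (fun r => ~ _) => simple apply D0_not
  | |- D0 (fun r => _ <-> _) => simple apply D0_iff
  | |- D0 (fun r => r ?i = r ?j) => exact (D0_eq i j)
  | |- D0 (fun r => r ?i ∈ r ?j) => exact (D0_mem i j)
  | |- D0 (fun r => exists x, x ∈ r ?i /\ _) => simple apply (D0_bex i)
  | |- D0 (fun r => forall x, x ∈ r ?i -> _) => simple apply (D0_ball i)
  | |- D0 (fun r => _ -> _) => simple apply D0_imp
  | |- D0 (fun r => ?R (r ?i) (r ?j) (r ?k)) => simple apply (D0_app3 R i j k); solve [auto with dzero]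
  end; cbn beta).

Section Delta0Facts.
Context {V : set_structure} {HV : ZFC V}.

Lemma D0_is_upair : D0 (fun r : nat -> V => is_upair (r 0) (r 1) (r 2)).
Proof.
  apply (D0_ext (fun r => r 1 ∈ r 0 /\ r 2 ∈ r 0 /\ forall x, x ∈ r 0 -> x = r 1 \/ x = r 2)); [|d0].
  intros r. unfold is_upair. split.
  - intros H. split; [apply H; auto|split; [apply H; auto|]]. intros x; apply H.
  - intros (H1 & H2 & H3) x; split; [apply H3|intros [-> | ->]; auto].
Qed.
Hint Resolve D0_is_upair : dzero.

Lemma D0_is_pair : D0 (fun r : nat -> V => is_pair (r 0) (r 1) (r 2)).
Proof.
  apply (D0_ext (fun r => exists s, s ∈ r 0 /\ exists t, t ∈ r 0 /\
     (is_upair s (r 1) (r 1) /\ is_upair t (r 1) (r 2) /\ is_upair (r 0) s t))); [|d0].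
  intros r. unfold is_pair. split.
  - intros (s & t & H1 & H2 & H3). exists s; split; [apply H3; auto|].
    exists t; split; [apply H3; auto|]. auto.
  - intros (s & _ & t & _ & H); eauto.
Qed.
Hint Resolve D0_is_pair : dzero.

Lemma D0_maps : D0 (fun r : nat -> V => maps (r 0) (r 1) (r 2)).
Proof.
  apply (D0_ext (fun r => exists p, p ∈ r 0 /\ is_pair p (r 1) (r 2))); [|d0].
  intros r. unfold maps. split; intros (p & H & H'); eauto.
Qed.
Hint Resolve D0_maps : dzero.

Lemma D0_function_from_to : D0 (fun r : nat -> V => function_from_to (r 0) (r 1) (r 2)).
Proof.
  (* The quantifiers over values are unbounded in [function_on]; the codomain bounds them. *)
  apply (D0_ext (fun r =>
    (forall p, p ∈ r 0 -> exists x, x ∈ r 1 /\ exists y, y ∈ r 2 /\ is_pair p x y) /\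
    (forall x, x ∈ r 1 -> exists y, y ∈ r 2 /\ (maps (r 0) x y /\
       forall y', y' ∈ r 2 -> maps (r 0) x y' -> y = y')))); [|d0].
  intros r. unfold function_from_to, function_on. split.
  - intros ((H1 & H2) & H3). split.
    + intros p Hp. destruct (H1 p Hp) as (x & y & Hx & E). exists x; split; [exact Hx|].
      exists y; split; [|exact E]. apply (H3 x). exists p; auto.
    + intros x Hx. destruct (H2 x Hx) as (y & Hy & U). exists y; split; [eauto|split; [exact Hy|]].
      intros y' _; apply U.
  - intros (H1 & H2).
    assert (H3 : forall x y, maps (r 0) x y -> y ∈ r 2).
    { intros x y (p & E & Hp). destruct (H1 p Hp) as (x' & _ & y' & Hy' & E').
      apply is_pairE in E, E'. subst. apply pair_inj in E'. now destruct E' as [_ ->]. }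
    split; [split|exact H3].
    + intros p Hp. destruct (H1 p Hp) as (x & Hx & y & _ & E). eauto.
    + intros x Hx. destruct (H2 x Hx) as (y & _ & Hy & U). exists y; split; [exact Hy|eauto].
Qed.
End Delta0Facts.

#[export] Hint Resolve D0_is_upair D0_is_pair D0_maps D0_function_from_to : dzero.

(** What is known of an ultrapower before its critical point and its closure are. The transfer
    lemmas are stated at this level because the closure proof already relies on them. *)
Record elementary_map {V : set_structure} (M : V -> Prop) (j : V -> V) : Prop := {
  elem_transitive : transitive_class M;
  elem_into : forall x, M (j x);
  elem_sat : forall (phi : formula) (rho : nat -> V),
    sat (universe V) rho phi <-> sat M (fun n => j (rho n)) phi
}.

Lemma embedding_elementary {V : set_structure} (kappa : V) M j :
  embedding kappa M j -> elementary_map M j.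
Proof. intros [? ? ? ? ? ? ?]; now constructor. Qed.

(** * Transfer along an elementary map *)

Section Embedding.
Context {V : set_structure} {HV : ZFC V}.
Variables (kappa : V) (M : V -> Prop) (j : V -> V).
Hypothesis emb : elementary_map M j.

(** The variable [x] ranges over all of [M], not just over the range of [j]; the facts to be
    transferred concern generators, which are usually not of the form j(y). Spare parameter slots
    are filled by repetition. *)
Lemma transfer_all (P : V -> V -> V -> V -> V -> Prop) a b c d :
  D0 (fun r => P (r 0) (r 1) (r 2) (r 3) (r 4)) ->
  (forall x, P x a b c d) -> forall x, M x -> P x (j a) (j b) (j c) (j d).
Proof.
  intros (phi & E) H x Mx.
  set (r := env_cons a (env_cons b (env_cons c (fun _ : nat => d)))).
  assert (T : transitive_class (universe V)) by (intros ? ? ? ?; exact I).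
  assert (S : sat (universe V) r (f_all phi)).
  { intros y _. apply (E (universe V) T (env_cons y r)); [intros; exact I|]. apply H. }
  apply (elem_sat _ _ emb) in S.
  specialize (S x Mx).
  apply (E M (elem_transitive _ _ emb) (env_cons x (fun n => j (r n)))) in S; [exact S|].
  intros [|n]; [exact Mx|apply (elem_into _ _ emb)].
Qed.

Lemma j_mem x y : x ∈ y <-> j x ∈ j y.
Proof. exact (elem_sat _ _ emb (f_mem 0 1) (env_cons x (fun _ => y))). Qed.

Lemma M_mem x y : x ∈ j y -> M x.
Proof. intros H. exact (elem_transitive _ _ emb _ _ (elem_into _ _ emb y) H). Qed.

Lemma transfer_maps f x y : maps f x y -> maps (j f) (j x) (j y).
Proof.
  intros H.
  apply (transfer_all (fun _ f x y _ => maps f x y) f x y y) with (x := j x);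
    [d0|auto|apply (elem_into _ _ emb)].
Qed.

Lemma j_ordinal a : ordinal a -> ordinal (j a).
Proof.
  intros Oa. split.
  - intros x y Hx Hy.
    refine (transfer_all (fun x k _ _ _ => x ∈ k -> forall y, y ∈ x -> y ∈ k)
      a a a a _ _ x (M_mem _ _ Hx) Hx y Hy); [d0|].
    intros u Hu v Hv; exact (proj1 Oa u v Hu Hv).
  - intros x y Hx Hy.
    refine (transfer_all (fun x k _ _ _ => x ∈ k -> forall y, y ∈ k -> x ∈ y \/ x = y \/ y ∈ x)
      a a a a _ _ x (M_mem _ _ Hx) Hx y Hy); [d0|].
    intros u Hu v Hv; now apply (proj2 Oa).
Qed.

Hypothesis crit : is_crit j kappa.

Lemma kappa_mem_j : kappa ∈ j kappa.
Proof.
  destruct (crit) as (Ok & N & F).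
  assert (S : subset kappa (j kappa)).
  { intros a Ha. rewrite <- (F a Ha). now apply -> j_mem. }
  apply ord_sub_mem; auto. now apply j_ordinal.
Qed.

(** On a set of size less than kappa, j(A) is the pointwise image of A. An injection of A into d <
    kappa becomes one of j(A) into j(d) = d, so an element of j(A) is identified by a value below
    kappa, which [j] fixes. *)
Lemma j_small_image A d : d ∈ kappa -> card_le A d ->
  forall X, X ∈ j A -> exists Y, Y ∈ A /\ X = j Y.
Proof.
  intros Hd (f & Ff & If) X HX.
  destruct (crit) as (Ok & _ & F).
  assert (Mx := M_mem _ _ HX).
  assert (H : exists y, y ∈ j d /\ maps (j f) X y).
  { refine (transfer_all (fun x A f d _ => x ∈ A -> exists y, y ∈ d /\ maps f x y)
      A f d d _ _ X Mx HX); [d0|].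
    intros x Hx. exists (app f x); split; [now apply (from_to_app f A)|].
    apply (function_maps f A); auto; apply Ff. }
  destruct H as (y & Hy & HXy). rewrite (F d Hd) in Hy.
  assert (Hyk : y ∈ kappa) by exact (proj1 Ok d y Hd Hy).
  assert (Ey := F y Hyk).
  destruct (classic (exists Y, Y ∈ A /\ maps f Y y)) as [(Y & HY & HYy)|N].
  - exists Y; split; [exact HY|].
    assert (HjY : maps (j f) (j Y) y) by (rewrite <- Ey; now apply transfer_maps).
    refine (transfer_all (fun x A f d _ => x ∈ A -> forall x', x' ∈ A -> forall y, y ∈ d ->
      maps f x y -> maps f x' y -> x = x') A f d d _ _ X Mx HX (j Y) _ y _ HXy HjY); [d0| | |].
    + intros x _ x' _ z _; apply If.
    + now apply -> j_mem.
    + now rewrite (F d Hd).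
  (* If no element of [A] has value [y], transfer says the same of j(A) and j(y) = y, contradicting
     the value of [X]. *)
  - exfalso.
    refine (transfer_all (fun x A f y _ => x ∈ A -> ~ maps f x y) A f y y _ _ X Mx HX _); [d0| |].
    + intros x Hx h; eauto.
    + now rewrite Ey.
Qed.

End Embedding.

(** * From gluing to directedness *)

Section Directedness.
Context {V : set_structure} {HV : ZFC V}.

(** The common end of both arguments from weak gluing to directedness: a gluing enters only through
    an ultrafilter on a set of size at most kappa, together with projections to the given
    ultrafilters. *)
Lemma directed_of_projections (kappa lam lam_plus : V) :
  cardinal kappa -> (exists U, frakU kappa U) -> infinite_ordinal lam ->
  is_succ_cardinal lam_plus lam ->
  (forall Us, uf_sequence kappa lam Us ->
    exists E W, ultrafilter_on E W /\ complete kappa E W /\ card_le E kappa /\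
      forall b, b ∈ lam -> exists F : V -> V, Df1 F /\
        forall X, subset X kappa -> (X ∈ app Us b <-> big E W (fun x => F x ∈ X))) ->
  RK_directed lam_plus kappa.
Proof.
  intros Ck [U0 FU0] Il Sl H A HA LA.
  apply (card_lt_succ_cardinal lam_plus lam) in LA; [|apply Il|exact Sl].
  destruct (classic (A = emp)) as [E|NE].
  (* An empty family has no first member to fill up a sequence, yet its bound must still be an
     ultrafilter of the right kind. *)
  { exists U0; split; [exact FU0|]. intros U HU; subst; exfalso; exact (in_emp _ HU). }
  apply nonempty_ex in NE. destruct NE as [a0 Ha0].
  apply card_le_elim in LA. destruct LA as (f & Hf & If).
  (* The family enumerated along lam by inverting an injection; indices off its range repeat [a0],
     since the sequence must be total. *)
  set (G := fun b => ite (exists u, u ∈ A /\ app f u = b) (union (sep A (fun u => app f u = b))) a0).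
  assert (DG : Df1 G) by (unfold G; dfn).
  assert (EG : forall u, u ∈ A -> G (app f u) = u).
  { intros u Hu. unfold G. rewrite ite_true by eauto. apply set_ext; intros z.
    rewrite in_union. split.
    - intros (v & Hv & Hz). apply in_sep in Hv; [|dfn]. destruct Hv as [Hv E].
      apply If in E; auto; now subst.
    - intros Hz; exists u; split; [|exact Hz]. apply in_sep; [dfn|auto]. }
  assert (HG : forall b, G b ∈ A).
  { intros b. destruct (classic (exists u, u ∈ A /\ app f u = b)) as [(u & Hu & <-)|N].
    - now rewrite EG.
    - unfold G. now rewrite ite_false. }
  destruct (H (func lam G)) as (E & W & UW & CW & LE & P).
  { split; [now apply func_on|]. intros b u Hb. apply maps_func in Hb; [|exact DG].
    destruct Hb as [_ ->]. apply HA, HG. }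
  destruct (RK_bound_of_ultrafilter kappa U0 Ck FU0 E W UW CW LE) as (W' & UW' & CW' & B).
  assert (R : forall U, U ∈ A -> RK_le kappa U W').
  { intros U HU. destruct (P (app f U) (Hf U HU)) as (F & DF & HF).
    apply (B U F); [apply HA, HU|exact DF|]. intros X SX. rewrite <- (HF X SX).
    rewrite app_func by auto. now rewrite EG. }
  exists W'; split; [|exact R]. split; [exact UW'|split; [exact CW'|]].
  apply (RK_le_nonprincipal kappa a0); [apply HA, Ha0|now apply R|apply HA, Ha0].
Qed.

Lemma glues_app kappa j alpha Us eta b : uf_sequence kappa alpha Us -> ordinal_sequence alpha eta ->
  glues kappa j Us eta -> b ∈ alpha ->
  forall X, X ∈ app Us b <-> subset X kappa /\ app eta b ∈ j X.
Proof.
  intros HU He Hg Hb. apply (Hg b); apply (function_maps _ alpha); auto; [apply HU|apply He].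
Qed.

Lemma uf_sequence_app kappa alpha Us b : uf_sequence kappa alpha Us -> b ∈ alpha ->
  frakU kappa (app Us b).
Proof. intros HU Hb. apply (proj2 HU b), (function_maps _ alpha); auto. apply HU. Qed.

Lemma directed_of_weak_GP_uf (kappa lam lam_plus : V) :
  measurable kappa -> infinite_ordinal lam -> is_succ_cardinal lam_plus lam ->
  weak_GP_uf kappa lam -> RK_directed lam_plus kappa.
Proof.
  intros (Ck & _ & U0 & FU0) Il Sl GP.
  apply (directed_of_projections kappa lam); eauto. intros Us HU.
  destruct (GP Us HU) as (M & j & eta & emb & (E & W & SE & UW & CW & TM & cl & _ & _ & surj & _ & cmem & cj)
    & He & Hg).
  exists E, W. split; [exact UW|split; [exact CW|split]].
  { apply short_sequencesE in SE; [|apply Ck]. subst E. now apply (short_sequences_card_le kappa U0). }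
  intros b Hb. assert (G := glues_app kappa j lam Us eta b HU He Hg Hb).
  assert (Mb : M (app eta b)).
  { apply (M_mem M j (embedding_elementary kappa M j emb) _ kappa). apply G.
    apply (uf_full kappa), (uf_sequence_app kappa lam Us b HU Hb). }
  (* The generator is below j(kappa), hence in [M], hence the class of some [f]. Membership of the
     class of [f] in j(X) means that [f] lands in [X] almost everywhere, so [f] is the
     projection. *)
  destruct (surj _ Mb) as (f & Ff & Ef).
  exists (app f); split; [dfn|]. intros X SX. rewrite G, <- Ef.
  assert (Fc : function_on (func E (fun _ => X)) E) by (apply func_on; dfn).
  rewrite (cj X (func E (fun _ => X))); [|exact Fc|intros d Hd; apply maps_func; [dfn|auto]].
  rewrite (cmem f _ Ff Fc), (big_maps E W UW (fun x y => x ∈ y)) by (exact Ff || exact Fc || dfn).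
  rewrite (big_iff E W UW _ (fun x => app f x ∈ X)); [tauto|dfn|dfn|].
  intros d Hd. now rewrite app_func by (dfn || exact Hd).
Qed.

(** * The measure derived from the sequence of generators *)

Section ExtenderMeasure.
Variables (kappa lam : V) (M : V -> Prop) (j : V -> V) (Us eta : V).
Hypothesis Ck : cardinal kappa.
Hypothesis Hk : emp ∈ kappa.
Hypothesis Ll : subset lam kappa.
Hypothesis emb : embedding kappa M j.
Hypothesis HU : uf_sequence kappa lam Us.
Hypothesis He : ordinal_sequence lam eta.
Hypothesis Hg : glues kappa j Us eta.

Let el : elementary_map M j := embedding_elementary kappa M j emb.
Let E := short_sequences kappa.
(** The generators, padded with 0 to length exactly kappa. Closure under kappa-sequences then puts
    [s] into [M], and kappa < j(kappa) makes it a member of j(kappa^{<kappa}), where a measure on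
    kappa^{<kappa} needs its seed. *)
Let s := func kappa (fun b => ite (b ∈ lam) (app eta b) emp).
Let Fs : function_on s kappa.
Proof. apply func_on; dfn. Qed.

Let s_val b : b ∈ lam -> app s b = app eta b.
Proof. intros Hb. unfold s. rewrite app_func by (dfn || auto). now apply ite_true. Qed.

Let Fsj : function_from_to s kappa (j kappa).
Proof.
  apply func_from_to; [dfn|]. intros b Hb. destruct (classic (b ∈ lam)) as [h|h].
  - rewrite ite_true by exact h. apply (glues_app kappa j lam Us eta b HU He Hg h).
    apply (uf_full kappa), (uf_sequence_app kappa lam Us b HU h).
  - rewrite ite_false by exact h.
    rewrite <- (proj2 (proj2 (emb_crit _ _ _ emb)) emp Hk). now apply -> (j_mem M j el).
Qed.

Let Ms : M s.
Proof.
  apply (emb_closed _ _ _ emb); [exact Fs|]. intros x y Hxy.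
  exact (M_mem M j el _ _ (proj2 Fsj x y Hxy)).
Qed.

Let s_mem : s ∈ j E.
Proof.
  refine (transfer_all M j el (fun t k E _ _ =>
    (exists a, a ∈ k /\ function_from_to t a k) -> t ∈ E) kappa E E E _ _ s Ms _); [d0| |].
  - intros t Ht. now apply (proj2 (short_sequencesE kappa E (proj1 Ck)) eq_refl).
  - exists kappa; split; [exact (kappa_mem_j kappa M j el (emb_crit _ _ _ emb))|exact Fsj].
Qed.

Let Dj : Df1 j.
Proof. apply definable_funE, (emb_definable _ _ _ emb). Qed.

Let W := sep (pow E) (fun X => s ∈ j X).
Let HW X : X ∈ W <-> subset X E /\ s ∈ j X.
Proof. unfold W. rewrite in_sep by dfn. now rewrite in_pow. Qed.

Let W_ultra : ultrafilter_on E W.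
Proof.
  constructor.
  - intros X HX; now apply HW in HX.
  - apply HW; split; [now intros x|exact s_mem].
  - intros e He' H. apply HW in H. destruct H as [_ H].
    refine (transfer_all M j el (fun t e _ _ _ => ~ t ∈ e) e e e e _ He' s Ms H); d0.
  - intros X Y HX S SY. apply HW in HX; apply HW; split; [exact SY|].
    refine (transfer_all M j el (fun t X Y _ _ => t ∈ X -> t ∈ Y) X Y Y Y _ S s Ms _);
      [d0|apply HX].
  - intros X Y Z HX HY HZ. apply HW in HX, HY; apply HW; split.
    + intros x Hx. apply HX. now apply HZ in Hx.
    + refine (transfer_all M j el (fun t X Y Z _ => t ∈ X -> t ∈ Y -> t ∈ Z) X Y Z Z _ _ s Ms _ _);
        [d0| |apply HX|apply HY]. intros t H1 H2; apply HZ; auto.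
  - intros X Y S HY. destruct (classic (s ∈ j X)) as [h|h]; [left|right]; apply HW; auto.
    split; [intros x Hx; now apply HY in Hx|].
    refine (transfer_all M j el (fun t X Y E _ => t ∈ E -> ~ t ∈ X -> t ∈ Y) X Y E E _ _ s Ms _ h);
      [d0| |exact s_mem]. intros t H1 H2; apply HY; auto.
Qed.

Let W_complete : complete kappa E W.
Proof.
  intros A SA LA Y HY. apply HW; split; [intros x Hx; now apply HY in Hx|].
  apply card_ltE in LA; [|exact Ck]. destruct LA as (d & Hd & LA).
  refine (transfer_all M j el (fun t A Y E _ => t ∈ E -> (forall X, X ∈ A -> t ∈ X) -> t ∈ Y)
    A Y E E _ _ s Ms s_mem _); [d0|intros t H1 H2; apply HY; auto|].
  (* The family has fewer than kappa members, so each element of its image under [j] is j(X') for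
     some member X'. *)
  intros X HX. destruct (j_small_image kappa M j el (emb_crit _ _ _ emb) A d Hd LA X HX) as (X' & HX' & ->).
  apply SA, HW in HX'; tauto.
Qed.

Lemma measure_of_sequence : exists W, ultrafilter_on E W /\ complete kappa E W /\
  forall b, b ∈ lam -> exists F : V -> V, Df1 F /\
    forall X, subset X kappa -> (X ∈ app Us b <-> big E W (fun x => F x ∈ X)).
Proof.
  exists W; split; [exact W_ultra|split; [exact W_complete|]].
  (* The projection evaluates a sequence at [b]. The default [kappa] is a member of no subset of
     kappa, so sequences too short to have a value at [b] do not count. *)
  intros b Hb. exists (fun t => ite (exists y, maps t b y) (app t b) kappa); split; [dfn|].
  intros X SX. rewrite (glues_app kappa j lam Us eta b HU He Hg Hb).
  set (Y := sep E (fun t => ite (exists y, maps t b y) (app t b) kappa ∈ X)).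
  change (subset X kappa /\ app eta b ∈ j X <-> Y ∈ W). rewrite HW.
  assert (HY : forall t, t ∈ Y <-> t ∈ E /\ exists y, y ∈ X /\ maps t b y).
  { intros t. unfold Y. rewrite in_sep by dfn.
    split; intros [Ht H]; (split; [exact Ht|]);
      apply (proj2 (short_sequencesE kappa E (proj1 Ck)) eq_refl) in Ht; destruct Ht as (a & Ha & F).
    - destruct (classic (exists y, maps t b y)) as [h|h].
      + rewrite ite_true in H by exact h. exists (app t b); split; [exact H|].
        destruct h as [y Hy]. apply (function_maps t a) in Hy; [|apply F].
        apply (function_maps t a); [apply F|tauto].
      + rewrite ite_false in H by exact h. exfalso; exact (mem_irrefl _ (SX _ H)).
    - destruct H as (y & Hy & Hm). rewrite ite_true by eauto.
      apply (function_maps t a) in Hm; [|apply F]. destruct Hm; now subst. }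
  assert (T : s ∈ j Y <-> s ∈ j E /\ exists y, y ∈ j X /\ maps s (j b) y).
  { refine (transfer_all M j el (fun t Y E X b => t ∈ Y <-> t ∈ E /\ exists y, y ∈ X /\ maps t b y)
      Y E X b _ HY s Ms); d0. }
  (* Transfer speaks of the entry at j(b), which is the entry at b because b < lam <= kappa lies
     below the critical point. *)
  rewrite (proj2 (proj2 (emb_crit _ _ _ emb)) b (Ll b Hb)) in T. rewrite T.
  assert (Hs : forall y, maps s b y <-> y = app eta b).
  { intros y. rewrite (function_maps s kappa), s_val by (exact Fs || exact Hb). split; [tauto|].
    intros ->; split; auto. }
  split.
  - intros [_ H]. split; [intros t Ht; now apply HY in Ht|split; [exact s_mem|]].
    exists (app eta b); split; [exact H|now apply Hs].
  - intros [_ [_ (y & Hy & Hm)]]; split; [exact SX|]. apply Hs in Hm; now subst.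
Qed.
End ExtenderMeasure.

Lemma directed_of_weak_GP (kappa lam lam_plus : V) :
  measurable kappa -> infinite_ordinal lam -> is_succ_cardinal lam_plus lam ->
  ord_le lam kappa -> weak_GP kappa lam -> RK_directed lam_plus kappa.
Proof.
  intros (Ck & _ & U0 & FU0) Il Sl Ll GP.
  apply (directed_of_projections kappa lam); eauto. intros Us HU.
  destruct (GP Us HU) as (M & j & eta & emb & _ & He & Hg).
  apply ord_le_subset in Ll; [|apply Il|apply Ck].
  destruct (measure_of_sequence kappa lam M j Us eta Ck (emp_kappa kappa U0 Ck FU0) Ll emb HU He Hg)
    as (W & UW & CW & P).
  exists (short_sequences kappa), W. split; [exact UW|split; [exact CW|split; [|exact P]]].
  now apply (short_sequences_card_le kappa U0).
Qed.
End Directedness.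

(** * Ultrapowers *)

Section Ultrapower.
Context {V : set_structure} {HV : ZFC V}.

Lemma class_choice_total a (R : V -> V -> Prop) : D2 R ->
  exists g, function_on g a /\ forall x, x ∈ a -> (exists y, R x y) -> R x (app g x).
Proof.
  intros DR. destruct (class_choice a (fun x y => (exists z, R x z) -> R x y)) as (g & Fg & Hg).
  - dfn.
  - intros x _. destruct (classic (exists z, R x z)) as [[z Hz]|N]; [exists z; auto|].
    exists emp; intros h; contradiction.
  - eauto.
Qed.

Variables kappa E W : V.
Hypothesis Ck : cardinal kappa.
Hypothesis Hw : omega ∈ kappa.
Hypothesis UW : ultrafilter_on E W.
Hypothesis CW : complete kappa E W.

Notation Fun f := (function_on f E).
Notation bigW := (big E W).

Definition eqW f g := bigW (fun d => app f d = app g d).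
Definition memW f g := bigW (fun d => app f d ∈ app g d).

Lemma D_eqW : D2 eqW. Proof. unfold eqW; dfn. Qed.
Lemma D_memW : D2 memW. Proof. unfold memW; dfn. Qed.
Hint Resolve D_eqW D_memW : dfn.

(* Every [W]-member of [g] is [W]-equal to a function into [values g]; this makes the
   ultrapower membership set-like on representatives. *)
Definition values g := cup (union (repl E (app g))) (sing emp).
Lemma Dt_values : Df1 values. Proof. unfold values; dfn. Qed.
Hint Resolve Dt_values : dfn.

Definition ult_pred g :=
  sep (pow (prod E (values g))) (fun f => Fun f /\ Fun g /\ memW f g).
Lemma Dt_ult_pred : Df1 ult_pred. Proof. unfold ult_pred; dfn. Qed.
Hint Resolve Dt_ult_pred : dfn.

Lemma ult_predE f g : f ∈ ult_pred g <->
  Fun f /\ Fun g /\ memW f g /\ forall d, d ∈ E -> app f d ∈ values g.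
Proof.
  unfold ult_pred. rewrite in_sep by dfn. rewrite in_pow. split.
  - intros (S & Ff & Fg & H). split; [exact Ff|split; [exact Fg|split; [exact H|]]].
    intros d Hd. assert (h := S _ (function_pair f E d Ff Hd)). apply in_prod in h.
    destruct h as (x & y & _ & Hy & Exy). apply pair_inj in Exy. now destruct Exy as [_ ->].
  - intros (Ff & Fg & H & Hv). split; [|auto]. intros p Hp. apply (in_function f E) in Hp; [|exact Ff].
    destruct Hp as (x & Hx & ->). apply in_prod. exists x, (app f x). auto.
Qed.

(** Without a minimal element, choice yields a sequence descending modulo [W]. As omega < kappa,
    completeness makes it descend at almost every point simultaneously, and a single such point
    contradicts foundation. *)
Lemma ult_wf a x : x ∈ a -> exists m, m ∈ a /\ forall y, y ∈ ult_pred m -> ~ y ∈ a.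
Proof.
  intros Hx. apply NNPP; intros N.
  destruct (class_choice a (fun m y => y ∈ ult_pred m /\ y ∈ a)) as (c & _ & Hc); [dfn| |].
  { intros m Hm. apply NNPP; intros h. apply N. exists m; split; [exact Hm|].
    intros y Hy Hya; eauto. }
  destruct (iterate_exists (app c) x) as (F & DF & F0 & FS); [dfn|].
  assert (Fa : forall n, n ∈ omega -> F n ∈ a).
  { apply (omega_induction (fun n => F n ∈ a)); [dfn|now rewrite F0|].
    intros n Hn IH. rewrite FS by exact Hn. now apply Hc. }
  assert (B : bigW (fun d => forall n, n ∈ omega -> app (F (succ n)) d ∈ app (F n) d)).
  { apply (big_forall E W kappa CW omega (fun n d => app (F (succ n)) d ∈ app (F n) d)); [dfn| |].
    - now apply Ck.
    - intros n Hn. rewrite FS by exact Hn.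
      assert (h := proj1 (Hc _ (Fa n Hn))). apply ult_predE in h. apply h. }
  apply (big_ex E W UW) in B; [|dfn]. destruct B as (d & Hd & B).
  destruct (foundation (repl omega (fun n => app (F n) d)) (app (F emp) d)) as (m & Hm & U).
  - apply in_repl; [dfn|]. exists emp; split; [apply emp_omega|auto].
  - apply in_repl in Hm; [|dfn]. destruct Hm as (n & Hn & ->).
    apply (U _ (B n Hn)), in_repl; [dfn|]. exists (succ n); split; [now apply succ_omega|auto].
Qed.

Lemma eqW_sym f g : eqW f g -> eqW g f.
Proof. apply (big_mono E W UW); [dfn|dfn|auto]. Qed.

Lemma memW_eqW_l f g h : eqW f g -> (memW f h <-> memW g h).
Proof.
  intros H. apply (big_iff_big E W UW); [dfn|dfn|]. revert H. apply (big_mono E W UW); [dfn|dfn|].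
  intros d _ ->. tauto.
Qed.

Lemma memW_eqW_r f g h : eqW f g -> (memW h f <-> memW h g).
Proof.
  intros H. apply (big_iff_big E W UW); [dfn|dfn|]. revert H. apply (big_mono E W UW); [dfn|dfn|].
  intros d _ ->. tauto.
Qed.

Lemma ult_pred_repr h g : Fun g -> memW h g -> exists h', h' ∈ ult_pred g /\ eqW h h'.
Proof.
  intros Fg H. exists (func E (fun d => ite (app h d ∈ app g d) (app h d) emp)).
  assert (Eq : eqW h (func E (fun d => ite (app h d ∈ app g d) (app h d) emp))).
  { revert H. apply (big_mono E W UW); [dfn|dfn|].
    intros d Hd H. rewrite app_func by (dfn || exact Hd). now rewrite ite_true. }
  split; [|exact Eq]. apply ult_predE. split; [apply func_on; dfn|split; [exact Fg|split]].
  - now apply (memW_eqW_l _ _ _ Eq).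
  - intros d Hd. rewrite app_func by (dfn || exact Hd). unfold values. apply in_cup.
    destruct (classic (app h d ∈ app g d)) as [h'|h'].
    + left. rewrite ite_true by exact h'. apply in_union. exists (app g d); split; [|exact h'].
      apply in_repl; [dfn|eauto].
    + right. rewrite ite_false by exact h'. now apply in_sing.
Qed.

Lemma collapse_exists : exists cl : V -> V, Df1 cl /\ forall x, cl x = repl (ult_pred x) cl.
Proof. apply (recursion ult_pred (fun _ I => I)); [dfn|dfn|exact ult_wf]. Qed.

Section Collapse.
Variable cl : V -> V.
Hypothesis Dcl : Df1 cl.
Hypothesis clE : forall x, cl x = repl (ult_pred x) cl.

Lemma in_cl g y : y ∈ cl g <-> exists f, f ∈ ult_pred g /\ y = cl f.
Proof. rewrite clE. now apply in_repl. Qed.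

Lemma cl_eqW f g : Fun f -> Fun g -> eqW f g -> cl f = cl g.
Proof.
  revert g. pattern f; revert f. apply (wf_induction ult_pred); [dfn|dfn|exact ult_wf|].
  intros f IH g Ff Fg H. apply set_ext; intros y. rewrite !in_cl. split.
  - intros (h & Hh & ->). assert (Ph := Hh). apply ult_predE in Ph. destruct Ph as (Fh & _ & Mh & _).
    apply (memW_eqW_r _ _ h H) in Mh. destruct (ult_pred_repr h g Fg Mh) as (h' & Hh' & E').
    exists h'; split; [exact Hh'|]. apply IH; auto. apply ult_predE in Hh'; tauto.
  - intros (h & Hh & ->). assert (Ph := Hh). apply ult_predE in Ph. destruct Ph as (Fh & _ & Mh & _).
    apply (memW_eqW_r _ _ h H) in Mh. destruct (ult_pred_repr h f Ff Mh) as (h' & Hh' & E').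
    exists h'; split; [exact Hh'|]. symmetry. apply IH; auto; [apply ult_predE in Hh'; tauto|].
    now apply eqW_sym.
Qed.

(** Extensionality of the ultrapower modulo [W], by induction on [f]: functions that are not
    [W]-equal differ in some [W]-member, and a representative of it would collapse into only one of
    the two classes. *)
Lemma cl_inj f g : Fun f -> Fun g -> cl f = cl g -> eqW f g.
Proof.
  revert g. pattern f; revert f. apply (wf_induction ult_pred); [dfn|dfn|exact ult_wf|].
  intros f IH g Ff Fg Ec. apply NNPP; intros N.
  (* If [u] is not almost everywhere included in [v], choosing a witness at each point gives a
     function that is a [W]-member of [u] but not of [v]. *)
  assert (K : forall u v, ~ bigW (fun d => exists z, z ∈ app u d /\ ~ z ∈ app v d) \/
     exists h, memW h u /\ ~ memW h v).
  { intros u v. destruct (classic (bigW (fun d => exists z, z ∈ app u d /\ ~ z ∈ app v d))) as [B|B];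
      [right|now left].
    destruct (class_choice_total E (fun d z => z ∈ app u d /\ ~ z ∈ app v d)) as (h & Fh & Hh); [dfn|].
    exists h; split.
    - revert B. apply (big_mono E W UW); [dfn|dfn|]. intros d Hd B. now apply Hh.
    - unfold memW. apply (big_not E W UW); [dfn|]. revert B. apply (big_mono E W UW); [dfn|dfn|].
      intros d Hd B. now apply Hh. }
  destruct (K f g) as [B|(h & H1 & H2)].
  - destruct (K g f) as [B'|(h & H1 & H2)].
    + apply N. apply (big_not E W UW) in B; [|dfn]. apply (big_not E W UW) in B'; [|dfn].
      refine (big_and2 E W UW _ _ _ _ _ _ _ B B'); [dfn|dfn|dfn|].
      intros d Hd b b'. apply set_ext; intros z; split; intros Hz; apply NNPP; intros h; eauto.
    + destruct (ult_pred_repr h g Fg H1) as (h' & Hh' & E').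
      assert (Hc : cl h' ∈ cl f) by (rewrite Ec; apply in_cl; eauto).
      apply in_cl in Hc. destruct Hc as (k & Hk & Ek). assert (Pk := Hk).
      apply ult_predE in Pk, Hh'. assert (Q : eqW k h') by (apply IH; auto; tauto).
      apply H2, (memW_eqW_l _ _ _ E'), (memW_eqW_l _ _ _ Q). tauto.
  - destruct (ult_pred_repr h f Ff H1) as (h' & Hh' & E').
    assert (Hc : cl h' ∈ cl g) by (rewrite <- Ec; apply in_cl; eauto).
    apply in_cl in Hc. destruct Hc as (k & Hk & Ek). assert (Ph := Hh').
    apply ult_predE in Ph, Hk. assert (Q : eqW h' k) by (apply IH; auto; tauto).
    apply H2, (memW_eqW_l _ _ _ E'), (memW_eqW_l _ _ _ Q). tauto.
Qed.

Lemma cl_eq f g : Fun f -> Fun g -> (cl f = cl g <-> eqW f g).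
Proof. intros Ff Fg; split; [now apply cl_inj|now apply cl_eqW]. Qed.

Lemma cl_mem f g : Fun f -> Fun g -> (cl f ∈ cl g <-> memW f g).
Proof.
  intros Ff Fg; split.
  - intros H. apply in_cl in H. destruct H as (h & Hh & E'). apply ult_predE in Hh.
    destruct Hh as (Fh & _ & Mh & _). apply cl_eq in E'; auto. now apply (memW_eqW_l _ _ _ E').
  - intros H. destruct (ult_pred_repr f g Fg H) as (h & Hh & E'). apply in_cl. exists h; split; [exact Hh|].
    apply cl_eq; auto. apply ult_predE in Hh; tauto.
Qed.

Definition ultM (y : V) : Prop := exists f, Fun f /\ cl f = y.
Definition const a := func E (fun _ => a).
Definition ultj a := cl (const a).

Lemma Dt_const_fun : Df1 const. Proof. unfold const; dfn. Qed.
Hint Resolve Dt_const_fun : dfn.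

Lemma const_on a : Fun (const a).
Proof. apply func_on; dfn. Qed.

Lemma app_const a d : d ∈ E -> app (const a) d = a.
Proof. intros Hd. unfold const. now rewrite app_func by (dfn || exact Hd). Qed.

Lemma ultM_transitive : transitive_class ultM.
Proof.
  intros x y (g & Fg & <-) Hy. apply in_cl in Hy. destruct Hy as (f & Hf & ->).
  exists f; split; [|auto]. apply ult_predE in Hf; tauto.
Qed.

Lemma big_imp (P Q : V -> Prop) : D1 P -> D1 Q ->
  (bigW (fun d => P d -> Q d) <-> (bigW P -> bigW Q)).
Proof.
  intros DP DQ. split.
  - intros H H'. refine (big_and2 E W UW _ _ _ _ _ _ _ H H'); [dfn|dfn|dfn|auto].
  - intros H. destruct (classic (bigW P)) as [h|h].
    + apply H in h. revert h. apply (big_mono E W UW); [dfn|dfn|auto].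
    + apply (big_not E W UW) in h; [|dfn]. revert h. apply (big_mono E W UW); [dfn|dfn|tauto].
Qed.

Lemma D_sat_app rho phi : D1 (fun d => sat (universe V) (fun n => app (rho n) d) phi).
Proof. apply (D_sat (fun n r => app (rho n) (r 0))). intros n; dfn. Qed.
Hint Resolve D_sat_app : dfn.

Theorem Los phi rho : (forall n, Fun (rho n)) ->
  (sat ultM (fun n => cl (rho n)) phi <->
   bigW (fun d => sat (universe V) (fun n => app (rho n) d) phi)).
Proof.
  revert rho. induction phi as [m n|m n| |p IHp q IHq|p IHp]; intros rho Fr; simpl sat.
  - now apply cl_mem.
  - now apply cl_eq.
  - split; [tauto|]. intros H. apply (big_ex E W UW) in H; [|dfn]. now destruct H as (_ & _ & []).
  - rewrite (big_imp (fun d => sat (universe V) (fun n => app (rho n) d) p)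
                     (fun d => sat (universe V) (fun n => app (rho n) d) q)); [|apply D_sat_app|apply D_sat_app].
    now rewrite (IHp rho Fr), (IHq rho Fr).
  - assert (Dall : D2 (fun d x => sat (universe V) (env_cons x (fun n => app (rho n) d)) p)).
    { apply (D_ext (fun r => sat (universe V)
        (fun n => (env_cons (fun r => r 1) (fun n r => app (rho n) (r 0))) n r) p)).
      - intros r.
        replace (env_cons (r 1) (fun n => app (rho n) (r 0)))
          with (fun n => (env_cons (fun r : nat -> V => r 1) (fun n r => app (rho n) (r 0))) n r);
          [tauto|apply functional_extensionality; now intros [|n]].
      - apply D_sat. intros [|n]; simpl; dfn. }
    assert (Dg : forall g, D1 (fun d =>
      sat (universe V) (env_cons (app g d) (fun n => app (rho n) d)) p)).
    { intros g. apply (D_app2 _ (fun r => r 0) (fun r => app g (r 0)) Dall); dfn. }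
    assert (K : forall g, Fun g -> (sat ultM (env_cons (cl g) (fun n => cl (rho n))) p <->
       bigW (fun d => sat (universe V) (env_cons (app g d) (fun n => app (rho n) d)) p))).
    { intros g Fg. specialize (IHp (env_cons g rho)).
      replace (env_cons (cl g) (fun n => cl (rho n))) with (fun n => cl (env_cons g rho n))
        by (apply functional_extensionality; now intros [|n]).
      rewrite IHp by (intros [|k]; simpl; auto).
      apply (big_iff E W UW); [apply D_sat_app|exact (Dg g)|].
      intros d _.
      replace (env_cons (app g d) (fun n => app (rho n) d)) with (fun n => app (env_cons g rho n) d);
        [tauto|apply functional_extensionality; now intros [|n]]. }
    assert (Dall' : D1 (fun d => forall x, universe V x ->
      sat (universe V) (env_cons x (fun n => app (rho n) d)) p)).
    { apply (D_ext (fun r => forall x, sat (universe V) (env_cons x (fun n => app (rho n) (r 0))) p)).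
      - intros r; unfold universe; split; intros H x; auto.
      - apply D_all. exact (D_app2 _ (fun r => r 1) (fun r => r 0) Dall (Dt_var 1) (Dt_var 0)). }
    split.
    + intros H. apply NNPP; intros N. apply (big_not E W UW) in N; [|exact Dall'].
      (* Choose a counterexample at every point that has one; the class of the resulting function
         belongs to [ultM] and refutes the universal statement there. *)
      destruct (class_choice_total E (fun d x => ~ sat (universe V) (env_cons x (fun n => app (rho n) d)) p))
        as (g & Fg & Hg); [apply D_not, Dall|].
      assert (B : bigW (fun d => sat (universe V) (env_cons (app g d) (fun n => app (rho n) d)) p)).
      { apply K; [exact Fg|]. apply H. exists g; auto. }
      revert B. apply (big_not E W UW); [exact (Dg g)|]. revert N. apply (big_mono E W UW).
      * apply D_not, Dall'.
      * apply D_not, (Dg g).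
      * intros d Hd N. apply Hg; [exact Hd|]. apply NNPP; intros N'. apply N. intros x _.
        apply NNPP; intros h; eauto.
    + intros B x (g & Fg & <-). apply K; [exact Fg|]. revert B. apply (big_mono E W UW); [exact Dall'|exact (Dg g)|].
      intros d _ B. apply B; exact I.
Qed.

Lemma ultj_elementary : elementary_map ultM ultj.
Proof.
  constructor; [exact ultM_transitive|intros x; exists (const x); split; [apply const_on|reflexivity]|].
  intros phi rho. rewrite (Los phi (fun n => const (rho n))) by (intros; apply const_on).
  assert (H : forall d, d ∈ E -> (sat (universe V) (fun n => app (const (rho n)) d) phi <->
                                 sat (universe V) rho phi)).
  { intros d Hd. replace (fun n => app (const (rho n)) d) with rho; [tauto|].
    apply functional_extensionality; intros n. now rewrite app_const. }
  split.
  - intros S. apply (big_true E W UW); [apply D_sat_app|]. intros d Hd. now apply H.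
  - intros B. apply (big_ex E W UW) in B; [|apply D_sat_app]. destruct B as (d & Hd & B). now apply (H d Hd).
Qed.

(** By induction on the ordinal: a function almost everywhere below [a] is, by [big_exists], almost
    everywhere a constant b < [a], so its class is j(b) = b. *)
Lemma ultj_small a : a ∈ kappa -> ultj a = a.
Proof.
  intros Ha. assert (Ok := proj1 Ck).
  revert Ha. assert (Oa : a ∈ kappa -> ordinal a) by apply (ord_mem _ _ Ok).
  destruct (classic (ordinal a)) as [O|O]; [|tauto]. clear Oa. revert a O.
  apply (ord_induction (fun a => a ∈ kappa -> ultj a = a)); [unfold ultj; dfn|].
  intros a Oa IH Ha. assert (IH' : forall b, b ∈ a -> ultj b = b)
    by (intros b Hb; apply IH; [exact Hb|exact (ord_mem_trans _ _ _ Ok Hb Ha)]).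
  apply set_ext; intros y. split.
  - intros Hy. apply in_cl in Hy. destruct Hy as (f & Hf & ->). apply ult_predE in Hf.
    destruct Hf as (Ff & _ & Mf & _).
    destruct (big_exists E W UW kappa CW a (fun b d => app f d = b)) as (b & Hb & B);
      [dfn|now apply Ck| |].
    + revert Mf. apply (big_mono E W UW); [dfn|dfn|]. intros d Hd H. rewrite app_const in H by exact Hd. eauto.
    + replace (cl f) with b; [exact Hb|]. rewrite <- (IH' b Hb). symmetry. apply cl_eq; [exact Ff|apply const_on|].
      revert B. apply (big_mono E W UW); [dfn|dfn|]. intros d Hd ->. now rewrite app_const.
  - intros Hy. rewrite <- (IH' y Hy). apply cl_mem; try apply const_on.
    apply (big_true E W UW); [dfn|]. intros d Hd. now rewrite !app_const.
Qed.

(** Łoś applied to the bounded formula for pairs, whose meaning in the transitive class [ultM] is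
    the true one. *)
Lemma cl_pair q x y : Fun q -> Fun x -> Fun y -> bigW (fun d => app q d = pair (app x d) (app y d)) ->
  cl q = pair (cl x) (cl y).
Proof.
  intros Fq Fx Fy B. apply is_pairE.
  destruct (D0_is_pair (V := V)) as (phi & H).
  set (rho := env_cons q (env_cons x (fun _ => y))).
  assert (Fr : forall n, Fun (rho n)) by (intros [|[|n]]; assumption).
  apply (H ultM ultM_transitive (fun n => cl (rho n))); [intros n; exists (rho n); auto|].
  apply Los; [exact Fr|]. revert B. apply (big_mono E W UW); [dfn|apply D_sat_app|].
  intros d Hd B. apply (H (universe V)); [intros ? ? ? ?; exact I|intros; exact I|].
  now apply is_pairE.
Qed.

(** * Critical point and closure of the ultrapower *)

Section Critical.
(** A function into kappa that is constant on no large set. Its class lies below j(kappa) but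
    differs from every ordinal below kappa, since those are classes of constants; this is what moves
    kappa. *)
Variable g0 : V.
Hypothesis Fg0 : Fun g0.
Hypothesis g0_kappa : forall d, d ∈ E -> app g0 d ∈ kappa.
Hypothesis g0_free : forall a, bigW (fun d => app g0 d <> a).

Lemma ultj_crit : is_crit ultj kappa.
Proof.
  split; [apply Ck|split; [|exact ultj_small]]. intros Ek.
  assert (H : cl g0 ∈ kappa).
  { rewrite <- Ek. apply cl_mem; [exact Fg0|apply const_on|].
    apply (big_true E W UW); [dfn|]. intros d Hd. rewrite app_const by exact Hd. auto. }
  assert (Q : eqW g0 (const (cl g0))).
  { apply cl_inj; [exact Fg0|apply const_on|]. symmetry. now apply ultj_small. }
  assert (F := g0_free (cl g0)). apply (big_not E W UW) in F; [|dfn]. apply F.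
  revert Q. apply (big_mono E W UW); [dfn|dfn|]. intros d Hd H'. now rewrite app_const in H'.
Qed.

(** Let h represent kappa and g_x represent f(x). Then f is represented by the function sending d to
    the sequence of all g_xi(d) with xi < h(d). *)
Lemma ultM_closed : closed_under_sequences kappa ultM.
Proof.
  intros f Ff Mf.
  assert (Mk : ultM kappa).
  { apply (ultM_transitive (ultj kappa)); [apply (elem_into _ _ ultj_elementary)|].
    exact (kappa_mem_j kappa ultM ultj ultj_elementary ultj_crit). }
  destruct Mk as (h & Fh & Eh).
  destruct (class_choice kappa (fun x g => Fun g /\ cl g = app f x)) as (g & _ & Hg); [dfn| |].
  { intros x Hx. apply (Mf x), (function_maps f kappa); auto. }
  set (G := func E (fun d => func (app h d) (fun xi => app (app g xi) d))).
  assert (FG : Fun G) by (apply func_on; dfn).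
  assert (AG : forall d, d ∈ E -> app G d = func (app h d) (fun xi => app (app g xi) d))
    by (intros d Hd; unfold G; now rewrite app_func by (dfn || exact Hd)).
  exists G; split; [exact FG|]. apply set_ext; intros p. rewrite (in_function f kappa) by exact Ff. split.
  - intros Hp. apply in_cl in Hp. destruct Hp as (q & Hq & ->). apply ult_predE in Hq.
    destruct Hq as (Fq & _ & Mq & _).
    (* [k] reads off the index of the pair q(d). Its class is below kappa, so [k] is almost
       everywhere one fixed index, and [q] represents the pair of [f] at that index. *)
    destruct (class_choice_total E (fun d xi => xi ∈ app h d /\ app q d = pair xi (app (app g xi) d)))
      as (k & Fk & Hk); [dfn|].
    assert (B : bigW (fun d => app k d ∈ app h d /\ app q d = pair (app k d) (app (app g (app k d)) d))).
    { revert Mq. apply (big_mono E W UW); [dfn|dfn|]. intros d Hd H. rewrite AG in H by exact Hd.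
      apply in_repl in H; [|dfn]. apply Hk; [exact Hd|exact H]. }
    assert (Kk : cl k ∈ kappa).
    { rewrite <- Eh. apply cl_mem; [exact Fk|exact Fh|]. revert B. apply (big_mono E W UW); [dfn|dfn|tauto]. }
    assert (Q : eqW k (const (cl k))).
    { apply cl_inj; [exact Fk|apply const_on|]. symmetry. now apply ultj_small. }
    exists (cl k); split; [exact Kk|]. destruct (Hg _ Kk) as [Fgk Egk]. rewrite <- Egk.
    apply cl_pair; auto. refine (big_and2 E W UW _ _ _ _ _ _ _ B Q); [dfn|dfn|dfn|].
    intros d Hd [_ b] e. rewrite app_const in e by exact Hd. now rewrite b, e.
  - intros (x & Hx & ->). destruct (Hg x Hx) as [Fgx Egx].
    set (q := func E (fun d => pair x (app (app g x) d))).
    assert (Fq : Fun q) by (apply func_on; dfn).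
    assert (Aq : forall d, d ∈ E -> app q d = pair x (app (app g x) d))
      by (intros d Hd; unfold q; now rewrite app_func by (dfn || exact Hd)).
    replace (pair x (app f x)) with (cl q).
    + apply cl_mem; auto.
      assert (B : memW (const x) h).
      { apply cl_mem; [apply const_on|exact Fh|]. rewrite Eh. change (ultj x ∈ kappa). now rewrite ultj_small. }
      revert B. apply (big_mono E W UW); [dfn|dfn|]. intros d Hd H. rewrite app_const in H by exact Hd.
      rewrite AG, Aq by exact Hd. apply in_repl; [dfn|eauto].
    + rewrite <- Egx. transitivity (pair (ultj x) (cl (app g x))); [|now rewrite ultj_small].
      apply (cl_pair q (const x)); auto; [apply const_on|].
      apply (big_true E W UW); [dfn|]. intros d Hd. rewrite Aq, app_const by exact Hd. reflexivity.
Qed.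

Lemma ultj_embedding : embedding kappa ultM ultj.
Proof.
  constructor.
  - unfold ultM; dfn.
  - unfold ultj; dfn.
  - exact ultM_transitive.
  - apply (elem_into _ _ ultj_elementary).
  - apply (elem_sat _ _ ultj_elementary).
  - exact ultj_crit.
  - exact ultM_closed.
Qed.
End Critical.

Lemma ultM_is_ultrapower : is_ultrapower E W ultM ultj.
Proof.
  split; [exact ultM_transitive|]. exists cl. split; [dfn|split; [|split; [|split; [|split]]]].
  - intros f Ff; exists f; auto.
  - intros y Hy; exact Hy.
  - intros f g Ff Fg. rewrite (cl_eq f g Ff Fg). symmetry. apply (big_maps E W UW (fun x y => x = y)); auto; dfn.
  - intros f g Ff Fg. rewrite (cl_mem f g Ff Fg). symmetry. apply (big_maps E W UW (fun x y => x ∈ y)); auto; dfn.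
  - intros a c Fc Hc. unfold ultj. f_equal. apply (function_ext _ _ E); [apply const_on|exact Fc|].
    intros d Hd. rewrite app_const by exact Hd. specialize (Hc d Hd).
    apply (function_maps c E) in Hc; tauto.
Qed.
End Collapse.

Theorem ultrapower_exists g0 : Fun g0 -> (forall d, d ∈ E -> app g0 d ∈ kappa) ->
  (forall a, bigW (fun d => app g0 d <> a)) ->
  exists (M : V -> Prop) (j cl : V -> V), Df1 cl /\ embedding kappa M j /\ is_ultrapower E W M j /\
    (forall f g, Fun f -> Fun g -> (cl f ∈ cl g <-> bigW (fun d => app f d ∈ app g d))) /\
    (forall f X, Fun f -> (cl f ∈ j X <-> bigW (fun d => app f d ∈ X))).
Proof.
  intros Fg H1 H2. destruct collapse_exists as (cl & Dcl & clE).
  exists (ultM cl), (ultj cl), cl. split; [exact Dcl|].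
  split; [now apply (ultj_embedding cl Dcl clE g0)|].
  split; [now apply ultM_is_ultrapower|]. split; [intros; now apply cl_mem|].
  intros f X Ff. unfold ultj. rewrite cl_mem; auto; [|apply const_on].
  apply (big_iff E W UW); [dfn|dfn|]. intros d Hd. now rewrite app_const.
Qed.
End Ultrapower.

(** * From directedness to gluing *)

Section Gluing.
Context {V : set_structure} {HV : ZFC V}.

(** The record spelled out as a conjunction, the form in which the definability tactic can read
    it. *)
Lemma ultrafilter_onE (E U : V) : ultrafilter_on E U <->
  (forall X, X ∈ U -> subset X E) /\ E ∈ U /\ (forall e, (forall x, ~ x ∈ e) -> ~ e ∈ U) /\
  (forall X Y, X ∈ U -> subset X Y -> subset Y E -> Y ∈ U) /\
  (forall X Y Z, X ∈ U -> Y ∈ U -> (forall x, x ∈ Z <-> x ∈ X /\ x ∈ Y) -> Z ∈ U) /\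
  (forall X Y, subset X E -> (forall x, x ∈ Y <-> x ∈ E /\ ~ x ∈ X) -> X ∈ U \/ Y ∈ U).
Proof.
  split; [intros [? ? ? ? ? ?]; auto 10|intros (? & ? & ? & ? & ? & ?); now constructor].
Qed.

Lemma D_frakU : D2 (@frakU V).
Proof.
  unfold frakU. apply D_and; [|apply D_and].
  - eapply D_ext; [intros r; apply ultrafilter_onE|]. dfn.
  - unfold complete, card_lt, card_le; dfn.
  - unfold principal; dfn.
Qed.
Hint Resolve D_frakU : dfn.

Lemma pairing_exists (kappa U : V) : cardinal kappa -> frakU kappa U ->
  exists (q : V -> V -> V) (l r : V -> V), Df2 q /\ Df1 l /\ Df1 r /\
    (forall x y, x ∈ kappa -> y ∈ kappa -> q x y ∈ kappa /\ l (q x y) = x /\ r (q x y) = y) /\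
    (forall z, z ∈ kappa -> l z ∈ kappa) /\ (forall z, z ∈ kappa -> r z ∈ kappa).
Proof.
  intros Ck FU. assert (H := prod_card_le kappa U Ck FU). apply card_le_elim in H.
  destruct H as (f & Hf & If).
  set (q := fun x y => app f (pair x y)).
  assert (Dq : Df2 q) by (unfold q; dfn).
  assert (Hq : forall x y, x ∈ kappa -> y ∈ kappa -> q x y ∈ kappa)
    by (intros x y Hx Hy; apply Hf, in_prod; eauto 6).
  assert (Iq : forall x y x' y', x ∈ kappa -> y ∈ kappa -> x' ∈ kappa -> y' ∈ kappa ->
    q x y = q x' y' -> x = x' /\ y = y').
  { intros x y x' y' Hx Hy Hx' Hy' E. apply pair_inj, If; auto; apply in_prod; eauto 6. }
  set (l := fun z => union (sep kappa (fun x => exists y, y ∈ kappa /\ q x y = z))).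
  set (r := fun z => union (sep kappa (fun y => exists x, x ∈ kappa /\ q x y = z))).
  assert (Dl : Df1 l) by (unfold l; dfn). assert (Dr : Df1 r) by (unfold r; dfn).
  assert (El : forall x y, x ∈ kappa -> y ∈ kappa -> l (q x y) = x).
  { intros x y Hx Hy. apply set_ext; intros t. unfold l. rewrite in_union. split.
    - intros (x' & Hx' & Ht). apply in_sep in Hx'; [|dfn]. destruct Hx' as (Hx' & y' & Hy' & E).
      apply Iq in E; auto. now destruct E as [-> _].
    - intros Ht; exists x; split; [|exact Ht]. apply in_sep; [dfn|]. eauto. }
  assert (Er : forall x y, x ∈ kappa -> y ∈ kappa -> r (q x y) = y).
  { intros x y Hx Hy. apply set_ext; intros t. unfold r. rewrite in_union. split.
    - intros (y' & Hy' & Ht). apply in_sep in Hy'; [|dfn]. destruct Hy' as (Hy' & x' & Hx' & E).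
      apply Iq in E; auto. now destruct E as [_ ->].
    - intros Ht; exists y; split; [|exact Ht]. apply in_sep; [dfn|]. eauto. }
  (* Off the range of the pairing both projections are empty, so they still map kappa into kappa. *)
  assert (range : forall z, (exists x y, x ∈ kappa /\ y ∈ kappa /\ z = q x y) \/ (l z = emp /\ r z = emp)).
  { intros z. destruct (classic (exists x y, x ∈ kappa /\ y ∈ kappa /\ z = q x y)) as [h|h]; [now left|right].
    split; apply is_empty_emp; intros t Ht; apply in_union in Ht; destruct Ht as (u & Hu & _);
      (apply in_sep in Hu; [|dfn]); destruct Hu as (Hu & v & Hv & <-); apply h; eauto 6. }
  exists q, l, r. split; [exact Dq|split; [exact Dl|split; [exact Dr|split; [auto|split]]]];
    intros z _; destruct (range z) as [(x & y & Hx & Hy & ->)|[E1 E2]].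
  - now rewrite El.
  - rewrite E1. exact (emp_kappa kappa U Ck FU).
  - now rewrite Er.
  - rewrite E2. exact (emp_kappa kappa U Ck FU).
Qed.

(** * Products of ultrafilters *)

Section Product.
Variables (kappa W U : V) (q : V -> V -> V).
Hypothesis UW : ultrafilter_on kappa W.
Hypothesis CW : complete kappa kappa W.
Hypothesis UU : ultrafilter_on kappa U.
Hypothesis CU : complete kappa kappa U.
Hypothesis Dq : Df2 q.
Hypothesis Hq : forall x y, x ∈ kappa -> y ∈ kappa -> q x y ∈ kappa.

(** The Fubini product of [W] and [U], carried to kappa by the pairing [q]: for almost every first
    coordinate, almost every second coordinate. *)
Definition uf_prod : V :=
  sep (pow kappa) (fun X => big kappa W (fun x => big kappa U (fun y => q x y ∈ X))).

Lemma in_uf_prod X : X ∈ uf_prod <->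
  subset X kappa /\ big kappa W (fun x => big kappa U (fun y => q x y ∈ X)).
Proof. unfold uf_prod. rewrite in_sep by dfn. now rewrite in_pow. Qed.

Lemma big_uf_prod (P : V -> Prop) : D1 P ->
  (big kappa uf_prod P <-> big kappa W (fun x => big kappa U (fun y => P (q x y)))).
Proof.
  intros DP. unfold big at 1. rewrite in_uf_prod.
  rewrite (big_iff kappa W UW _ (fun x => big kappa U (fun y => P (q x y)))); [|dfn|dfn|].
  - split; [tauto|]. intros h; split; [now apply sep_subset|exact h].
  - intros x Hx. apply (big_iff kappa U UU); [dfn|dfn|]. intros y Hy. rewrite in_sep by dfn.
    split; [tauto|]. auto.
Qed.

Lemma uf_prod_ultrafilter : ultrafilter_on kappa uf_prod.
Proof.
  constructor.
  - intros X HX. now apply in_uf_prod in HX.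
  - apply in_uf_prod. split; [now intros x|].
    apply (big_true kappa W UW); [dfn|]. intros x Hx. apply (big_true kappa U UU); [dfn|auto].
  - intros e He H. apply in_uf_prod in H. destruct H as [_ H].
    apply (big_ex kappa W UW) in H; [|dfn]. destruct H as (x & _ & H).
    apply (big_ex kappa U UU) in H; [|dfn]. destruct H as (y & _ & H). exact (He _ H).
  - intros X Y HX S S'. apply in_uf_prod in HX. apply in_uf_prod. split; [exact S'|].
    destruct HX as [_ HX]. revert HX. apply (big_mono kappa W UW); [dfn|dfn|]. intros x _.
    apply (big_mono kappa U UU); [dfn|dfn|auto].
  - intros X Y Z HX HY HZ. apply in_uf_prod in HX, HY. apply in_uf_prod.
    destruct HX as [SX HX], HY as [SY HY]. split; [intros x Hx; apply SX; now apply HZ in Hx|].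
    refine (big_and2 kappa W UW _ _ _ _ _ _ _ HX HY); [dfn|dfn|dfn|]. intros x _ h h'.
    refine (big_and2 kappa U UU _ _ _ _ _ _ _ h h'); [dfn|dfn|dfn|]. intros y _ k k'. apply HZ; auto.
  - intros X Y S HY.
    destruct (classic (big kappa W (fun x => big kappa U (fun y => q x y ∈ X)))) as [h|h]; [left|right];
      apply in_uf_prod; auto. split; [intros x Hx; now apply HY in Hx|].
    apply (big_not kappa W UW) in h; [|dfn]. revert h. apply (big_mono kappa W UW); [dfn|dfn|].
    intros x Hx h. apply (big_not kappa U UU) in h; [|dfn]. revert h.
    apply (big_mono kappa U UU); [dfn|dfn|]. intros y Hy h. apply HY; auto.
Qed.

Lemma uf_prod_complete : complete kappa kappa uf_prod.
Proof.
  intros A SA LA Y HY. apply in_uf_prod. split; [intros x Hx; now apply HY in Hx|].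
  assert (B : big kappa W (fun x => forall X, X ∈ A -> big kappa U (fun y => q x y ∈ X))).
  { apply (big_forall kappa W kappa CW A (fun X x => big kappa U (fun y => q x y ∈ X))); [dfn|exact LA|].
    intros X HX. now apply SA, in_uf_prod in HX. }
  revert B. apply (big_mono kappa W UW); [dfn|dfn|]. intros x Hx B.
  apply (big_forall kappa U kappa CU A (fun X y => q x y ∈ X)) in B; [|dfn|exact LA].
  revert B. apply (big_mono kappa U UU); [dfn|dfn|]. intros y Hy B. apply HY; auto.
Qed.
End Product.

(** * Good ultrafilters and increasing generators *)

Section Increasing.
Variables (kappa lam lam_plus beta Us U0 : V).
Hypothesis Ck : cardinal kappa.
Hypothesis Hw : omega ∈ kappa.
Hypothesis FU0 : frakU kappa U0.
Hypothesis Ol : ordinal lam.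
Hypothesis Sl : is_succ_cardinal lam_plus lam.
Hypothesis dir : RK_directed lam_plus kappa.
Hypothesis Hb : beta ∈ lam_plus.
Hypothesis HU : uf_sequence kappa beta Us.

Variables (q : V -> V -> V) (l r : V -> V).
Hypothesis Dq : Df2 q.
Hypothesis Dl : Df1 l.
Hypothesis Dr : Df1 r.
Hypothesis Hq : forall x y, x ∈ kappa -> y ∈ kappa -> q x y ∈ kappa /\ l (q x y) = x /\ r (q x y) = y.
Hypothesis Hl : forall z, z ∈ kappa -> l z ∈ kappa.
Hypothesis Hr : forall z, z ∈ kappa -> r z ∈ kappa.

Let Ob : ordinal beta := ord_mem _ _ (proj1 (proj1 Sl)) Hb.

(** Directedness is used only here: [b] has at most lam elements because b <= beta < lam^+. Each
    member is recovered from the bound as an image ultrafilter. *)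
Let bound_family (b g : V) : ord_le b beta -> (forall a, a ∈ b -> frakU kappa (app g a)) ->
  exists W, frakU kappa W /\ forall a, a ∈ b -> exists f, (forall x, x ∈ kappa -> app f x ∈ kappa) /\
    app g a = push kappa W (app f) kappa.
Proof.
  intros Lb Hg. destruct (dir (repl b (app g))) as (W & FW & HW).
  - intros U HU'. apply in_repl in HU'; [|dfn]. destruct HU' as (a & Ha & ->); auto.
  - apply (card_lt_succ_cardinal lam_plus lam); auto.
    apply (card_le_trans _ b); [apply card_le_repl; dfn|].
    apply (mem_succ_cardinal lam_plus lam); auto. exact (ord_le_mem_trans _ _ _ (proj1 (proj1 Sl)) Lb Hb).
  - exists W; split; [exact FW|]. intros a Ha.
    destruct (RK_le_elim kappa (app g a) W) as (f & Hf & H); [apply HW, in_repl; [dfn|eauto]|].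
    exists f; split; [exact Hf|]. apply RK_le_push; [apply Hg, Ha|exact H].
Qed.

Definition dominates E E' : Prop := exists p, (forall x, x ∈ kappa -> app p x ∈ kappa) /\
  E' = push kappa E (app p) kappa /\ big kappa E (fun z => r (app p z) ∈ r z).

Lemma D_dominates : D2 dominates.
Proof. unfold dominates, push; dfn. Qed.
Hint Resolve D_dominates : dfn.

Definition good_step (b E H : V) : Prop :=
  frakU kappa E /\ (forall X, subset X kappa -> (X ∈ app Us b <-> big kappa E (fun z => r z ∈ X))) /\
  forall a, a ∈ b -> exists E', pair a E' ∈ H /\ dominates E E'.

Lemma D_good_step : D3 good_step.
Proof. unfold good_step; dfn. Qed.
Hint Resolve D_good_step : dfn.

Definition good_closed (H : V) : Prop := forall b E, b ∈ beta -> good_step b E H -> pair b E ∈ H.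

(** Goodness at [b] refers to goodness at smaller indices, so it is an inductive definition: the
    intersection of all sets closed under [good_step]. The ambient product makes it a set. *)
Definition good : V :=
  sep (prod beta (pow (pow kappa))) (fun p => forall H, good_closed H -> p ∈ H).

Lemma in_good p : p ∈ good <-> p ∈ prod beta (pow (pow kappa)) /\ forall H, good_closed H -> p ∈ H.
Proof. unfold good, good_closed. rewrite in_sep by dfn. reflexivity. Qed.

Lemma good_step_mono b E H H' : subset H H' -> good_step b E H -> good_step b E H'.
Proof.
  intros S (h1 & h2 & h3). split; [exact h1|split; [exact h2|]]. intros a Ha.
  destruct (h3 a Ha) as (E' & HE & h). eauto.
Qed.

Lemma good_intro b E : b ∈ beta -> good_step b E good -> pair b E ∈ good.
Proof.
  intros Hbb h. apply in_good; split.
  - apply in_prod. exists b, E; repeat split; auto. apply in_pow. intros X HX. apply in_pow.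
    exact (uf_subset _ _ (proj1 (proj1 h)) X HX).
  - intros H CH. apply CH; [exact Hbb|]. revert h. apply good_step_mono.
    intros p Hp. apply in_good in Hp. now apply Hp.
Qed.

Lemma good_elim b E : pair b E ∈ good -> good_step b E good.
Proof.
  intros Hp.
  (* Inversion for a least fixed point: the good pairs that satisfy [good_step] already form a
     closed set, which therefore contains all good pairs. *)
  set (H := sep good (fun p => forall b E, p = pair b E -> good_step b E good)).
  assert (HH : forall p, p ∈ H <-> p ∈ good /\ forall b E, p = pair b E -> good_step b E good) by sep_spec.
  assert (CH : good_closed H).
  { intros b' E' Hb' h. assert (h' : good_step b' E' good).
    { revert h; apply good_step_mono. intros p Hp'. now apply HH in Hp'. }
    apply HH; split; [now apply good_intro|]. intros b'' E'' Eq. apply pair_inj in Eq.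
    destruct Eq; now subst. }
  apply in_good in Hp. destruct Hp as [_ Hp]. apply Hp, HH in CH. now apply CH.
Qed.

Lemma good_total b : b ∈ beta -> exists E, pair b E ∈ good.
Proof.
  intros Hbb. assert (Obb := ord_mem _ _ Ob Hbb). revert b Obb Hbb.
  apply (ord_induction (fun b => b ∈ beta -> exists E, pair b E ∈ good)); [dfn|].
  intros b Obb IH Hbb.
  destruct (class_choice b (fun a E => pair a E ∈ good)) as (g & _ & Hg); [dfn| |].
  { intros a Ha. apply IH; [exact Ha|exact (ord_mem_trans _ _ _ Ob Ha Hbb)]. }
  destruct (bound_family b g) as (W & FW & HW); [now left|intros a Ha; apply (good_elim _ _ (Hg a Ha))|].
  assert (FU := uf_sequence_app kappa beta Us b HU Hbb).
  set (U := app Us b) in *.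
  assert (Hq' : forall x y, x ∈ kappa -> y ∈ kappa -> q x y ∈ kappa) by (intros; now apply Hq).
  assert (UP := uf_prod_ultrafilter kappa W U q (proj1 FW) (proj1 FU) Dq Hq').
  assert (CP := uf_prod_complete kappa W U q (proj1 FW) (proj1 (proj2 FW)) (proj1 FU) (proj1 (proj2 FU)) Dq Hq').
  assert (BP := big_uf_prod kappa W U q (proj1 FW) (proj1 FU) Dq Hq').
  set (E := uf_prod kappa W U q) in *.
  assert (const : forall P : Prop, big kappa U (fun _ => P) <-> P).
  { intros P; split; intros h.
    - apply (big_ex kappa U (proj1 FU)) in h; [|dfn]. now destruct h as (_ & _ & h).
    - apply (big_true kappa U (proj1 FU)); [dfn|auto]. }
  assert (PU : forall X, subset X kappa -> (X ∈ U <-> big kappa E (fun z => r z ∈ X))).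
  { intros X SX. rewrite BP by dfn.
    assert (h : forall x, x ∈ kappa -> (X ∈ U <-> big kappa U (fun y => r (q x y) ∈ X))).
    { intros x Hx. rewrite (big_mem kappa U X SX). apply (big_iff kappa U (proj1 FU)); [dfn|dfn|].
      intros y Hy. now rewrite (proj2 (proj2 (Hq x y Hx Hy))). }
    split; intros HX.
    - apply (big_true kappa W (proj1 FW)); [dfn|]. intros x Hx. now apply (h x Hx).
    - apply (big_ex kappa W (proj1 FW)) in HX; [|dfn]. destruct HX as (x & Hx & HX). now apply (h x Hx). }
  exists E. apply good_intro; [exact Hbb|]. split; [|split; [exact PU|]].
  - split; [exact UP|split; [exact CP|]].
    apply (RK_le_nonprincipal kappa U); [apply FU| |apply FU].
    now apply (RK_le_intro kappa U E r).
  - intros a Ha. exists (app g a); split; [now apply Hg|].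
    destruct (HW a Ha) as (f & Hf & Ef).
    assert (Ap : forall z, z ∈ kappa -> app (func kappa (fun z => app f (l z))) z = app f (l z))
      by (intros z Hz; now rewrite app_func by (dfn || exact Hz)).
    (* Taking the first coordinate maps the product to [W], and [f] maps [W] to the ultrafilter
       chosen at [a]. *)
    exists (func kappa (fun z => app f (l z))). split; [|split].
    + intros z Hz. rewrite Ap; auto.
    + rewrite Ef. apply set_ext; intros X. rewrite !in_push by dfn.
      rewrite (BP (fun z => app (func kappa (fun z => app f (l z))) z ∈ X)) by dfn.
      rewrite (big_iff kappa W (proj1 FW) (fun x => app f x ∈ X)
        (fun x => big kappa U (fun y => app (func kappa (fun z => app f (l z))) (q x y) ∈ X)));
        [tauto|dfn|dfn|].
      intros x Hx. rewrite <- (const (app f x ∈ X)). apply (big_iff kappa U (proj1 FU)); [dfn|dfn|].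
      intros y Hy. destruct (Hq x y Hx Hy) as (h1 & h2 & _). now rewrite Ap, h2.
    + rewrite BP by dfn. apply (big_true kappa W (proj1 FW)); [dfn|]. intros x Hx.
      (* For fixed x, the second coordinate of f(x) is a fixed ordinal below kappa, and [U]-almost
         every y exceeds it. *)
      assert (A := big_above kappa U Ck FU (r (app f x)) (Hr _ (Hf x Hx))).
      revert A. apply (big_mono kappa U (proj1 FU)); [dfn|dfn|]. intros y Hy A.
      destruct (Hq x y Hx Hy) as (h1 & h2 & h3). now rewrite Ap, h2, h3.
Qed.

Lemma increasing_gluing : exists (M : V -> Prop) (j : V -> V) (eta : V),
  embedding kappa M j /\ ultrapower_embedding kappa M j /\
  ordinal_sequence beta eta /\ strictly_increasing eta /\ glues kappa j Us eta.
Proof.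
  destruct (class_choice beta (fun b E => pair b E ∈ good)) as (g & _ & Hg); [dfn|exact good_total|].
  destruct (bound_family beta g) as (W0 & FW0 & HW0);
    [now right|intros a Ha; apply (good_elim _ _ (Hg a Ha))|].
  set (E := short_sequences kappa).
  assert (HE := proj2 (short_sequencesE kappa E (proj1 Ck)) eq_refl).
  assert (H1 : succ emp ∈ kappa).
  { exact (ord_mem_trans _ _ _ (proj1 Ck) (succ_omega _ emp_omega) Hw). }
  (* The measure has to live on kappa^{<kappa}; sequences of length one provide a copy of kappa in
     it. *)
  set (i := fun x => func (succ emp) (fun _ => x)).
  assert (Di : Df1 i) by (unfold i; dfn).
  assert (Hi : forall x, x ∈ kappa -> i x ∈ E).
  { intros x Hx. apply HE. exists (succ emp); split; [exact H1|]. apply func_from_to; [dfn|auto]. }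
  assert (Ei : forall x, app (i x) emp = x).
  { intros x. unfold i. rewrite app_func; [reflexivity|dfn|apply in_succ; auto]. }
  set (W := push kappa W0 i E).
  assert (UW : ultrafilter_on E W) by (apply ultrafilter_push; auto; apply FW0).
  assert (CW : complete kappa E W) by (apply complete_push; auto; apply FW0).
  assert (BW : forall P : V -> Prop, D1 P -> (big E W P <-> big kappa W0 (fun x => P (i x))))
    by (intros P DP; apply big_push; auto; apply FW0).
  (* The function sending a sequence to its first entry is constant on no large set because [W0] is
     nonprincipal; the default keeps its values in kappa on all sequences. *)
  destruct (ultrapower_exists kappa E W Ck Hw UW CW
    (func E (fun t => ite (app t emp ∈ kappa) (app t emp) emp)))
    as (M & j & cl & Dcl & emb & ult & clmem & clj).
  { apply func_on; dfn. }
  { intros d Hd. rewrite app_func by (dfn || exact Hd).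
    destruct (classic (app d emp ∈ kappa)) as [h|h]; [now rewrite ite_true|rewrite ite_false by exact h].
    exact (emp_kappa kappa U0 Ck FU0). }
  { intros a. apply BW; [dfn|]. assert (B := big_neq kappa W0 FW0 a). revert B.
    apply (big_mono kappa W0 (proj1 FW0)); [dfn|dfn|]. intros x Hx.
    rewrite app_func by (dfn || now apply Hi). rewrite Ei. now rewrite ite_true. }
  (* [E'] is the type of the point represented by [f]: a subset X of kappa is in [E'] exactly when
     j(X) contains that point. *)
  set (typ := fun f E' => forall X, subset X kappa -> (X ∈ E' <-> big E W (fun d => app f d ∈ X))).
  assert (Dtyp : D2 typ) by (unfold typ; dfn).
  assert (typ_big : forall f E' (P : V -> Prop), ultrafilter_on kappa E' -> typ f E' -> D1 P ->
    (big kappa E' P <-> big E W (fun d => P (app f d)))).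
  { intros f E' P UE T DP. unfold big at 1. rewrite (T (sep kappa P)) by now apply sep_subset.
    apply (big_iff_big E W UW); [dfn|dfn|].
    assert (B : big E W (fun d => app f d ∈ kappa)) by (apply T; [now intros x|apply (uf_full _ _ UE)]).
    revert B. apply (big_mono E W UW); [dfn|dfn|]. intros d _ B. rewrite in_sep by dfn. tauto. }
  set (second := fun f => func E (fun d => r (app f d))).
  assert (Dsec : Df1 second) by (unfold second; dfn).
  assert (Fsec : forall f, function_on (second f) E) by (intros f; apply func_on; dfn).
  assert (Asec : forall f d, d ∈ E -> app (second f) d = r (app f d))
    by (intros f d Hd; unfold second; now rewrite app_func by (dfn || exact Hd)).
  (* Second coordinates of all points whose type is good at [b]. Neither the point nor its type is
     fixed in advance, so the set of candidates is not tied to the choice [g]. *)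
  set (point := fun b e => exists f E', pair b E' ∈ good /\ typ f E' /\ e = cl (second f)).
  assert (Dpoint : D2 point) by (unfold point; dfn).
  assert (Oj := j_ordinal M j (embedding_elementary _ _ _ emb) kappa (proj1 Ck)).
  assert (point_ord : forall b e, point b e -> ordinal e).
  { intros b e (f & E' & HG & T & ->). apply (ord_mem _ _ Oj). apply clj; [apply Fsec|].
    destruct (good_elim _ _ HG) as (FE' & _).
    assert (B : big E W (fun d => app f d ∈ kappa)).
    { apply T; [now intros x|apply (uf_full _ _ (proj1 FE'))]. }
    revert B. apply (big_mono E W UW); [dfn|dfn|]. intros d Hd B. rewrite Asec by exact Hd. auto. }
  assert (point_ex : forall b, b ∈ beta -> exists e, point b e).
  { intros b Hbb. destruct (HW0 b Hbb) as (f & Hf & Ef).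
    set (f' := func E (fun t => app f (app t emp))).
    exists (cl (second f')), f', (app g b). split; [now apply Hg|split; [|reflexivity]].
    intros X SX. rewrite Ef, in_push by dfn. rewrite BW by dfn.
    rewrite (big_iff kappa W0 (proj1 FW0) (fun x => app f' (i x) ∈ X) (fun x => app f x ∈ X));
      [tauto|dfn|dfn|].
    intros x Hx. unfold f'. rewrite app_func by (dfn || now apply Hi). now rewrite Ei. }
  set (et := fun b => least (point b)).
  assert (Det : Df1 et) by (unfold et; dfn).
  assert (Het : forall b, b ∈ beta -> point b (et b) /\ forall e, point b e -> ord_le (et b) e).
  { intros b Hbb. destruct (point_ex b Hbb) as (e & He).
    destruct (least_spec (point b) e) as (_ & h1 & h2); [dfn|eauto|exact He|].
    split; [exact h1|]. intros e' He'. apply h2; eauto. }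
  exists M, j, (func beta et). split; [exact emb|split; [|split; [|split]]].
  - exists E, W. auto.
  - split; [now apply func_on|]. intros b e Hbe. apply maps_func in Hbe; [|exact Det].
    destruct Hbe as [Hbb ->]. apply (point_ord b), Het, Hbb.
  - intros a b e e' Ha Hbb Hab. apply maps_func in Ha, Hbb; try exact Det.
    destruct Ha as [Ha ->], Hbb as [Hbb ->].
    destruct (Het b Hbb) as [(f & E' & HG & T & Eb) _].
    destruct (good_elim _ _ HG) as (FE' & _ & h3). destruct (h3 a Hab) as (E'' & HG' & p & Hp & Ep & Bp).
    (* The projection of a least point for [b]. Its type is good at [a], so its second coordinate
       competes in the minimum defining [et a], although it need not come from the ultrafilter
       chosen there. *)
    set (f' := func E (fun d => app p (app f d))).
    assert (Af : forall d, d ∈ E -> app f' d = app p (app f d))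
      by (intros d Hd; unfold f'; now rewrite app_func by (dfn || exact Hd)).
    assert (T' : typ f' E'').
    { intros X SX. rewrite Ep, in_push by dfn. rewrite (typ_big f E') by (dfn || auto; apply FE').
      rewrite (big_iff E W UW (fun d => app f' d ∈ X) (fun d => app p (app f d) ∈ X)); [tauto|dfn|dfn|].
      intros d Hd. now rewrite Af. }
    assert (Lt : cl (second f') ∈ cl (second f)).
    { apply clmem; try apply Fsec. apply (typ_big f E') in Bp; [|apply FE'|exact T|dfn].
      revert Bp. apply (big_mono E W UW); [dfn|dfn|]. intros d Hd B. now rewrite !Asec, Af. }
    rewrite Eb. apply (ord_le_mem_trans _ (cl (second f'))).
    + apply (point_ord b). exists f, E'; auto.
    + apply Het; [exact Ha|]. exists f', E''; auto.
    + exact Lt.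
  - intros b u e Hbu Hbe X. apply maps_func in Hbe; [|exact Det]. destruct Hbe as [Hbb ->].
    apply (function_maps Us beta) in Hbu; [|apply HU]. destruct Hbu as [_ ->].
    destruct (Het b Hbb) as [(f & E' & HG & T & ->) _].
    destruct (good_elim _ _ HG) as (FE' & h2 & _).
    assert (FU := uf_sequence_app kappa beta Us b HU Hbb).
    assert (K : subset X kappa -> (X ∈ app Us b <-> cl (second f) ∈ j X)).
    { intros SX. rewrite (h2 X SX), clj by apply Fsec. rewrite (typ_big f E') by (dfn || auto; apply FE').
      apply (big_iff E W UW); [dfn|dfn|]. intros d Hd. now rewrite Asec. }
    split.
    + intros HX. assert (SX := uf_subset _ _ (proj1 FU) X HX). split; [exact SX|now apply K].
    + intros [SX HX]. now apply K.
Qed.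
End Increasing.

Lemma lt_GP_uf_of_directed (kappa lam lam_plus : V) : measurable kappa -> ordinal lam ->
  is_succ_cardinal lam_plus lam -> RK_directed lam_plus kappa -> lt_GP_uf kappa lam_plus.
Proof.
  intros (Ck & (w & Ew & Hw) & U0 & FU0) Ol Sl dir beta Hb _ Us HU.
  apply is_omegaE in Ew; subst w.
  destruct (pairing_exists kappa U0 Ck FU0) as (q & l & r & Dq & Dl & Dr & Hq & Hl & Hr).
  now apply (increasing_gluing kappa lam lam_plus beta Us U0 Ck Hw FU0 Ol Sl dir Hb HU q l r).
Qed.
End Gluing.

Theorem mainTheorem2 (V : set_structure) (HV : ZFC V)
  (kappa lam lam_plus : V)
  (Hkappa : measurable kappa)
  (Hlam : infinite_cardinal lam)
  (Hlam_le : le_two_power lam kappa)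
  (Hlam_plus : is_succ_cardinal lam_plus lam) :
  ((lt_GP_uf kappa lam_plus <-> GP_uf kappa lam) /\
   (GP_uf kappa lam <-> weak_GP_uf kappa lam) /\
   (weak_GP_uf kappa lam <-> RK_directed lam_plus kappa)) /\
  (ord_le lam kappa ->
   (lt_GP_uf kappa lam_plus <-> lt_GP kappa lam_plus) /\
   (GP_uf kappa lam <-> GP kappa lam) /\
   (weak_GP_uf kappa lam <-> weak_GP kappa lam)).
Proof.
  destruct Hlam as [Cl Il].
  assert (lt_imp : forall via, lt_GP_by via kappa lam_plus -> GP_by via kappa lam)
    by (intros via H; apply H; [apply Hlam_plus|exact Il]).
  assert (weaken : forall via, GP_by via kappa lam -> weak_GP_by via kappa lam).
  { intros via H U HU. destruct (H U HU) as (M & j & eta & h1 & h2 & h3 & _ & h5).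
    exists M, j, eta; auto. }
  assert (forget : forall alpha, GP_uf kappa alpha -> GP kappa alpha).
  { intros alpha H U HU. destruct (H U HU) as (M & j & eta & h1 & _ & h).
    exists M, j, eta. split; [exact h1|split; [exact I|exact h]]. }
  assert (d1 := directed_of_weak_GP_uf kappa lam lam_plus Hkappa Il Hlam_plus).
  assert (d2 := lt_GP_uf_of_directed kappa lam lam_plus Hkappa (proj1 Cl) Hlam_plus).
  assert (w1 := lt_imp (ultrapower_embedding kappa)). assert (w2 := weaken (ultrapower_embedding kappa)).
  split.
  (* [w1], [w2], [d1], [d2] form the cycle (1), (2), (3), (4), (1). *)
  - unfold lt_GP_uf, GP_uf, weak_GP_uf in *. tauto.
  (* For lam <= kappa, [d3] leads from (3') to (4) and thus back to the versions via ultrafilters,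
     each of which implies its unrestricted counterpart. *)
  - intros Ll. assert (d3 := directed_of_weak_GP kappa lam lam_plus Hkappa Il Hlam_plus Ll).
    assert (w3 := lt_imp any_embedding). assert (w4 := weaken any_embedding).
    assert (f1 : lt_GP_uf kappa lam_plus -> lt_GP kappa lam_plus)
      by (intros H b Hb Ib; apply forget, H; auto).
    assert (f2 := forget lam).
    assert (f3 : weak_GP_uf kappa lam -> weak_GP kappa lam).
    { intros H. apply w4, w3, f1, d2, d1, H. }
    unfold lt_GP_uf, GP_uf, weak_GP_uf, lt_GP, GP, weak_GP in *. tauto.
Qed.
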